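(* Let $d$ be a positive integer, and let $\mathrm{S}(\mathbb{P}^2,d;2)$ denote the number of non-split $d$-aCM vector bundles of rank $2$ on $\mathbb{P}^2$ with a $T$-equivariant structure, counted up to isomorphism of vector bundles and up to twist by $\mathcal{O}_{\mathbb{P}^2}(dt)$ with $t\in\mathbb{Z}$. That is, $\mathrm{S}(\mathbb{P}^2,d;2)$ is the number of equivalence classes of non-split $d$-aCM rank $2$ vector bundles $\mathcal{E}$ on $\mathbb{P}^2$ that admit a $T$-equivariant structure, where $\mathcal{E}\sim\mathcal{E}'$ if and only if $\mathcal{E}'\cong\mathcal{E}\otimes\mathcal{O}_{\mathbb{P}^2}(dt)$ as vector bundles for some $t\in\mathbb{Z}$. Then $$\mathrm{S}(\mathbb{P}^2,d;2)=\frac{(d-1)d(d+1)(d+2)}{24}.$$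
   Context: Work over $\mathbb{C}$. $\mathbb{P}^2$ is regarded as a toric variety with its dense torus $T\simeq(\mathbb{C}^\times)^2$. A $T$-equivariant structure on a vector bundle $\mathcal{E}$ on $\mathbb{P}^2$ is a lift of the $T$-action on $\mathbb{P}^2$ to $\mathcal{E}$, i.e. a family of isomorphisms $\Phi_t:t^*\mathcal{E}\to\mathcal{E}$, $t\in T$, satisfying the usual cocycle compatibility. A vector bundle is split if it is isomorphic (as a vector bundle) to a direct sum of line bundles, and non-split otherwise. For a positive integer $d$, a vector bundle $\mathcal{E}$ on $\mathbb{P}^2$ is called $d$-aCM ($d$-arithmetically Cohen–Macaulay) if $\mathrm{H}^1(\mathbb{P}^2,\mathcal{E}\otimes\mathcal{O}_{\mathbb{P}^2}(dt))=0$ for all $t\in\mathbb{Z}$. *)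

(* Defs.v *)
From HB Require Import structures.
From mathcomp Require Import all_boot all_order all_algebra.
From mathcomp Require Import classical_sets cardinality.
From mathcomp Require Import reals complex mpoly.

Set Implicit Arguments.
Unset Strict Implicit.
Unset Printing Implicit Defensive.

Import GRing.Theory.
Local Open Scope classical_set_scope.
Local Open Scope ring_scope.

(* Vector bundles on P^2 are locally free subsheaves of the constant sheaf
   K^r, where K = C(x, y) is the function field of P^2. As P^2 is integral,
   choosing a basis of the generic stalk realizes every locally free sheaf of
   rank r in this way, a morphism of sheaves is determined by the K-linear map
   it induces on generic stalks, and a subsheaf is determined by its stalks at
   closed points. *)

Section ProjectivePlane.
Variable C : fieldType.

(* Nonzero p : P2point stands for [p_0 : p_1 : p_2]; the value 0 is never used:
   every quantification over points below carries p != 0. *)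
Definition P2point := 'rV[C]_3.

(* x = x_1 / x_0 and y = x_2 / x_0 *)
Definition funField := {fraction {mpoly C[2]}}.

Definition dehom (F : {mpoly C[3]}) : funField :=
  FracField.tofrac (F \mPo [tuple 1; 'X_(0 : 'I_2); 'X_(1 : 'I_2)]).

(* The stalk of O(n) at p, embedded in K by s |-> s / x_0 ^ n: the quotients
   F / G of forms with deg F = deg G + n and G(p) != 0. *)
Definition Ostalk (n : int) (p : P2point) : set funField :=
  [set f | exists (k l : nat) (F G : {mpoly C[3]}),
     [/\ F \is k.-homog, G \is l.-homog, (k : int) = (l : int) + n,
         G.@[p ord0] != 0 & f = dehom F / dehom G]].

Section Bundles.
Variable r : nat.

(* p |-> the stalk at p *)
Definition stalks := P2point -> set 'cV[funField]_r.

(* Around every point, on a basic open set D(F), the sheaf is g O^r for some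
   g in GL_r(K), i.e. the columns of g form a local frame. *)
Definition locally_free (E : stalks) : Prop :=
  forall p : P2point, p != 0 ->
  exists (k : nat) (F : {mpoly C[3]}) (g : 'M[funField]_r),
    [/\ F \is k.-homog, F.@[p ord0] != 0, g \in unitmx &
        forall q : P2point, q != 0 -> F.@[q ord0] != 0 ->
          E q = [set g *m w | w in [set w : 'cV[funField]_r |
                                      forall i, Ostalk 0 q (w i 0)]]].

Record vbundle := VBundle {
  vstalk :> stalks;
  vbundleP : locally_free vstalk }.

Definition is_iso (h : 'M[funField]_r) (E F : stalks) : Prop :=
  h \in unitmx /\
  forall p : P2point, p != 0 -> [set h *m v | v in E p] = F p.

Definition isomorphic (E F : stalks) : Prop := exists h, is_iso h E F.

(* The sheaf E (x) O(n). Its stalk is spanned by the products f *: v; since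
   the stalk of O(n) is free of rank 1, these products already form a module. *)
Definition twist (n : int) (E : stalks) : stalks :=
  fun p => [set f *: v | f in Ostalk n p & v in E p].

Definition sections (U : set P2point) (E : stalks) : set 'cV[funField]_r :=
  [set v | forall p : P2point, p != 0 -> U p -> E p v].

Definition chart (i : 'I_3) : set P2point := [set p | p ord0 i != 0].

(* H^1(P^2, E) = 0, computed by Cech cochains on the affine cover of P^2 by the
   three charts. The cocycle condition forces s i i = 0 and s j i = - s i j. *)
Definition H1_vanishes (E : stalks) : Prop :=
  forall s : 'I_3 -> 'I_3 -> 'cV[funField]_r,
    (forall i j, sections (chart i `&` chart j) E (s i j)) ->
    (forall i j k, s i j + s j k = s i k) ->
  exists m : 'I_3 -> 'cV[funField]_r,
    (forall i, sections (chart i) E (m i)) /\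
    (forall i j, s i j = m j - m i).

Definition aCM (d : nat) (E : stalks) : Prop :=
  forall t : int, H1_vanishes (twist ((d : int) * t) E).

End Bundles.

Definition direct_sum (r : nat) (L : 'I_r -> stalks 1) : stalks r :=
  fun p => [set v | forall i, L i p (row i v)].

Definition split_bundle (r : nat) (E : stalks r) : Prop :=
  exists L : 'I_r -> vbundle 1, isomorphic E (direct_sum L).

(* The torus T, a group under the componentwise product of C * C, acts on P^2
   by t [p_0 : p_1 : p_2] = [p_0 : t_1 p_1 : t_2 p_2]. *)
Definition torus : set (C * C) := [set t | t.1 != 0 /\ t.2 != 0].

Definition act (t : C * C) (p : P2point) : P2point :=
  \row_i (p ord0 i * [tuple 1; t.1; t.2]`_i).

(* f(x, y) |-> f(t_1 x, t_2 y). For t in the torus this does not depend on the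
   fraction representing f and is an automorphism of the field K. *)
Definition scale_vars (t : C * C) (P : {mpoly C[2]}) : {mpoly C[2]} :=
  P \mPo [tuple t.1 *: 'X_(0 : 'I_2); t.2 *: 'X_(1 : 'I_2)].

Definition pull_fun (t : C * C) (f : funField) : funField :=
  FracField.tofrac (scale_vars t \n_(repr f)) /
  FracField.tofrac (scale_vars t \d_(repr f)).

Definition pullback (r : nat) (t : C * C) (E : stalks r) : stalks r :=
  fun p => [set map_mx (pull_fun t) v | v in E (act t p)].

(* F(t_1, t_2, x, y) at a fixed t *)
Definition specialize (t : C * C) (F : {mpoly C[4]}) : {mpoly C[2]} :=
  F \mPo [tuple t.1%:MP; t.2%:MP; 'X_(0 : 'I_2); 'X_(1 : 'I_2)].

(* The entries of Phi are rational functions N / D of (t, x, y), with D not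
   identically zero for any fixed t in T. If moreover each Phi t is an
   isomorphism from the pullback of E by t to E, this says that Phi is an
   isomorphism of vector bundles on T x P^2: in local frames the entries of Phi
   and its inverse are then rational functions on T x P^2 which are regular on
   each slice {t} x P^2, hence regular, the local rings being factorial. *)
Definition algebraic_family (r : nat) (Phi : C * C -> 'M[funField]_r) : Prop :=
  exists (N : 'M[{mpoly C[4]}]_r) (D : {mpoly C[4]}),
  forall t, torus t ->
    specialize t D != 0 /\
    forall i j, Phi t i j = FracField.tofrac (specialize t (N i j)) /
                            FracField.tofrac (specialize t D).

Definition equivariant_structure (r : nat) (E : stalks r)
    (Phi : C * C -> 'M[funField]_r) : Prop :=
  [/\ algebraic_family Phi,
      forall t, torus t -> is_iso (Phi t) (pullback t E) E &
      forall s t, torus s -> torus t ->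
        Phi (s * t) = Phi t *m map_mx (pull_fun t) (Phi s)].

Definition admits_equivariant_structure (r : nat) (E : stalks r) : Prop :=
  exists Phi, equivariant_structure E Phi.

Definition equiv_up_to_twist (r d : nat) (E F : stalks r) : Prop :=
  exists t : int, isomorphic F (twist ((d : int) * t) E).

(* The set of equivalence classes whose cardinality is S(P^2, d; r). *)
Definition toric_aCM_classes (d r : nat) : set (set (vbundle r)) :=
  [set [set F : vbundle r | equiv_up_to_twist d E F] | E in
    [set E : vbundle r | [/\ ~ split_bundle E, aCM d E &
                             admits_equivariant_structure E]]].

End ProjectivePlane.

Arguments toric_aCM_classes C d r : clear implicits.

(* Main.v *)
(* The cocycle condition makes an equivariant structure [Phi] a coboundary over
   the function field K, so that E may be assumed to be a T-stable subsheaf of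
   K^2. It is then determined, by transitivity of T on orbits and Hartogs
   extension at the fixed points, by its stalks at one point of each coordinate
   line [x_i = 0]; there it is described by a line of C^2 and two integers, in
   the spirit of Klyachko's filtrations. Either the three lines can be adapted
   to a decomposition of C^2 and E splits, or, up to isomorphism, E is the kernel
   Syz_b(n) of (x_0^b_0, x_1^b_1, x_2^b_2) : O(n - b_0) + O(n - b_1) + O(n - b_2)
   -> O(n) with all b_i > 0. The latter is indecomposable, because endomorphisms
   lift to graded 3 x 3 matrices having (x_i^b_i) as an eigenvector. The graded
   module H^1_*(Syz_b(n)) is C[x_0, x_1, x_2] / (x_i^b_i) with a shift by n; hence
   it determines b and n, and H^1(Syz_b(n)) = 0 unless
   0 <= n <= sum_i (b_i - 1). Therefore the classes correspond to the (b, n) with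
   sum_i (b_i - 1) < n < d, that is, to the quadruples of natural numbers
   (b_0 - 1, b_1 - 1, b_2 - 1, n - 1 - sum_i (b_i - 1)) of sum at most d - 2. *)

Require Import Defs.
From HB Require Import structures.
From mathcomp Require Import all_boot all_order all_algebra.
From mathcomp Require Import boolp classical_sets cardinality.
From mathcomp Require Import reals complex mpoly ring zify.

Set Implicit Arguments.
Unset Strict Implicit.
Unset Printing Implicit Defensive.

Import GRing.Theory.
Local Open Scope classical_set_scope.
Local Open Scope ring_scope.

(** * Regular functions on basic open sets *)

Section AffineNullstellensatz.
Variable C : closedFieldType.
Implicit Types (a b : C) (c : {poly C}) (P Q A B G D : {poly {poly C}}).

(** Since stalks are given by quotients of forms, cohomology is computed by hand from one fact: a
    function regular off [G = 0] is [F / G ^ k] with [F] a form. Hartogs extension, [H^0(O(n))],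
    [H^1(O(n)) = 0] and the exact sequence of a syzygy bundle follow on explicit cochains. On a line
    [x_i = 0], elimination over the valuation ring leaves a multiplier modulo [u ^ b], with [u] a
    uniformizer. It is constant because the torus is transitive on the open line, while the
    stabilizer of a point scales [u ^ m], [m > 0], by a nontrivial character and so kills all higher
    terms. Syzygies appear because three pairwise independent linear forms in two variables satisfy
    one relation with nonzero coefficients; rescaled, they sum to zero. From [H^1_*], [b_i] is read
    as the least power of [x_i] acting by zero, and [n] from the lowest degree. The range of [n]
    with nonzero [H^1] starts at 0, so the residue class of [n] modulo [d] misses it only if the
    remainder of [n] lies beyond its other end. *)

Definition evx a P : {poly C} := map_poly (horner_eval a) P.

Lemma evxM a P Q : evx a (P * Q) = evx a P * evx a Q.
Proof. exact: rmorphM. Qed.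
Lemma evxD a P Q : evx a (P + Q) = evx a P + evx a Q.
Proof. exact: rmorphD. Qed.
Lemma evxC a c : evx a c%:P = (c.[a])%:P.
Proof. by rewrite /evx map_polyC. Qed.
Lemma evxX a P n : evx a (P ^+ n) = evx a P ^+ n.
Proof. exact: rmorphXn. Qed.
Lemma evxZ a c P : evx a (c *: P) = c.[a] *: evx a P.
Proof. by rewrite -[c *: P]mul_polyC evxM evxC mul_polyC. Qed.

Lemma evx_eq0 a P : evx a P = 0 -> exists Q, P = ('X - a%:P)%:P * Q.
Proof.
move=> P0; exists (map_poly (fun p => p %/ ('X - a%:P)) P).
apply/polyP=> i; rewrite coefCM coef_map_id0 ?div0p // mulrC divpK //.
rewrite dvdp_XsubCl /root; apply/eqP.
by have := congr1 (fun q : {poly C} => q`_i) P0; rewrite coef_map coef0.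
Qed.

Lemma evx_neq0 P : P != 0 -> exists a, evx a P != 0.
Proof.
rewrite -lead_coef_eq0 => /closed_nonrootP [a ra]; exists a.
apply/negP=> /eqP /(congr1 (fun q : {poly C} => q`_(size P).-1)).
by rewrite coef_map coef0 => e; move: ra; rewrite /root [_.[a]]e eqxx.
Qed.

(** Over an algebraically closed field: as a polynomial in y over [C[x]], [Q] has content 1. Here
    [evx a] substitutes [a] for the inner variable x. *)
Definition primx Q := forall a, evx a Q != 0.

(** The content is split off one factor [x - a] at a time; each factor lowers the degree of the
    leading coefficient, which bounds the recursion. *)
Lemma primx_decomp P : P != 0 ->
  exists c Q, [/\ c != 0, primx Q & P = c%:P * Q].
Proof.
move: {2}(size (lead_coef P)) (leqnn (size (lead_coef P))) => n.
elim: n P => [|n IH] P sz nzP.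
  by move: sz; rewrite leqn0 size_poly_eq0 lead_coef_eq0 (negPf nzP).
have [pP|] := pselect (primx P); first by exists 1, P; split; rewrite ?oner_neq0 ?mul1r.
move=> /existsNP [a /negP]; rewrite negbK => /eqP /evx_eq0 [Q eQ].
have nzQ : Q != 0 by apply: contra_neq nzP => Q0; rewrite eQ Q0 mulr0.
have [|c [R [nc pR eR]]] := IH Q _ nzQ.
  move: sz; rewrite eQ lead_coefM lead_coefC mulrC.
  by rewrite size_Mmonic ?lead_coef_eq0 ?monicXsubC // size_XsubC addn2.
exists (('X - a%:P) * c), R; split=> //.
  by rewrite mulf_neq0 // polyXsubC_eq0.
by rewrite eQ eR polyCM mulrA.
Qed.

(** Gauss's lemma: a factor [x - a] of [c] divides [D * Q], hence [D], because [evx a Q] is nonzero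
    in the domain [C[y]]. *)
Lemma primx_dvd c Q B D : c != 0 -> primx Q -> c%:P * B = D * Q ->
  exists D', B = D' * Q.
Proof.
move: {2}(size c) (leqnn (size c)) => n.
elim: n c D => [|n IH] c D sz nzc pQ e.
  by move: sz; rewrite leqn0 size_poly_eq0 (negPf nzc).
have [/size_poly1P [k nk ck]|/closed_rootP [a /factor_theorem [c' ec]]] := boolP (size c == 1%N).
  exists ((k^-1)%:P%:P * D); rewrite -mulrA -e ck mulrA -!polyCM mulVf //.
  by rewrite !mul1r.
have nc' : c' != 0 by apply: contra_neq nzc => c0; rewrite ec c0 mul0r.
have : evx a D * evx a Q = 0.
  by rewrite -evxM -e evxM evxC ec hornerM hornerXsubC subrr mulr0 mul0r.
move/eqP; rewrite mulf_eq0 (negPf (pQ a)) orbF => /eqP /evx_eq0 [D' eD].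
apply: (IH c' D') => //.
  by move: sz; rewrite ec size_Mmonic ?monicXsubC // size_XsubC addn2.
apply: (mulfI (x := ('X - a%:P)%:P)); first by rewrite polyC_eq0 polyXsubC_eq0.
by transitivity (c%:P * B); [rewrite ec polyCM; ring | rewrite e eD; ring].
Qed.

(** The exponent [n] bounds the number of roots of [p] counted with multiplicity, and each of them
    is matched with one factor [g]. *)
Lemma poly_roots_dvd (p g : {poly C}) n : p != 0 -> (size p <= n.+1)%N ->
  (forall b, root p b -> root g b) -> p %| g ^+ n.
Proof.
move=> np sz rt; have [rs ers] := closed_field_poly_normal p.
have nl : lead_coef p != 0 by rewrite lead_coef_eq0.
have szr : (size rs <= n)%N by move: sz; rewrite ers size_scale // size_prod_XsubC ltnS.
rewrite ers dvdpZl // -(subnK szr) exprD dvdp_mull //.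
have : forall b, b \in rs -> root g b.
  by move=> b br; apply: rt; rewrite ers rootZ // root_prod_XsubC.
elim: rs {ers szr} => [|r rs IH] h; first by rewrite big_nil expr0.
rewrite big_cons /= exprS dvdp_mul ?dvdp_XsubCl ?h ?mem_head //.
by apply: IH => b br; rewrite h // inE br orbT.
Qed.

Lemma zeros_primx_dvd Q G : primx Q ->
  (forall a b, root (evx a Q) b -> root (evx a G) b) ->
  exists k D, G ^+ k = D * Q.
Proof.
move=> pQ z; exists (size Q); set k := size Q.
have nQ : Q != 0 by apply/eqP => Q0; have := pQ 0; rewrite Q0 /evx rmorph0 eqxx.
have nl : lead_coef Q != 0 by rewrite lead_coef_eq0.
have e := Pdiv.Idomain.divp_eq (G ^+ k) Q.
set m := scalp _ _ in e; set D := (_ %/ _) in e; set R := (_ %% _) in e.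
(* If [R] were nonzero, then at a value [x = a] killing neither [R] nor the leading coefficient of
   [Q], the polynomial [Q(a, y)] of full degree would divide [G(a, y) ^ k], hence [R(a, y)], whose
   degree is smaller. *)
have R0 : R = 0.
  apply/eqP/negPn/negP => nR.
  have : lead_coef Q *: R != 0 by rewrite -mul_polyC mulf_neq0 ?polyC_eq0.
  move=> /evx_neq0 [a]; rewrite evxZ -mul_polyC mulf_eq0 polyC_eq0 negb_or => /andP [la Ra].
  have szQ : size (evx a Q) = size Q.
    by rewrite /evx size_map_poly_id0.
  have dv : evx a Q %| evx a R.
    have /dvdp_addr <- : evx a Q %| evx a D * evx a Q by rewrite dvdp_mull.
    rewrite -evxM -evxD -e evxZ evxX dvdpZr ?horner_exp ?expf_neq0 //.
    apply: poly_roots_dvd; rewrite ?szQ //; exact: z.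
  have := dvdp_leq Ra dv; rewrite leqNgt szQ => /negP; apply.
  by rewrite (leq_ltn_trans (size_poly _ _)) // ltn_modp.
rewrite R0 addr0 -mul_polyC in e.
have [D' eD] := primx_dvd (expf_neq0 m nl) pQ e.
by exists D'.
Qed.

(* [P / Q] regular wherever [G] does not vanish: the denominators of [P / Q]
   form an ideal [I], and [G ^+ k] is found in it. *)
Lemma nullstellensatz_denominator P Q G : Q != 0 ->
  (forall a b, ~~ root (evx a G) b ->
     exists A B, ~~ root (evx a B) b /\ A * Q = P * B) ->
  exists k R, P * G ^+ k = R * Q.
Proof.
move=> nQ reg; pose I B := exists A, A * Q = P * B.
have ID B B' : I B -> I B' -> I (B + B').
  by move=> [A e] [A' e']; exists (A + A'); rewrite mulrDl e e' mulrDr.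
have IM B D : I B -> I (D * B).
  by move=> [A e]; exists (D * A); rewrite -mulrA e mulrCA.
have IQ : I Q by exists P.
(* Over [C(x)] the ideal [I] is generated by [B0]; its primitive part [Q1] therefore divides every
   denominator. *)
have [B0 [nB0 IB0 minB]] : exists B0, [/\ B0 != 0, I B0 & forall B, I B -> B != 0 -> (size B0 <= size B)%N].
  have exn : exists n, `[<exists B, [/\ B != 0, I B & size B = n]>].
    by exists (size Q); apply/asboolP; exists Q.
  case: (ex_minnP exn) => n /asboolP [B [nB IB sB]] mn; exists B; split => // B' IB' nB'.
  by rewrite sB; apply: mn; apply/asboolP; exists B'.
have [c [Q1 [nc pQ1 eB0]]] := primx_decomp nB0.
have dvdI B : I B -> exists D, B = D * Q1.
  move=> IB; have e := Pdiv.Idomain.divp_eq B B0.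
  set m := scalp _ _ in e; set D := (_ %/ _) in e; set R := (_ %% _) in e.
  have R0 : R = 0.
    apply/eqP/negPn/negP => nR.
    have IR : I R.
      have -> : R = ((lead_coef B0 ^+ m)%:P) * B + (- D) * B0.
        by rewrite mul_polyC e mulNr addrAC subrr add0r.
      by apply: ID; apply: IM.
    by have := minB _ IR nR; rewrite leqNgt ltn_modp nB0.
  rewrite R0 addr0 -mul_polyC eB0 mulrA in e.
  by apply: (primx_dvd _ pQ1 e); rewrite expf_neq0 // lead_coef_eq0 -eB0.
have [k0 [D0 eG]] : exists k D, G ^+ k = D * Q1.
  apply: zeros_primx_dvd => // a b rQ1; apply/negPn/negP => /reg [A [B [rB e]]].
  have [D eB] : exists D, B = D * Q1 by apply: dvdI; exists A.
  by move: rB; rewrite eB evxM rootM rQ1 orbT.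
(* Among the elements [c Q1 G ^ k] of [I], one with [c] of least degree is taken. If [c] is
   constant, a power of [G] lies in [I], since [Q1] divides a power of [G]. *)
have exn : exists n, `[<exists c k, [/\ c != 0, I (c%:P * (Q1 * G ^+ k)) & size c = n]>].
  exists (size c); apply/asboolP; exists c, 0%N; split=> //.
  by rewrite expr0 mulr1 -eB0.
case: (ex_minnP exn) => n /asboolP [c' [k [nc' Ic' sc']]] mn.
have [/size_poly1P [l nl ec]|/closed_rootP [a /factor_theorem [c2 ec]]] := boolP (size c' == 1%N).
  have [A eA] : I (G ^+ (k0 + k)).
    have -> : G ^+ (k0 + k) = (D0 * (l^-1)%:P%:P) * (c'%:P * (Q1 * G ^+ k)).
      by rewrite ec -mulrA [_%:P%:P * (_ * _)]mulrA -!polyCM mulVf // mul1r mulrA exprD eG.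
    exact: IM.
  by exists (k0 + k)%N, A.
set X := ('X - a%:P) in ec.
have nX : X%:P != 0 by rewrite polyC_eq0 polyXsubC_eq0.
have nc2 : c2 != 0 by apply: contra_neq nc' => c0; rewrite ec c0 mul0r.
have notI k' : ~ I (c2%:P * (Q1 * G ^+ k')).
  move=> Ik; have : (n <= size c2)%N by apply: mn; apply/asboolP; exists c2, k'.
  by rewrite -sc' ec size_Mmonic ?monicXsubC // size_XsubC addn2 ltnn.
set B1 := c2%:P * (Q1 * G ^+ k).
have eB1 : c'%:P * (Q1 * G ^+ k) = X%:P * B1.
  by rewrite ec polyCM /B1 [RHS]mulrA [X%:P * _]mulrC.
move: (Ic') => [A0]; rewrite eB1 => eA0.
have nP : P != 0.
  by apply/eqP => P0; apply: (notI 0%N); exists 0; rewrite P0 !mul0r.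
have nA0 : evx a A0 != 0.
  apply/eqP => /evx_eq0 [A1 eA1]; apply: (notI k); exists A1.
  by apply: (mulfI nX); rewrite mulrA -eA1 eA0 mulrCA.
(* A root [a] of [c'] forces every denominator to vanish on the line [x = a]. Regularity off [G = 0]
   then makes [x - a] divide [G], and this factor can replace the one in [c'], against
   minimality. *)
have van B : I B -> evx a B = 0.
  move=> [A eA]; have : evx a (A0 * B) = 0.
    suff -> : A0 * B = X%:P * (A * B1).
      by rewrite evxM evxC hornerXsubC subrr mul0r.
    apply: (mulfI nQ); apply: (mulfI nP).
    transitivity (P * B * (A0 * Q)); first by ring.
    by rewrite eA0 -eA; ring.
  by move/eqP; rewrite evxM mulf_eq0 (negPf nA0) => /eqP.
have : evx a G = 0.
  apply/eqP/negPn/negP => /closed_nonrootP [b /reg [A [B [rB e]]]].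
  by move: rB; rewrite van ?root0 //; exists A.
move=> /evx_eq0 [G' eG']; exfalso; apply: (notI k.+1).
have -> : c2%:P * (Q1 * G ^+ k.+1) = G' * (c'%:P * (Q1 * G ^+ k)).
  have -> : G ^+ k.+1 = X%:P * G' * G ^+ k by rewrite exprS -eG'.
  by rewrite eB1 /B1; ring.
exact: IM.
Qed.

End AffineNullstellensatz.

(** * Polynomials in several variables *)

Section MPolyComplements.

Lemma mpoly_rmorph_ext n (R : comNzRingType) (S : comNzRingType)
    (f g : {rmorphism {mpoly R[n]} -> S}) :
  (forall c, f c%:MP = g c%:MP) -> (forall i, f 'X_i = g 'X_i) -> f =1 g.
Proof.
move=> fgC fgX; elim/mpolyind=> [|c m p _ _ IH]; first by rewrite !rmorph0.
rewrite !rmorphD IH -mul_mpolyC !rmorphM fgC mpolyXE_id !rmorph_prod.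
by congr (_ * _ + _); apply: eq_bigr => i _; rewrite !rmorphXn fgX.
Qed.

Lemma mpoly_comp_ext n k (R : comNzRingType) (S : comNzRingType)
    (lq : n.-tuple {mpoly R[k]}) (f : {rmorphism {mpoly R[k]} -> S})
    (g : {rmorphism {mpoly R[n]} -> S}) p :
  (forall c, f c%:MP = g c%:MP) -> (forall i : 'I_n, f lq`_i = g 'X_i) ->
  f (p \mPo lq) = g p.
Proof.
move=> fgC fgX; elim/mpolyind: p=> [|c m p _ _ IH].
  by rewrite comp_mpoly0 !rmorph0.
rewrite comp_mpolyD !rmorphD IH comp_mpolyZ comp_mpolyX -!mul_mpolyC !rmorphM fgC.
rewrite mpolyXE_id !rmorph_prod.
by congr (_ * _ + _); apply: eq_bigr => i _; rewrite !rmorphXn -fgX (tnth_nth 0).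
Qed.

Lemma comp_mpolyA n k l (R : comNzRingType) (lq : n.-tuple {mpoly R[k]})
    (lr : k.-tuple {mpoly R[l]}) p :
  (p \mPo lq) \mPo lr = p \mPo [tuple of [seq q \mPo lr | q <- lq]].
Proof.
apply: (@mpoly_comp_ext n k R {mpoly R[l]} lq (comp_mpoly lr)
  (comp_mpoly [tuple of [seq q \mPo lr | q <- lq]])) => [c|i].
  by rewrite /= !comp_mpolyC.
by rewrite /= comp_mpolyXU /= (nth_map 0) // size_tuple.
Qed.

Lemma meval_comp n k (R : comNzRingType) (lq : n.-tuple {mpoly R[k]})
    (v : 'I_k -> R) (w : 'I_n -> R) p :
  (forall i : 'I_n, (lq`_i).@[v] = w i) -> (p \mPo lq).@[v] = p.@[w].
Proof.
move=> vw; rewrite comp_mpoly_meval; apply: meval_eq => i.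
by rewrite -vw (tnth_nth 0).
Qed.

Lemma mcoeff_muni n (R : comNzRingType) (p : {mpoly R[n.+1]}) (m : 'X_{1..n.+1}) :
  (muni p)`_(m ord_max) @_([multinom m (widen_ord (leqnSn n) i) | i < n]) = p@_m.
Proof.
rewrite muniE coef_sum raddf_sum /=.
transitivity (\sum_(k <- msupp p) p@_k * (k == m)%:R).
  apply: eq_bigr => k _; rewrite coefZ coefXn eq_sym; case: eqVneq => [e|ne].
    rewrite mulr1 mcoeffZ mcoeffX; congr (_ * (_ : bool)%:R).
    apply/eqP/eqP => [/mnmP h|-> //]; apply/mnmP => i.
    case: (unliftP ord_max i) => [j|] -> //.
    have := h j; rewrite !mnmE.
    suff -> : widen_ord (leqnSn n) j = lift ord_max j by [].
    by apply/val_inj; rewrite /= /bump leqNgt ltn_ord.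
  rewrite mulr0 mcoeff0; case: eqVneq => [e|_]; last by rewrite mulr0.
  by rewrite e eqxx in ne.
rewrite -[RHS](mulr1 p@_m).
have [mp|mp] := boolP (m \in msupp p); last first.
  rewrite (memN_msupp_eq0 mp) mul0r big_seq big1 // => k kp.
  by case: eqVneq => [e|_]; rewrite ?mulr0 // -e kp in mp *.
rewrite (bigD1_seq m) ?msupp_uniq //= eqxx big1 ?addr0 // => k /negPf ->.
by rewrite mulr0.
Qed.

(** All coordinates are asked to be nonzero because the points found this way have to lie in the
    open torus orbit or, after restriction, in the open orbit of a coordinate line. *)
Lemma mpoly_nonroot n (C : closedFieldType) (p : {mpoly C[n]}) : p != 0 ->
  exists v : 'I_n -> C, (forall i, v i != 0) /\ p.@[v] != 0.
Proof.
elim: n p => [|n IH] p np.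
  exists (fun=> 1); split=> [i|]; first by rewrite oner_neq0.
  by move: np; rewrite [p]nvar0_mpolyC mevalC mpolyC_eq0.
have [m] : exists m, p@_m != 0.
  apply: contrapT => h; move/eqP: np; apply; apply/mpolyP => m.
  by rewrite mcoeff0; apply/eqP/negPn/negP => hm; apply: h; exists m.
rewrite -mcoeff_muni; set q := (muni p)`_ _ => nqm.
have nq : q != 0 by apply: contra_neq nqm => ->; rewrite mcoeff0.
have [v [nv qv]] := IH q nq.
pose f := map_poly (meval v) (muni p).
(* The factor ['X] keeps the chosen last coordinate away from 0. *)
have nf : 'X * f != 0.
  rewrite mulf_neq0 ?polyX_eq0 //; apply/eqP => /polyP /(_ (m ord_max)).
  by rewrite coef0 coef_map /=; apply/eqP.
have /closed_nonrootP [x] := nf; rewrite rootM negb_or rootX => /andP [nx fx].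
pose w (i : 'I_n.+1) := match split (cast_ord (esym (addn1 n)) i) with
  | inl j => v j | inr _ => x end.
exists w; split=> [i|]; first by rewrite /w; case: split => // j; rewrite nv.
suff -> : p.@[w] = f.[x] by [].
rewrite /f; apply/esym.
apply: (@mpoly_rmorph_ext n.+1 C C (horner_eval x \o map_poly (meval v) \o @muni n C) (meval w)) => [c|i] /=.
  by rewrite /horner_eval /muni mmapC /= map_polyC /= !mevalC hornerC.
rewrite /horner_eval /muni mmapX mmap1U mevalXU /w.
case: split => j /=; first by rewrite map_polyC /= mevalXU hornerC.
by rewrite map_polyX hornerX.
Qed.
End MPolyComplements.

(** * Forms in three variables and their dehomogenization *)

Section Forms.
Variable C : closedFieldType.
Local Notation S := {mpoly C[3]}.
Local Notation A2 := {mpoly C[2]}.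
Local Notation K := (funField C).

(** The passage to nested one-variable polynomials, where pseudo-division in the outer variable is
    available. *)
Definition toXY (P : A2) : {poly {poly C}} :=
  mmap (polyC \o polyC) (fun i : 'I_2 => if i == 0 then 'X%:P else 'X) P.

Lemma toXY_evx a b (P : A2) v : v 0 = a -> v 1 = b ->
  (evx a (toXY P)).[b] = P.@[v].
Proof.
move=> va vb.
apply: (@mpoly_rmorph_ext 2 C C (horner_eval b \o map_poly (horner_eval a) \o
   mmap (polyC \o polyC) (fun i : 'I_2 => if i == 0 then 'X%:P else 'X)) (meval v)) => [c|i] /=.
  by rewrite mmapC /= !map_polyC /= /horner_eval !hornerC mevalC.
rewrite mmapX mmap1U mevalXU.
case: (unliftP 0 i) => [j|] -> /=; last by rewrite map_polyC /= /horner_eval hornerC hornerX.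
by rewrite map_polyX /horner_eval hornerX ord1 -vb; congr v; apply/val_inj.
Qed.

Definition ofXY (P : {poly {poly C}}) : A2 :=
  (map_poly (horner_eval ('X_0 : A2) \o map_poly (@mpolyC 2 C)) P).['X_1].

Lemma ofXYM P Q : ofXY (P * Q) = ofXY P * ofXY Q.
Proof. by rewrite /ofXY rmorphM hornerM. Qed.

Lemma toXYK P : ofXY (toXY P) = P.
Proof.
apply: (@mpoly_rmorph_ext 2 C A2 (horner_eval 'X_1 \o map_poly (horner_eval ('X_0 : A2) \o map_poly (@mpolyC 2 C)) \o
   mmap (polyC \o polyC) (fun i : 'I_2 => if i == 0 then 'X%:P else 'X)) idfun) => [c|i] /=.
  by rewrite mmapC /= !map_polyC /= map_polyC /= /horner_eval !hornerC.
rewrite mmapX mmap1U.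
case: (unliftP 0 i) => [j|] -> /=.
  by rewrite map_polyX /horner_eval hornerX ord1; congr ('X_ _); apply/val_inj.
by rewrite map_polyC /= map_polyX /horner_eval hornerC hornerX.
Qed.

Lemma nullstellensatz_denominator2 (P Q G : A2) : Q != 0 ->
  (forall v, G.@[v] != 0 -> exists A B, B.@[v] != 0 /\ A * Q = P * B) ->
  exists k R, P * G ^+ k = R * Q.
Proof.
move=> nQ reg.
have toM P' Q' : toXY (P' * Q') = toXY P' * toXY Q' by exact: rmorphM.
have [||k [R e]] := @nullstellensatz_denominator C (toXY P) (toXY Q) (toXY G).
- by apply: contra_neq nQ => e; rewrite -(toXYK Q) e /ofXY rmorph0 horner0.
- move=> a b; set v := fun i : 'I_2 => if i == 0 then a else b.
  rewrite /root (@toXY_evx _ _ _ v) // => /reg [A [B [nB e]]].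
  exists (toXY A), (toXY B); rewrite /root (@toXY_evx _ _ _ v) //; split=> //.
  by rewrite -!toM e.
exists k, (ofXY R).
rewrite -[P in LHS]toXYK -[G in LHS]toXYK -[Q in RHS]toXYK -ofXYM -e ofXYM; congr (_ * _).
by rewrite /ofXY rmorphXn /= hornerE.
Qed.

Definition dehomP (F : S) : A2 := F \mPo [tuple 1; 'X_(0 : 'I_2); 'X_(1 : 'I_2)].

Lemma ord3P (i : 'I_3) : [\/ i = 0, i = 1 | i = 2%:R].
Proof.
by case: i => [[|[|[|i]]] hi] //; [apply: Or31|apply: Or32|apply: Or33]; apply/val_inj.
Qed.

Definition mkpt (v : 'I_2 -> C) : 'rV[C]_3 := \row_i [tuple 1; v 0; v 1]`_i.

Lemma meval_dehomP (F : S) v : (dehomP F).@[v] = F.@[mkpt v ord0].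
Proof.
apply: meval_comp => i; rewrite !mxE.
by case: (ord3P i) => -> /=; rewrite ?mevalXU ?meval1.
Qed.

Lemma meval_homog n (F : {mpoly C[n]}) k (v : 'I_n -> C) l : F \is k.-homog ->
  F.@[fun i => l * v i] = l ^+ k * F.@[v].
Proof.
move=> /dhomogP hF; rewrite !mevalE mulr_sumr big_seq [RHS]big_seq.
apply: eq_bigr => m /hF mk; rewrite mulrCA; congr (_ * _).
have -> : k = (\sum_i m i)%N by rewrite -mdegE; apply/esym/mk.
rewrite (big_morph _ (exprD l) (expr0 l)) -big_split /=.
by apply: eq_bigr => i _; rewrite exprMn.
Qed.

(** A nonzero form is nonzero at some point with all coordinates nonzero, which can be rescaled to
    have first coordinate 1. *)
Lemma dehomP_inj0 (F : S) k : F \is k.-homog -> dehomP F = 0 -> F = 0.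
Proof.
move=> hF d0; apply/eqP/negPn/negP => /mpoly_nonroot [v [nv]].
have -> : F.@[v] = F.@[fun i => v 0 * (v i / v 0)].
  by apply: meval_eq => i; rewrite mulrC divfK.
rewrite (meval_homog _ _ hF).
set w := fun j : 'I_2 => v (lift 0 j) / v 0.
have -> : F.@[fun i => v i / v 0] = F.@[mkpt w ord0].
  apply: meval_eq => i; rewrite mxE.
  by case: (ord3P i) => -> /=; rewrite ?divff // /w; congr (v _ / _); apply/val_inj.
by rewrite -meval_dehomP d0 meval0 mulr0 eqxx.
Qed.

Lemma homogX n (i : 'I_n) : ('X_i : {mpoly C[n]}) \is 1.-homog.
Proof. by rewrite dhomogX; apply/eqP/mdeg1. Qed.

Lemma homogXn n (i : 'I_n) k : ('X_i ^+ k : {mpoly C[n]}) \is k.-homog.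
Proof. by have := dhomogMn k (homogX i); rewrite mul1n. Qed.

(** The degree [k] need not be minimal: forms are brought to a common degree by powers of [x_0],
    which dehomogenize to 1. *)
Lemma homogenize (P : A2) : exists k (F : S), F \is k.-homog /\ dehomP F = P.
Proof.
elim/mpolyind: P => [|c m P _ _ [k [F [hF dF]]]].
  by exists 0%N, 0; rewrite rpred0 /dehomP comp_mpoly0.
pose M : S := c *: ('X_1 ^+ m 0 * 'X_2%:R ^+ m 1).
have hM : M \is (m 0%R + m 1%R).-homog by rewrite rpredZ // dhomogM ?homogXn.
have dX k' : dehomP ('X_0 ^+ k') = 1.
  by rewrite /dehomP rmorphXn /= comp_mpolyXU expr1n.
have dM : dehomP M = c *: 'X_[m].
  rewrite /dehomP comp_mpolyZ rmorphM !rmorphXn /= !comp_mpolyXU /=.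
  rewrite [X in _ = _ *: X]mpolyXE_id 2!big_ord_recl big_ord0 mulr1.
  by congr (_ *: (_ * 'X_ _ ^+ m _)); apply/val_inj.
exists (k + (m 0%R + m 1%R))%N, (M * 'X_0 ^+ k + F * 'X_0 ^+ (m 0%R + m 1%R)); split.
  apply: rpredD; last by rewrite dhomogM ?homogXn.
  by rewrite addnC dhomogM ?homogXn.
have dMM U V : dehomP (U * V) = dehomP U * dehomP V by exact: rmorphM.
by rewrite /dehomP comp_mpolyD -!/(dehomP _) !dMM !dX !mulr1 dM dF.
Qed.

Lemma fracE (R : idomainType) (f : {fraction R}) :
  f = FracField.tofrac \n_(repr f) / FracField.tofrac \d_(repr f).
Proof.
have nd : FracField.tofrac \d_(repr f) != 0 by rewrite tofrac_eq0 denom_ratioP.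
apply: (mulIf nd); rewrite divfK //.
rewrite -[f in LHS]reprK; set x := repr f.
unlock FracField.tofrac; rewrite -[LHS]FracField.pi_mul.
apply/eqmodP; rewrite /= FracField.equivfE /FracField.mulf.
rewrite !numden_Ratio ?mulr1 ?oner_neq0 ?denom_ratioP //.
by rewrite /x !reprK mulrC.
Qed.

End Forms.

(** * Restriction to coordinate lines; points and lines as places *)

Section Restriction.
Variable C : closedFieldType.
Local Notation S := {mpoly C[3]}.
Implicit Types (F G : S) (i j : 'I_3).

Lemma mpolyX_neq0 n (m : 'X_{1..n}) : 'X_[m] != 0 :> {mpoly C[n]}.
Proof. by rewrite -msize_poly_eq0 msizeX. Qed.

Lemma mcoeff_XnM n (i : 'I_n) k (G : {mpoly C[n]}) m :
  ('X_i ^+ k * G)@_m = if (k <= m i)%N then G@_(m - U_(i) *+ k) else 0.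
Proof.
rewrite mulrC mpolyXn; case: leqP => h.
  rewrite -[m in LHS](submK (m := (U_(i) *+ k)%MM)) 1?addmC ?mcoeffMX //.
  apply/mnm_lepP => j; rewrite mulmnE mnm1E.
  by case: eqVneq => [<-|]; rewrite ?mul1n ?mul0n.
apply/memN_msupp_eq0/negP => /(msuppM_le) /allpairsP [[m1 m2] /= [_]].
rewrite msuppX inE => /eqP -> e; move: h.
by rewrite e mnmDE mulmnE mnm1E eqxx mul1n ltnNge leq_addl.
Qed.

Lemma Xn_dvdP n (i : 'I_n) k (F : {mpoly C[n]}) :
  (forall m, F@_m != 0 -> (k <= m i)%N) <->
  exists G : {mpoly C[n]}, F = 'X_i ^+ k * G.
Proof.
split=> [h|[G ->] m]; last by rewrite mcoeff_XnM; case: leqP; rewrite ?eqxx.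
exists (\sum_(m <- msupp F) F@_m *: 'X_[m - U_(i) *+ k]).
rewrite {1}[F]mpolyE mulr_sumr big_seq [RHS]big_seq; apply: eq_bigr => m mF.
rewrite -scalerAr mpolyXn -mpolyXD addmC submK //.
apply/mnm_lepP => j; rewrite mulmnE mnm1E.
by case: eqVneq => [<-|_]; rewrite ?mul1n ?mul0n // h // -mcoeff_msupp.
Qed.

Lemma homog_XnM n (i : 'I_n) k (G : {mpoly C[n]}) l :
  'X_i ^+ k * G \is (k + l).-homog -> G \is l.-homog.
Proof.
move=> /dhomogP h; apply/dhomogP => m mG.
have e : ('X_i ^+ k * G)@_(m + U_(i) *+ k) = G@_m by rewrite mulrC mpolyXn addmC mcoeffMX.
have : mdeg (m + U_(i) *+ k) = (k + l)%N by apply: h; rewrite mcoeff_msupp e -mcoeff_msupp.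
by rewrite mdegD mdegMn mdeg1 mul1n addnC => /addnI.
Qed.

(* the restriction of [F] to the line [x_i = 0] *)
Definition rst i F : S := F \mPo [tuple if j == i then 0 else 'X_j | j < 3].

Lemma rstM i F G : rst i (F * G) = rst i F * rst i G.
Proof. exact: rmorphM. Qed.

Lemma rst_X i j : rst i 'X_j = if j == i then 0 else 'X_j.
Proof. by rewrite /rst comp_mpolyXU (nth_map i) ?size_enum_ord // nth_ord_enum. Qed.

Lemma meval_rst i F v : (rst i F).@[v] = F.@[fun j => if j == i then 0 else v j].
Proof.
apply: meval_comp => j; rewrite (nth_map i) ?size_enum_ord // nth_ord_enum.
by case: eqVneq; rewrite ?meval0 ?mevalXU.
Qed.

Lemma rst_mX i (m : 'X_{1..3}) : rst i 'X_[m] = if m i == 0%N then 'X_[m] else 0.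
Proof.
rewrite mpolyXE_id /rst rmorph_prod /=.
case: eqVneq => [e|ne].
  apply: eq_bigr => j _; rewrite rmorphXn /= -/(rst i _) rst_X.
  by case: eqVneq => // ->; rewrite e !expr0.
rewrite (bigD1 i) //= rmorphXn /= -/(rst i _) rst_X eqxx expr0n (negPf ne).
by rewrite mul0r.
Qed.

Lemma mcoeff_rst i F m : (rst i F)@_m = if m i == 0%N then F@_m else 0.
Proof.
elim/mpolyind: F => [|c k P _ _ IH].
  by rewrite /rst comp_mpoly0 mcoeff0 if_same.
rewrite /rst comp_mpolyD comp_mpolyZ -!/(rst _ _) rst_mX !mcoeffD !mcoeffZ IH mcoeffX.
case: (eqVneq (k i) 0%N) => ki; case: (eqVneq (m i) 0%N) => mi;
  rewrite ?mcoeffX ?mcoeff0 //; case: (eqVneq k m) => ek; rewrite ?mulr0 ?addr0 //.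
  by rewrite -ek ki eqxx in mi.
by rewrite ek mi eqxx in ki.
Qed.

Lemma rst_eq0 i F : rst i F = 0 -> exists G, F = 'X_i * G.
Proof.
move=> e; suff /Xn_dvdP [G ->] : forall m, F@_m != 0 -> (1 <= m i)%N by exists G; rewrite expr1.
move=> m; have := congr1 (mcoeff m) e; rewrite mcoeff_rst mcoeff0 lt0n.
by case: eqVneq => // _ ->; rewrite eqxx.
Qed.

Lemma homog_XM i G l : 'X_i * G \is l.+1.-homog -> G \is l.-homog.
Proof. by move=> h; apply: (@homog_XnM _ i 1); rewrite expr1. Qed.

Lemma pt_neq0 (p : 'rV[C]_3) i : p ord0 i != 0 -> p != 0.
Proof. by apply: contra_neq => ->; rewrite mxE. Qed.

Lemma rst_neq0_pt i F : rst i F != 0 ->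
  exists p : 'rV[C]_3, [/\ p ord0 i = 0, forall j, j != i -> p ord0 j != 0 & F.@[p ord0] != 0].
Proof.
move=> /mpoly_nonroot [v [nv Fv]]; exists (\row_j if j == i then 0 else v j).
split=> [|j ji|]; rewrite ?mxE ?eqxx // ?(negPf ji) //.
suff <- : (rst i F).@[v] = F.@[(\row_j if j == i then 0 else v j) ord0] by [].
by rewrite meval_rst; apply: meval_eq => j; rewrite mxE.
Qed.

(* [D G] is to be read as "[G] is invertible at the place [D]"; the places of
   interest are the closed points, the generic points of the lines [x_i = 0],
   and the generic point of the plane. *)
Definition place (D : S -> bool) :=
  [/\ D 0 = false, forall F G, D (F * G) = D F && D G & exists i, D 'X_i].

Definition at_pt (p : 'rV[C]_3) : S -> bool := fun G => G.@[p ord0] != 0.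
Definition at_line i : S -> bool := fun G => rst i G != 0.

Lemma at_pt_place p : p != 0 -> place (at_pt p).
Proof.
move=> np; split=> [|F G|]; rewrite /at_pt ?meval0 ?eqxx //.
  by rewrite mevalM mulf_eq0 negb_or.
have [i ni] : exists i, p ord0 i != 0.
  apply: contrapT => h; move/eqP: np; apply; apply/rowP => i; rewrite mxE.
  by apply/eqP/negPn/negP => ni; apply: h; exists i.
by exists i; rewrite mevalXU.
Qed.

Lemma at_line_place i : place (at_line i).
Proof.
split=> [|F G|]; rewrite /at_line /rst ?comp_mpoly0 ?eqxx //.
  by rewrite rmorphM mulf_eq0 negb_or.
by exists (lift i 0); rewrite -/(rst _ _) rst_X [_ == i]eq_sym (negPf (neq_lift _ _)) mpolyX_neq0.
Qed.

End Restriction.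

(* A function field of the plane: computing with [{fraction {mpoly C[2]}}]
   itself makes unification unfold the quotient construction. *)
Record model (C : closedFieldType) := Model {
  mK :> fieldType;
  emb : {rmorphism {mpoly C[2]} -> mK};
  emb_inj : injective emb;
  emb_frac : forall f, exists P Q, Q != 0 /\ f = emb P / emb Q;
  mpull : C * C -> {rmorphism mK -> mK};
  mpullE : forall t P, t.1 != 0 -> t.2 != 0 ->
    mpull t (emb P) = emb (scale_vars t P) }.

(** * Germs of sections of O(n) at a place *)

Section Local.
Variables (C : closedFieldType) (K : model C).
Local Notation S := {mpoly C[3]}.
Implicit Types (F G : S) (i j : 'I_3) (f g : K).

Definition dh F : K := emb K (dehomP F).

Lemma dhM : {morph dh : F G / F * G}.
Proof. by move=> F G; rewrite /dh /dehomP !rmorphM. Qed.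
Lemma dhD : {morph dh : F G / F + G}.
Proof. by move=> F G; rewrite /dh /dehomP !rmorphD. Qed.
Lemma dhN : {morph dh : F / - F}.
Proof. by move=> F; rewrite /dh /dehomP !rmorphN. Qed.
Lemma dh0 : dh 0 = 0. Proof. by rewrite /dh /dehomP !rmorph0. Qed.
Lemma dh1 : dh 1 = 1. Proof. by rewrite /dh /dehomP !rmorph1. Qed.
Lemma dhXn F n : dh (F ^+ n) = dh F ^+ n.
Proof. by rewrite /dh /dehomP !rmorphXn. Qed.

Lemma dh_X0 : dh 'X_0 = 1.
Proof. by rewrite /dh /dehomP comp_mpolyXU /= rmorph1. Qed.

Lemma dh_eq0 F k : F \is k.-homog -> (dh F == 0) = (F == 0).
Proof.
move=> hF; apply/eqP/eqP => [e|->]; last exact: dh0.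
by apply: (dehomP_inj0 hF); apply: (@emb_inj _ K); rewrite rmorph0.
Qed.

Lemma dh_inj F G k : F \is k.-homog -> G \is k.-homog -> dh F = dh G -> F = G.
Proof.
move=> hF hG e; apply/eqP; rewrite -subr_eq0 -(@dh_eq0 _ k) ?rpredB //.
by rewrite dhD dhN e subrr.
Qed.

Lemma frac_forms f : exists k F G,
  [/\ F \is k.-homog, G \is k.-homog, G != 0 & f = dh F / dh G].
Proof.
have [P [Q [nQ ->]]] := emb_frac f.
have [k [F [hF eF]]] := homogenize P; have [l [G [hG eG]]] := homogenize Q.
exists (k + l)%N, (F * 'X_0 ^+ l), ('X_0 ^+ k * G).
have nG : G != 0 by apply: contra_neq nQ => G0; rewrite -eG G0 /dehomP comp_mpoly0.
split; rewrite ?dhomogM ?homogXn //; first by rewrite mulf_neq0 ?expf_neq0 ?mpolyX_neq0.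
by rewrite !dhM !dhXn dh_X0 !expr1n mulr1 mul1r /dh eF eG.
Qed.

(** At [at_pt p] this is the stalk of O(n); at [at_line i] with [n = 0] it is the discrete valuation
    ring of the line [x_i = 0]. *)
Definition Oloc (D : S -> bool) (n : int) : set K :=
  [set f | exists (k l : nat) (F G : S),
     [/\ F \is k.-homog, G \is l.-homog, (k : int) = (l : int) + n,
         D G & f = dh F / dh G]].

Definition Xk i : K := dh 'X_i.

Lemma Xk_neq0 i : Xk i != 0.
Proof. by rewrite (@dh_eq0 _ 1%N) ?mpolyX_neq0 ?homogX. Qed.

Lemma Xk0 : Xk 0 = 1. Proof. exact: dh_X0. Qed.

Section Place.
Variable D : S -> bool.
Hypothesis hD : place D.

Lemma place_neq0 G : D G -> G != 0.
Proof. by case: hD => D0 _ _; apply: contraTneq => ->; rewrite D0. Qed.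

Lemma place_dh G k : G \is k.-homog -> D G -> dh G != 0.
Proof. by move=> hG /place_neq0; rewrite (dh_eq0 hG). Qed.

Lemma placeM F G : D (F * G) = D F && D G.
Proof. by case: hD. Qed.

Lemma place1 : D 1.
Proof. case: hD => [_ h [j hj]]; move: hj; rewrite -(mul1r 'X_j) h; by case/andP. Qed.

Lemma placeX F n : D F -> D (F ^+ n).
Proof.
move=> DF; elim: n => [|n IH]; first by rewrite expr0 place1.
by rewrite exprS placeM DF.
Qed.

Lemma Oloc_intro k l n F G : F \is k.-homog -> G \is l.-homog ->
  (k : int) = (l : int) + n -> D G -> Oloc D n (dh F / dh G).
Proof. by move=> hF hG e DG; exists k, l, F, G. Qed.

Lemma Oloc_form k F : F \is k.-homog -> Oloc D k (dh F).
Proof.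
move=> hF; rewrite -[dh F]divr1 -dh1.
by apply: (@Oloc_intro k 0%N); rewrite ?dhomog1 ?add0r ?place1.
Qed.

Lemma Oloc_inv k F : F \is k.-homog -> D F -> Oloc D (- (k%:Z)) (dh F)^-1.
Proof.
move=> hF DF; rewrite -[_^-1]mul1r -dh1.
by apply: (@Oloc_intro 0%N k); rewrite ?dhomog1 ?subrr.
Qed.

Lemma OlocM m n f g : Oloc D m f -> Oloc D n g -> Oloc D (m + n) (f * g).
Proof.
move=> [k [l [F [G [hF hG e DG ->]]]]] [k' [l' [F' [G' [hF' hG' e' DG' ->]]]]].
rewrite mulf_div -!dhM; apply: (@Oloc_intro (k + k') (l + l')); rewrite ?dhomogM //.
  by rewrite !PoszD e e' addrACA.
by rewrite placeM DG.
Qed.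

Lemma Oloc0 n : Oloc D n 0.
Proof.
case: hD => _ _ [i Di].
suff : Oloc D n (dh 0 / dh ('X_i ^+ `|n|)) by rewrite dh0 mul0r.
apply: (@Oloc_intro (absz (n + Posz (absz n))) (absz n)); rewrite ?rpred0 ?homogXn ?placeX //; lia.
Qed.

Lemma OlocD n f g : Oloc D n f -> Oloc D n g -> Oloc D n (f + g).
Proof.
move=> [k [l [F [G [hF hG e DG ->]]]]] [k' [l' [F' [G' [hF' hG' e' DG' ->]]]]].
rewrite addf_div ?(place_dh hG) ?(place_dh hG') // -!dhM -dhD.
apply: (@Oloc_intro (k + l')%N (l + l')%N).
- apply: rpredD; first by rewrite dhomogM.
  have -> : (k + l' = k' + l)%N by lia.
  by rewrite dhomogM.
- by rewrite dhomogM.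
- by rewrite !PoszD e addrAC.
- by rewrite placeM DG.
Qed.

Lemma OlocN n f : Oloc D n f -> Oloc D n (- f).
Proof.
move=> [k [l [F [G [hF hG e DG ->]]]]]; rewrite -mulNr -dhN.
by apply: (@Oloc_intro k l); rewrite ?rpredN.
Qed.

Lemma OlocB n f g : Oloc D n f -> Oloc D n g -> Oloc D n (f - g).
Proof. by move=> hf hg; apply: OlocD => //; apply: OlocN. Qed.

Lemma Oloc_sum n (I : Type) (r : seq I) (P : pred I) (f : I -> K) :
  (forall x, P x -> Oloc D n (f x)) -> Oloc D n (\sum_(x <- r | P x) f x).
Proof. by move=> h; elim/big_rec: _ => [|i x /h]; [exact: Oloc0|exact: OlocD]. Qed.

Lemma OlocX f n : Oloc D 0 f -> Oloc D 0 (f ^+ n).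
Proof.
move=> hf; elim: n => [|n IH]; last by rewrite exprS -[0]addr0; apply: OlocM.
by rewrite expr0 -dh1; apply: (@Oloc_form 0); rewrite dhomog1.
Qed.

Lemma Oloc1 : Oloc D 0 1. Proof. exact: (OlocX 0 (Oloc0 0)). Qed.

Lemma OlocC c : Oloc D 0 (dh c%:MP).
Proof. by apply: (@Oloc_form 0); rewrite -alg_mpolyC rpredZ ?dhomog1. Qed.

Lemma Oloc_XnM n i k f : Oloc D n f -> Oloc D (n + k%:Z) (Xk i ^+ k * f).
Proof.
move=> hf; rewrite addrC; apply: OlocM => //; rewrite -dhXn.
exact/Oloc_form/homogXn.
Qed.

(** As [x_i] is invertible at the place, [x_i ^ e] is a local generator of O(e). *)
Lemma Oloc_XzM n i (e : int) f : D 'X_i ->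
  Oloc D (n + e) (Xk i ^ e * f) <-> Oloc D n f.
Proof.
move=> Di; have X e' : Oloc D e' (Xk i ^ e').
  case: e' => k; first by rewrite -exprnP -dhXn; exact/Oloc_form/homogXn.
  by rewrite NegzE -exprnN -dhXn; apply: Oloc_inv; rewrite ?homogXn ?placeX.
split=> hf; last by rewrite addrC; apply: OlocM.
have -> : f = Xk i ^ (- e) * (Xk i ^ e * f).
  by rewrite mulrA -expfzDr ?Xk_neq0 // addNr expr0z mul1r.
have -> : n = - e + (n + e) by lia.
exact: OlocM.
Qed.

(** Dehomogenization is injective on forms of a fixed degree, so an equality of quotients of equal
    degree can be cross-multiplied into an equality of forms. *)
Lemma Oloc_cross n f k l A B : Oloc D n f -> A \is k.-homog -> B \is l.-homog ->
  B != 0 -> (k : int) = (l : int) + n -> f = dh A / dh B ->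
  exists F G, [/\ D G, A * G = F * B & exists k' l', F \is k'.-homog /\ G \is l'.-homog].
Proof.
move=> [k' [l' [F [G [hF hG e DG ->]]]]] hA hB nB e' /eqP.
rewrite eqr_div ?(place_dh hG) ?(dh_eq0 hB) // -!dhM => /eqP h.
exists F, G; split=> //; last by exists k', l'.
apply/esym; apply: (@dh_inj _ _ (k + l')) => //; last by rewrite dhomogM.
have -> : (k + l' = k' + l)%N by lia.
by rewrite dhomogM.
Qed.

End Place.
End Local.

(** * Forms with an integer as degree *)

Section HomogeneousInteger.
Variable C : closedFieldType.
Local Notation S := {mpoly C[3]}.
Implicit Types (F G : S) (i j : 'I_3) (z : int).

(* only [0] is homogeneous of negative degree *)
Definition homZ z F := forall m, F@_m != 0 -> Posz (mdeg m) = z.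

Lemma homZ0 z : homZ z 0.
Proof. by move=> m; rewrite mcoeff0 eqxx. Qed.

Lemma homZ_nat (k : nat) F : homZ k F <-> F \is k.-homog.
Proof.
split=> [h|/dhomogP h m]; last by rewrite -mcoeff_msupp => /h <-.
by apply/dhomogP => m; rewrite mcoeff_msupp => /h [].
Qed.

Lemma homZP z F : homZ z F -> F = 0 \/ exists2 k : nat, z = k & F \is k.-homog.
Proof.
move=> h; have [->|nF] := eqVneq F 0; [by left|right].
have := mlead_supp nF; rewrite mcoeff_msupp => /h e.
by exists (mdeg (mlead F)) => //; apply/homZ_nat; rewrite e.
Qed.

Lemma homZM z z' F G : homZ z F -> homZ z' G -> homZ (z + z') (F * G).
Proof.
move=> /homZP [->|[k -> hF]]; first by rewrite mul0r => _; exact: homZ0.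
move=> /homZP [->|[l -> hG]]; first by rewrite mulr0; exact: homZ0.
by rewrite -PoszD; apply/homZ_nat; rewrite dhomogM.
Qed.

Lemma homZD z F G : homZ z F -> homZ z G -> homZ z (F + G).
Proof.
move=> hF hG m; rewrite mcoeffD; have [F0|/hF //] := eqVneq F@_m 0.
by rewrite F0 add0r => /hG.
Qed.

Lemma homZN z F : homZ z F -> homZ z (- F).
Proof. by move=> hF m; rewrite mcoeffN oppr_eq0 => /hF. Qed.

Lemma homZ_sum z (I : Type) (r : seq I) (P : pred I) (A : I -> S) :
  (forall x, P x -> homZ z (A x)) -> homZ z (\sum_(x <- r | P x) A x).
Proof. by move=> h; elim/big_rec: _ => [|x B /h]; [exact: homZ0|exact: homZD]. Qed.

Lemma homZXn i (k : nat) : homZ k ('X_i ^+ k).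
Proof. exact/homZ_nat/homogXn. Qed.

Lemma homZ_XnM i k z F : homZ z ('X_i ^+ k * F) -> homZ (z - k%:Z) F.
Proof.
move=> h m nm.
have e : ('X_i ^+ k * F)@_(m + U_(i) *+ k) = F@_m by rewrite mulrC mpolyXn addmC mcoeffMX.
have := h (m + U_(i) *+ k)%MM; rewrite e => /(_ nm) <-.
by rewrite mdegD mdegMn mdeg1 mul1n PoszD addrK.
Qed.

Lemma homZ_XM i z F : homZ z ('X_i * F) -> homZ (z - 1) F.
Proof. by move=> h; apply: (@homZ_XnM i 1); rewrite expr1. Qed.

Lemma homZX z F k : homZ z F -> homZ (z * k%:Z) (F ^+ k).
Proof.
move=> h; elim: k => [|k IH]; first by rewrite expr0 mulr0; apply/homZ_nat/dhomog1.
by rewrite exprS intS mulrDr mulr1; apply: homZM.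
Qed.

Lemma Xn_dvd_cancel (i j : 'I_3) k F G : i != j -> 'X_j ^+ k * F = 'X_i ^+ k * G ->
  exists F', F = 'X_i ^+ k * F'.
Proof.
move=> ij e; apply/Xn_dvdP => m nm.
have := congr1 (mcoeff (m + U_(j) *+ k)) e; rewrite !mcoeff_XnM !mnmDE !mulmnE !mnm1E.
rewrite eqxx mul1n leq_addl addmK eq_sym (negPf ij) mul0n addn0; case: leqP => //.
by move=> _ e0; rewrite e0 eqxx in nm.
Qed.

(** Membership in an ideal generated by powers of variables is decided monomial by monomial. [sel]
    sends each monomial to a single admissible generator, which keeps the cofactors homogeneous. *)
Lemma monomial_ideal_split z (P : pred 'I_3) (b : 'I_3 -> nat) F :
  homZ z F -> (forall m, F@_m != 0 -> exists2 i, P i & (b i <= m i)%N) ->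
  exists A : 'I_3 -> S, [/\ F = \sum_i 'X_i ^+ b i * A i,
    forall i, ~~ P i -> A i = 0 & forall i, homZ (z - (b i)%:Z) (A i)].
Proof.
move=> hF h; pose sel (m : 'X_{1..3}) := [pick i | P i && (b i <= m i)%N].
pose A i := \sum_(m <- msupp F | sel m == Some i) F@_m *: 'X_[m - U_(i) *+ b i].
have selP m i : sel m == Some i -> P i && (b i <= m i)%N.
  by rewrite /sel; case: pickP => // j h' /eqP [<-].
have XA i (m : 'X_{1..3}) : sel m == Some i -> 'X_i ^+ b i * 'X_[m - U_(i) *+ b i] = 'X_[m] :> S.
  move=> /selP /andP [_ bm]; rewrite mpolyXn -mpolyXD addmC submK //.
  apply/mnm_lepP => j; rewrite mulmnE mnm1E.
  by case: eqVneq => [<-|_]; rewrite ?mul1n ?mul0n.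
exists A; split.
- transitivity (\sum_i \sum_(m <- msupp F | sel m == Some i) F@_m *: 'X_[m] : S).
    rewrite (exchange_big_dep predT) //= {1}[F]mpolyE big_seq [RHS]big_seq.
    apply: eq_bigr => m; rewrite mcoeff_msupp => /h [i Pi bi].
    rewrite /sel; case: pickP => [j _|/(_ i)]; last by rewrite Pi bi.
    rewrite (bigD1 j) //= big1 ?addr0 // => k /andP [/eqP [->]].
    by rewrite eqxx.
  apply: eq_bigr => i _; rewrite mulr_sumr; apply: eq_bigr => m sm.
  by rewrite -scalerAr XA.
- move=> i nPi; rewrite /A big1 // => m /selP /andP [Pi].
  by rewrite Pi in nPi.
- move=> i; rewrite /A big_seq_cond; apply: homZ_sum => m /andP [].
  rewrite mcoeff_msupp => nm sm; apply: (@homZ_XnM i).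
  rewrite -scalerAr XA // => m'; rewrite mcoeffZ mcoeffX.
  by case: (eqVneq m m') => [<-|_]; [rewrite mulr1; exact: hF | rewrite mulr0 eqxx].
Qed.

End HomogeneousInteger.

(** * Sections over basic open sets and Hartogs extension *)

Section Sections.
Variables (C : closedFieldType) (K : model C).
Local Notation S := {mpoly C[3]}.
Implicit Types (F G : S) (i j : 'I_3) (f g : K) (p q : 'rV[C]_3).

Lemma Oloc_homZ D (hD : place D) z F : homZ z F -> Oloc D z (dh K F).
Proof.
move=> /homZP [->|[k -> hF]]; last exact: Oloc_form.
by rewrite dh0; apply: Oloc0.
Qed.

Lemma dh_homZ_eq0 z F : homZ z F -> dh K F = 0 -> F = 0.
Proof.
move=> /homZP [//|[k _ hF]] /eqP.
by rewrite (dh_eq0 K hF) => /eqP.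
Qed.

Lemma dh_homZ_inj z F G : homZ z F -> homZ z G -> dh K F = dh K G -> F = G.
Proof.
move=> hF hG e; apply/eqP; rewrite -subr_eq0; apply/eqP.
by apply: (dh_homZ_eq0 (homZD hF (homZN hG))); rewrite dhD dhN e subrr.
Qed.

Lemma Oloc_homZ_div D (hD : place D) n e k F G : G \is e.-homog -> D G ->
  homZ (e%:Z * k%:Z + n) F -> Oloc D n (dh K F / dh K G ^+ k).
Proof.
move=> hG DG hF; have -> : n = e%:Z * k%:Z + n - (e * k)%:Z by lia.
apply: OlocM => //; first exact: Oloc_homZ.
by rewrite -dhXn; apply: Oloc_inv; rewrite ?dhomogMn ?placeX.
Qed.

(** On the chart [x_0 <> 0] the affine statement yields [F / G ^ k]; only the degree of [F] may be
    too large, and regularity along [x_0 = 0] lowers it. All large [k] are provided so that several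
    sections can share an exponent. *)
Lemma sections_basic_open n f G e : G \is e.-homog -> G != 0 ->
  (forall q, q != 0 -> G.@[q ord0] != 0 -> Oloc (at_pt q) n f) ->
  exists k0 : nat, forall k, (k0 <= k)%N ->
    exists2 F, homZ (e%:Z * k%:Z + n) F & f = dh K F / dh K G ^+ k.
Proof.
move=> hG nG reg.
have ndG : dh K G != 0 by rewrite (dh_eq0 _ hG).
suff [k0 [F hF ef]] : exists k, exists2 F, homZ (e%:Z * k%:Z + n) F & f = dh K F / dh K G ^+ k.
  exists k0 => k kk; exists (F * G ^+ (k - k0)).
    have -> : e%:Z * k%:Z + n = e%:Z * k0%:Z + n + (e%:Z * (k - k0)%N%:Z).
      by rewrite -[in LHS](subnKC kk) PoszD; ring.
    by apply: homZM => //; apply/homZX/homZ_nat.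
  have -> : dh K G ^+ k = dh K G ^+ (k - k0) * dh K G ^+ k0 by rewrite -exprD subnK.
  by rewrite ef dhM dhXn invfM mulrA mulfK ?expf_neq0.
(* Here [d] is the excess of the degree of [F]. As [x_0] dehomogenizes to 1, dividing by it leaves
   [f] unchanged. *)
have step d k F : homZ (e%:Z * k%:Z + n + d%:Z) F -> f = dh K F / dh K G ^+ k ->
    exists k, exists2 F, homZ (e%:Z * k%:Z + n) F & f = dh K F / dh K G ^+ k.
  elim: d k F => [|d IH] k F hF ef; first by exists k, F; rewrite // -[X in homZ X]addr0.
  have [F0|nF0] := eqVneq (rst 0 F) 0.
    have [F' eF] := rst_eq0 F0; apply: (IH k F'); last by rewrite ef eF dhM dh_X0 mul1r.
    have -> : e%:Z * k%:Z + n + d%:Z = e%:Z * k%:Z + n + d.+1%:Z - 1 by lia.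
    by apply: (@homZ_XM _ 0); rewrite -eF.
  (* If [G = x_0 G'], then [F / G ^ k = F G' / G ^ (k + 1)] after dehomogenization, and the excess
     drops by one. *)
  have [G0|nG0] := eqVneq (rst 0 G) 0.
    have [G' eG] := rst_eq0 G0; apply: (IH k.+1 (F * G')); last first.
      have edG : dh K G = dh K G' by rewrite eG dhM dh_X0 mul1r.
      by rewrite ef dhM exprSr invfM -edG -mulrA [dh K G * _]mulrCA divff ?mulr1.
    have -> : e%:Z * k.+1%:Z + n + d%:Z = e%:Z * k%:Z + n + d.+1%:Z + (e%:Z - 1) by lia.
    by apply: homZM => //; apply: (@homZ_XM _ 0); rewrite -eG; apply/homZ_nat.
  (* Otherwise [f] would have a pole at a point of [x_0 = 0] where neither [F] nor [G] vanishes. *)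
  have : rst 0 (F * G) != 0 by rewrite rstM mulf_neq0.
  move=> /rst_neq0_pt [q [q0 nq]]; rewrite mevalM mulf_eq0 negb_or => /andP [Fq Gq].
  have q_neq0 : q != 0 by apply: (@pt_neq0 _ _ 1); rewrite nq.
  have [F0|[r er hF']] := homZP hF; first by move: Fq; rewrite F0 meval0 eqxx.
  have [] := Oloc_cross (at_pt_place q_neq0) (A := F) (B := G ^+ k * 'X_0 ^+ d.+1)
    (k := r) (l := (e * k + d.+1)%N) (reg q q_neq0 Gq).
  - by [].
  - by rewrite dhomogM ?dhomogMn ?homogXn.
  - by rewrite mulf_neq0 ?expf_neq0 ?mpolyX_neq0.
  - by rewrite -er PoszD PoszM; ring.
  - by rewrite ef dhM !dhXn dh_X0 expr1n mulr1.
  move=> F1 [G1 [nG1 /(congr1 (meval (q ord0))) + _]].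
  have X0q : ('X_0 ^+ d.+1 : S).@[q ord0] = 0 by rewrite exprS mevalM mevalXU q0 mul0r.
  rewrite !mevalM X0q !mulr0 => /eqP; rewrite mulf_eq0 (negPf Fq) /=.
  by move: nG1; rewrite /at_pt => /negPf ->.
have [P [Q [nQ ef]]] := emb_frac f.
have niQ : emb K Q != 0 by rewrite -(rmorph0 (emb K)) (inj_eq (@emb_inj _ K)).
have [v Gv|k [R eR]] := @nullstellensatz_denominator2 C P Q (dehomP G) nQ.
  set q := mkpt v; rewrite meval_dehomP in Gv.
  have nq : q != 0 by apply: (@pt_neq0 _ _ 0); rewrite mxE oner_neq0.
  have [k [l [A [B [hA hB _ DB]]]]] := reg q nq Gv.
  rewrite ef /dh => /eqP; rewrite eqr_div //; last first.
    by rewrite -/(dh K B) (dh_eq0 _ hB) (place_neq0 (at_pt_place nq) DB).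
  rewrite -!rmorphM (inj_eq (@emb_inj _ K)) => /eqP e'.
  by exists (dehomP A), (dehomP B); split; rewrite ?e' // meval_dehomP.
have [r [F [hF eF]]] := homogenize R.
(* Multiplying the numerator by [x_0 ^ a] makes the excess [d] nonnegative. *)
pose a := absz (e%:Z * k%:Z + n).
pose d := absz (r%:Z + a%:Z - (e%:Z * k%:Z + n))%R.
apply: (step d k (F * 'X_0 ^+ a)).
  have -> : e%:Z * k%:Z + n + d%:Z = r%:Z + a%:Z by rewrite /d /a; lia.
  by apply: homZM; [exact/homZ_nat | exact: homZXn].
rewrite dhM !dhXn dh_X0 expr1n mulr1 /dh eF ef.
apply/eqP; rewrite eqr_div ?expf_neq0 // -rmorphXn -!rmorphM eR.
by [].
Qed.

(** Presentations [A / (G x_i) ^ k] and [B / (G x_j) ^ k] with the same [k] give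
    [x_j ^ k A = x_i ^ k B]; the variables being coprime, [x_i ^ k] cancels from the first one. *)
Lemma hartogs n f G e i j : G \is e.-homog -> G != 0 -> i != j ->
  (forall q, q != 0 -> G.@[q ord0] != 0 -> q ord0 i != 0 -> Oloc (at_pt q) n f) ->
  (forall q, q != 0 -> G.@[q ord0] != 0 -> q ord0 j != 0 -> Oloc (at_pt q) n f) ->
  exists k, exists2 F, homZ (e%:Z * k%:Z + n) F & f = dh K F / dh K G ^+ k.
Proof.
move=> hG nG ij ri rj.
have GX l : G * 'X_l \is (e + 1).-homog /\ G * 'X_l != 0.
  by rewrite dhomogM ?homogX // mulf_neq0 ?mpolyX_neq0.
have reg l : (forall q, q != 0 -> G.@[q ord0] != 0 -> q ord0 l != 0 -> Oloc (at_pt q) n f) ->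
   exists k0 : nat, forall k, (k0 <= k)%N ->
    exists2 F, homZ ((e + 1)%N%:Z * k%:Z + n) F & f = dh K F / dh K (G * 'X_l) ^+ k.
  have [h1 h2] := GX l; move=> h; apply: sections_basic_open => // q nq.
  by rewrite mevalM mulf_eq0 negb_or mevalXU => /andP [Gq ql]; apply: h.
have [k0 /(_ (k0 + _)%N) hi] := reg i ri; have [k1 /(_ (k0 + k1)%N) hj] := reg j rj.
have [|A hA eA] := hi k1; first exact: leq_addr.
have [|B hB eB] := hj; first exact: leq_addl.
set k := (k0 + k1)%N in hA hB eA eB.
have nd l : dh K 'X_l != 0 by rewrite (dh_eq0 _ (homogX _ _)) mpolyX_neq0.
have ndG : dh K G != 0 by rewrite (dh_eq0 _ hG).
have eAB : 'X_j ^+ k * A = 'X_i ^+ k * B.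
  have h l z F : homZ z F -> homZ (z + k%:Z) ('X_l ^+ k * F).
    by move=> hF; rewrite addrC; apply: homZM => //; exact: homZXn.
  have e0 : dh K ('X_j ^+ k * A) = dh K ('X_i ^+ k * B).
    have := eA; rewrite eB => /eqP.
    rewrite eqr_div ?expf_neq0 ?dhM ?mulf_neq0 // !exprMn => /eqP e'.
    rewrite !dhXn; apply: (mulfI (expf_neq0 k ndG)).
    by transitivity (dh K A * (dh K G ^+ k * dh K 'X_j ^+ k)); [ring | rewrite -e'; ring].
  have h0 := homZD (h j _ _ hA) (homZN (h i _ _ hB)).
  have [e1|[r _ hr]] := homZP h0; first by apply/eqP; rewrite -subr_eq0 e1.
  apply/eqP; rewrite -subr_eq0 -(dh_eq0 K hr).
  by rewrite dhD dhN e0 subrr.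
have [A' eA'] := Xn_dvd_cancel ij eAB.
exists k, A'.
  have -> : e%:Z * k%:Z + n = (e + 1)%N%:Z * k%:Z + n - k%:Z by lia.
  by apply: (@homZ_XnM _ i); rewrite -eA'.
rewrite eA eA' !dhM dhXn exprMn; apply/eqP.
rewrite eqr_div ?mulf_neq0 ?expf_neq0 //; apply/eqP; ring.
Qed.

End Sections.

(** * Cohomology of line bundles and of syzygy bundles *)

Section LineBundleCohomology.
Variables (C : closedFieldType) (K : model C).
Local Notation S := {mpoly C[3]}.
Implicit Types (F G : S) (i j : 'I_3) (f g : K) (p q : 'rV[C]_3).

Lemma ord3_neq : [/\ (0 : 'I_3) != 1, (0 : 'I_3) != 2%:R & (1 : 'I_3) != 2%:R].
Proof. by split. Qed.

Lemma sum_ord3 (V : nmodType) (h : 'I_3 -> V) : \sum_i h i = h 0 + h 1 + h 2%:R.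
Proof.
rewrite !big_ord_recl big_ord0 addr0 addrA; congr (_ + h _ + h _); exact/val_inj.
Qed.

Lemma global_sections n f :
  (forall q, q != 0 -> Oloc (at_pt q) n f) -> exists2 F, homZ n F & f = dh K F.
Proof.
move=> h; have [n01 _ _] := ord3_neq.
have [| |k [F hF ef]] := @hartogs C K n f 1 0%N 0 1 (dhomog1 _ _) (oner_neq0 _) n01.
- by move=> q nq _ _; apply: h.
- by move=> q nq _ _; apply: h.
exists F; first by rewrite mul0r add0r in hF.
by rewrite ef dh1 expr1n divr1.
Qed.

Lemma at_ptX p i : p ord0 i != 0 -> at_pt p 'X_i.
Proof. by rewrite /at_pt mevalXU. Qed.

Lemma Xk_sectionsP n i k F q : q != 0 -> q ord0 i != 0 -> homZ (k%:Z + n) F ->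
  Oloc (at_pt q) n (dh K F / Xk K i ^+ k).
Proof.
move=> nq qi hF; apply: (@Oloc_homZ_div _ _ _ (at_pt_place nq) _ 1); rewrite ?homogX //.
  exact: at_ptX.
by rewrite mul1r.
Qed.

(** With a common exponent [N], the cocycle condition reads [x_2 ^ N A = x_1 ^ N B - x_0 ^ N D].
    Hence each monomial of [A] is divisible by [x_0 ^ N] or [x_1 ^ N], and [s 0 1] is a difference
    of sections over two charts. *)
Lemma H1_O_vanishes n (s : 'I_3 -> 'I_3 -> K) :
  (forall i j q, q != 0 -> q ord0 i != 0 -> q ord0 j != 0 -> Oloc (at_pt q) n (s i j)) ->
  (forall i j k, s i j + s j k = s i k) ->
  exists mu : 'I_3 -> K,
    (forall i q, q != 0 -> q ord0 i != 0 -> Oloc (at_pt q) n (mu i)) /\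
    (forall i j, s i j = mu j - mu i).
Proof.
move=> reg coc; have [n01 n02 n12] := ord3_neq.
have sii i : s i i = 0 by have := coc i i i; rewrite -[RHS]addr0 => /addrI.
(* Every primitive has the form [s 0 i + c] with [c] independent of [i]. *)
suff [c hc] : exists c, forall i q, q != 0 -> q ord0 i != 0 -> Oloc (at_pt q) n (s 0 i + c).
  exists (fun i => s 0 i + c); split=> // i j.
  by rewrite -(coc 0 i j); ring.
have bas i j : i != j -> exists k0 : nat, forall k, (k0 <= k)%N ->
    exists2 F, homZ (2%:Z * k%:Z + n) F & s i j * (Xk K i ^+ k * Xk K j ^+ k) = dh K F.
  move=> ij; have [| | |k0 h0] := @sections_basic_open C K n (s i j) ('X_i * 'X_j) 2.
  - by have := dhomogM (homogX C i) (homogX C j).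
  - by rewrite mulf_neq0 ?mpolyX_neq0.
  - by move=> q nq; rewrite mevalM !mevalXU mulf_eq0 negb_or => /andP []; apply: reg.
  exists k0 => k /h0 [F hF eF]; exists F => //.
  by rewrite eF -exprMn -dhM divfK // expf_neq0 // dhM mulf_neq0 // Xk_neq0.
have [k0 h0] := bas _ _ n01; have [k1 h1] := bas _ _ n02; have [k2 h2] := bas _ _ n12.
pose N := (k0 + (k1 + k2))%N.
have [|A hA eA] := h0 N; first by rewrite /N; lia.
have [|B hB eB] := h1 N; first by rewrite /N; lia.
have [|D hD eD] := h2 N; first by rewrite /N; lia.
have nX i : Xk K i ^+ N != 0 by rewrite expf_neq0 ?Xk_neq0.
have rel : 'X_(2%:R : 'I_3) ^+ N * A = 'X_1 ^+ N * B - 'X_0 ^+ N * D.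
  have hX i z F : homZ z F -> homZ (N%:Z + z) ('X_i ^+ N * F).
    by move=> hF; apply: homZM => //; exact: homZXn.
  apply: (@dh_homZ_inj _ K (N%:Z + (2%:Z * N%:Z + n))); first exact: hX.
    by apply: homZD; [exact: hX | apply/homZN/hX].
  by rewrite dhD dhN !dhM !dhXn -eA -eB -eD -(coc 0 1 2%:R) /Xk; ring.
have [A' [eA' A'2 hA']] : exists A' : 'I_3 -> S, [/\ A = \sum_i 'X_i ^+ N * A' i,
    forall i, ~~ (i != 2%:R) -> A' i = 0 & forall i, homZ (2%:Z * N%:Z + n - N%:Z) (A' i)].
  apply: (@monomial_ideal_split C _ (fun i => i != 2%:R) (fun _ => N)) => // m nm.
  have := congr1 (mcoeff (m + U_(2%:R) *+ N)) rel.
  rewrite mcoeffB !mcoeff_XnM !mnmDE !mulmnE !mnm1E eqxx mul1n leq_addl addmK /=.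
  rewrite !addn0; case: leqP => [h|_]; first by exists 1.
  case: leqP => [h|_]; first by exists 0.
  by rewrite subrr => e; rewrite e eqxx in nm.
have eA2 : s 0 1 = dh K (A' 0) / Xk K 1 ^+ N + dh K (A' 1) / Xk K 0 ^+ N.
  have : s 0 1 * (Xk K 0 ^+ N * Xk K 1 ^+ N) = dh K (A' 0) * Xk K 0 ^+ N + dh K (A' 1) * Xk K 1 ^+ N.
    rewrite eA eA' sum_ord3 (A'2 2%:R) // mulr0 addr0 dhD !dhM !dhXn /Xk.
    by rewrite [dh K (A' 0) * _]mulrC [dh K (A' 1) * _]mulrC.
  rewrite (addf_div _ _ (nX 1) (nX 0)) => /(canRL (mulfK (mulf_neq0 (nX 0) (nX 1)))) ->.
  by rewrite [Xk K 0 ^+ N * _]mulrC.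
have hA'' i : homZ (N%:Z + n) (A' i).
  by have -> : N%:Z + n = 2%:Z * N%:Z + n - N%:Z by ring.
pose c := - (dh K (A' 1) / Xk K 0 ^+ N).
have rc q : q != 0 -> q ord0 0 != 0 -> Oloc (at_pt q) n c.
  by move=> nq q0; rewrite /c; apply: OlocN; apply: Xk_sectionsP.
have rc1 q : q != 0 -> q ord0 1 != 0 -> Oloc (at_pt q) n (s 0 1 + c).
  by move=> nq q1; rewrite eA2 addrK; apply: Xk_sectionsP.
exists c => i q nq qi; case: (ord3P i) qi => -> qi.
- by rewrite sii add0r; apply: rc.
- exact: rc1.
(* On chart 2 the section is regular wherever [x_0] or [x_1] is nonzero, and Hartogs supplies the
   remaining point. *)
have [||k [F hF ->]] := @hartogs C K n (s 0 2%:R + c) 'X_(2%:R : 'I_3) 1 0 1 (homogX _ _) (mpolyX_neq0 _ _) n01.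
- move=> q' nq'; rewrite mevalXU => q2 q0; apply: (@OlocD _ K _ (at_pt_place nq')).
    exact: reg.
  exact: rc.
- move=> q' nq'; rewrite mevalXU => q2 q1; rewrite -(coc 0 1) addrAC.
  by apply: (@OlocD _ K _ (at_pt_place nq')); [exact: rc1|exact: reg].
by apply: Xk_sectionsP; rewrite // mul1r in hF.
Qed.

End LineBundleCohomology.

(** * Syzygy bundles and their connecting homomorphism *)

Section Syzygies.
Variables (C : closedFieldType) (K : model C).
Local Notation S := {mpoly C[3]}.
Local Notation pt := 'rV[C]_3.
Local Notation vec := 'cV[K]_2.
Implicit Types (F G w : S) (i j c : 'I_3) (f g : K) (p q : pt) (u v : vec).

(* the three coordinates of a vector of the plane [l_0 + l_1 + l_2 = 0] *)
Definition lc v (i : 'I_3) : K :=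
  if i == 0 then v 0 0 else if i == 1 then v 1 0 else - (v 0 0 + v 1 0).

Lemma lcD u v i : lc (u + v) i = lc u i + lc v i.
Proof. by rewrite /lc !mxE; case: (ord3P i) => -> //=; ring. Qed.
Lemma lcN v i : lc (- v) i = - lc v i.
Proof. by rewrite /lc !mxE; case: (ord3P i) => -> //=; ring. Qed.
Lemma lcB u v i : lc (u - v) i = lc u i - lc v i.
Proof. by rewrite lcD lcN. Qed.
Lemma lcZ f v i : lc (f *: v) i = f * lc v i.
Proof. by rewrite /lc !mxE; case: (ord3P i) => -> //=; ring. Qed.
Lemma lc_sum0 v : \sum_i lc v i = 0.
Proof. by rewrite sum_ord3 /lc /=; ring. Qed.

Lemma lc_inj u v : lc u =1 lc v -> u = v.
Proof.
move=> e; apply/colP => i; case: (unliftP 0 i) => [k|] ->; last exact: (e 0).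
by rewrite ord1 (_ : lift 0 0 = 1); [exact: (e 1) | exact/val_inj].
Qed.

Definition lc_vec (h : 'I_3 -> K) : vec := \col_k if k == 0 then h 0 else h 1.

Lemma lc_vecK h : \sum_i h i = 0 -> lc (lc_vec h) =1 h.
Proof.
rewrite sum_ord3 => h0 i; rewrite /lc !mxE /=.
case: (ord3P i) => -> //=; apply/esym/eqP; rewrite -addr_eq0 addrC.
exact/eqP.
Qed.

(* The kernel of [(x_0^b_0, x_1^b_1, x_2^b_2) : O(n - b_0) + O(n - b_1) +
   O(n - b_2) -> O(n)], trivialized by sending a syzygy [(f_i)] to the vector
   with coordinates [x_i^b_i f_i]. *)
Definition Syz (b : 'I_3 -> nat) (n : int) (p : pt) : set vec :=
  [set v | forall i, Oloc (at_pt p) (n - (b i)%:Z) (Xk K i ^- b i * lc v i)].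

Definition gsections (U : set pt) (E : pt -> set vec) : set vec :=
  [set v | forall p, p != 0 -> U p -> E p v].

Definition cocycle (E : pt -> set vec) (s : 'I_3 -> 'I_3 -> vec) :=
  (forall i j, gsections (@chart C i `&` @chart C j) E (s i j)) /\
  (forall i j k, s i j + s j k = s i k).

Definition coboundary (E : pt -> set vec) (s : 'I_3 -> 'I_3 -> vec) :=
  exists m : 'I_3 -> vec,
    (forall i, gsections (@chart C i) E (m i)) /\ (forall i j, s i j = m j - m i).

Variable b : 'I_3 -> nat.

(* the cocycle [s] of [Syz b n] is the image of [w] under the connecting
   map H^0(O(n)) -> H^1(Syz b n) *)
Definition connecting (n : int) (s : 'I_3 -> 'I_3 -> vec) (w : S) :=
  exists mu : 'I_3 -> 'I_3 -> K,
  [/\ forall i c q, q != 0 -> q ord0 i != 0 -> Oloc (at_pt q) (n - (b c)%:Z) (mu i c),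
      forall i j c, lc (s i j) c = Xk K c ^+ b c * (mu j c - mu i c) &
      forall i, \sum_c Xk K c ^+ b c * mu i c = dh K w].

(** The degree [n] part of the ideal [(x_c ^ b_c)]; [homZ] makes cofactors of negative degree
    vanish. *)
Definition in_ideal (n : int) (w : S) :=
  exists A : 'I_3 -> S, w = \sum_c 'X_c ^+ b c * A c /\
    forall c, homZ (n - (b c)%:Z) (A c).

Let nX c : Xk K c ^+ b c != 0.
Proof. by rewrite expf_neq0 ?Xk_neq0. Qed.

(** Surjectivity of the connecting map: each coordinate of [s] has a primitive since
    [H^1(O(n - b_c)) = 0], and the images of the primitives in O(n) agree on overlaps, hence glue to
    a form. *)
Lemma cocycle_connecting n s : cocycle (Syz b n) s ->
  exists2 w, homZ n w & connecting n s w.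
Proof.
move=> [reg coc].
have /choice [mu hmu] : forall c, exists mu : 'I_3 -> K,
    (forall i q, q != 0 -> q ord0 i != 0 -> Oloc (at_pt q) (n - (b c)%:Z) (mu i)) /\
    (forall i j, Xk K c ^- b c * lc (s i j) c = mu j - mu i).
  move=> c; apply: H1_O_vanishes => [i j q nq qi qj|i j k]; first by apply: reg.
  by rewrite -mulrDr -lcD coc.
pose g i := \sum_c Xk K c ^+ b c * mu c i.
have gE i j : g i = g j.
  apply/eqP; rewrite -subr_eq0 /g -sumrB; apply/eqP.
  rewrite -[RHS](lc_sum0 (s j i)); apply: eq_bigr => c _.
  by have [_ h] := hmu c; rewrite -mulrBr -h mulrA mulfV ?mul1r.
have [|w hw ew] := @global_sections C K n (g 0).
  move=> q nq; have [_ _ [i qi]] := at_pt_place nq.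
  rewrite (gE _ i); apply: (Oloc_sum (at_pt_place nq)) => c _.
  rewrite -[n](subrK (b c)%:Z); apply: (Oloc_XnM (at_pt_place nq)).
  by have [h _] := hmu c; apply: h; move: qi; rewrite /at_pt mevalXU.
exists w => //; exists (fun i c => mu c i); split.
- by move=> i c q; have [h _] := hmu c; apply: h.
- move=> i j c; have [_ h] := hmu c.
  by rewrite -h mulrA mulfV ?mul1r.
- by move=> i; rewrite -ew (gE 0 i).
Qed.

Lemma Syz_intro n p v (f : 'I_3 -> K) :
  (forall c, lc v c = Xk K c ^+ b c * f c) ->
  (forall c, Oloc (at_pt p) (n - (b c)%:Z) (f c)) -> Syz b n p v.
Proof. by move=> e h c; rewrite e mulrA mulVf ?mul1r. Qed.

(** Exactness at [H^0(O(n))]. If [m] bounds [s] within the syzygies, the differences between [mu]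
    and the coordinates of [m] glue to forms [A c], which exhibit [w] in the ideal; conversely,
    subtracting the [A c] from [mu] leaves syzygies. *)
Lemma connecting_coboundary n s w : homZ n w -> connecting n s w ->
  coboundary (Syz b n) s <-> in_ideal n w.
Proof.
move=> hw [mu [reg es ew]]; split.
  move=> [m [hm em]].
  pose nu i c := Xk K c ^- b c * lc (m i) c.
  have regnu i c q : q != 0 -> q ord0 i != 0 -> Oloc (at_pt q) (n - (b c)%:Z) (nu i c).
    by move=> nq qi; apply: hm.
  have /choice [A hA] : forall c, exists A : S, homZ (n - (b c)%:Z) A /\
      forall i, mu i c = nu i c + dh K A.
    move=> c; have e i j : mu i c - nu i c = mu j c - nu j c.
      have : lc (s i j) c = lc (m j) c - lc (m i) c by rewrite em lcB.
      rewrite es => e; rewrite /nu.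
      have -> : mu j c = mu i c + Xk K c ^- b c * (lc (m j) c - lc (m i) c).
        by rewrite -e mulrA mulVf // mul1r; ring.
      by ring.
    have [|A hA eA] := @global_sections C K (n - (b c)%:Z) (mu 0 c - nu 0 c).
      move=> q nq; have [_ _ [i qi]] := at_pt_place nq.
      move: qi; rewrite /at_pt mevalXU => qi; rewrite (e _ i).
      by apply: (OlocB (at_pt_place nq)); [exact: reg|exact: regnu].
    by exists A; split=> // i; rewrite -eA -(e i 0); ring.
  exists A; split; last by move=> c; have [] := hA c.
  apply: (@dh_homZ_inj _ K n) => //.
    apply: homZ_sum => c _; rewrite -[n](subrK (b c)%:Z) addrC.
    by apply: homZM; [exact: homZXn | have [] := hA c].
  rewrite -(ew 0) (big_morph (dh K) (@dhD _ K) (@dh0 _ K)).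
  transitivity (\sum_c (lc (m 0) c + dh K ('X_c ^+ b c * A c))); last first.
    by rewrite big_split /= lc_sum0 add0r.
  apply: eq_bigr => c _; have [_ ->] := hA c.
  by rewrite mulrDr /nu mulrA mulfV // mul1r dhM dhXn.
move=> [A [eA hA]].
pose h i c := Xk K c ^+ b c * (mu i c - dh K (A c)).
have h0 i : \sum_c h i c = 0.
  transitivity (dh K w - dh K w); last by rewrite subrr.
  rewrite -[X in X - _](ew i) {1}eA (big_morph (dh K) (@dhD _ K) (@dh0 _ K)) -sumrB.
  by apply: eq_bigr => c _; rewrite /h mulrBr dhM dhXn.
exists (fun i => lc_vec (h i)); split.
  move=> i q nq qi; apply: (@Syz_intro n q _ (fun c => mu i c - dh K (A c))) => c.
    by rewrite lc_vecK.
  by apply: (OlocB (at_pt_place nq)); [exact: reg|apply: (Oloc_homZ K (at_pt_place nq))].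
move=> i j; apply: lc_inj => c; rewrite lcB !lc_vecK // es /h.
by ring.
Qed.

Lemma connecting_exists n w : homZ n w ->
  exists2 s, cocycle (Syz b n) s & connecting n s w.
Proof.
move=> hw.
have [mu [reg ew]] : exists mu : 'I_3 -> 'I_3 -> K,
    (forall i c q, q != 0 -> q ord0 i != 0 -> Oloc (at_pt q) (n - (b c)%:Z) (mu i c)) /\
    (forall i, \sum_c Xk K c ^+ b c * mu i c = dh K w).
  (* On chart [i], the form [w] is lifted to [w / x_i ^ b_i] in the [i]-th summand alone. *)
  exists (fun i c => if c == i then dh K w / Xk K i ^+ b i else 0); split.
    move=> i c q nq qi; case: eqVneq => [->|_]; last exact: (Oloc0 K (at_pt_place nq)).
    by apply: Xk_sectionsP; rewrite // addrC subrK.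
  move=> i; rewrite (bigD1 i) //= eqxx mulrC divfK // big1 ?addr0 // => c /negPf ->.
  by rewrite mulr0.
have [s es] : exists s : 'I_3 -> 'I_3 -> vec,
    forall i j c, lc (s i j) c = Xk K c ^+ b c * (mu j c - mu i c).
  exists (fun i j => lc_vec (fun c => Xk K c ^+ b c * (mu j c - mu i c))) => i j c.
  rewrite lc_vecK //; transitivity (dh K w - dh K w); last exact: subrr.
  by rewrite -{1}(ew j) -(ew i) -sumrB; apply: eq_bigr => d _; rewrite mulrBr.
exists s; last by exists mu.
split=> [i j q nq [qi qj]|i j k]; last first.
  by apply: lc_inj => c; rewrite lcD !es -mulrDr addrC addrA subrK.
apply: (@Syz_intro n q _ (fun c => mu j c - mu i c)) => c; first exact: es.
by apply: (OlocB (at_pt_place nq)); apply: reg.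
Qed.

Hypothesis b_gt0 : forall i, (0 < b i)%N.

Lemma in_ideal_coef n w m : in_ideal n w -> w@_m != 0 -> exists i, (b i <= m i)%N.
Proof.
move=> [A [-> _]] nm; apply: contrapT => h; move/eqP: nm; apply.
rewrite raddf_sum big1 //= => c _; rewrite mcoeff_XnM.
by case: leqP => // bm; case: h; exists c.
Qed.

Lemma in_idealP n w : homZ n w ->
  (forall m, w@_m != 0 -> exists i, (b i <= m i)%N) -> in_ideal n w.
Proof.
move=> hw h; have [|A [eA _ hA]] := @monomial_ideal_split C n xpredT b w hw.
  by move=> m /h [i bi]; exists i.
by exists A.
Qed.

Definition H1v (E : pt -> set vec) := forall s, cocycle E s -> coboundary E s.

(** The monomials with all exponents below the [b_i] form a basis modulo the ideal, and their
    degrees fill the interval from 0 to the sum of the [b_i - 1]. *)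
Lemma H1v_Syz n : H1v (Syz b n) <-> ~ (0 <= n <= (\sum_i (b i).-1)%N%:Z).
Proof.
split=> [van /andP [n0 nb]|out s cs].
  (* The exponents are filled greedily: [m0] as large as allowed, then [m1], and the rest goes to
     [m2]. *)
  have [m [mn mb]] : exists m : 'X_{1..3}, mdeg m = absz n /\ forall i, (m i < b i)%N.
    move: nb n0; rewrite sum_ord3 => nb n0.
    have := b_gt0 0; have := b_gt0 1; have := b_gt0 2%:R.
    set b0 := b 0 in nb *; set b1 := b 1 in nb *; set b2 := b 2%:R in nb *.
    move=> h2 h1 h0; pose a := absz n.
    pose m0 := minn a b0.-1; pose m1 := minn (a - m0) b1.-1; pose m2 := (a - m0 - m1)%N.
    pose m : 'X_{1..3} := [multinom if i == 0%R then m0 else if i == 1%R then m1 else m2 | i < 3].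
    exists m; split.
      rewrite mdegE sum_ord3 !mnmE /=; rewrite /m2 /m1 /m0 /a; lia.
    move=> i; rewrite mnmE; case: (ord3P i) => -> /=; rewrite -?/b0 -?/b1 -?/b2.
    - rewrite /m0; lia.
    - rewrite /m1; lia.
    - rewrite /m2 /m1 /m0 /a; lia.
  have hw : homZ n ('X_[m] : S).
    by move=> m'; rewrite mcoeffX; case: (eqVneq m m') => [<- _|_]; rewrite ?eqxx // mn; lia.
  have [s cs rs] := connecting_exists hw.
  have [/(_ (van _ cs)) hi _] := connecting_coboundary hw rs.
  have [|i bi] := in_ideal_coef (m := m) hi; first by rewrite mcoeffX eqxx oner_neq0.
  by have := mb i; rewrite ltnNge bi.
have [w hw rs] := cocycle_connecting cs.
apply/(connecting_coboundary hw rs)/in_idealP => // m nm.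
apply: contrapT => h; apply: out; rewrite -(hw m nm) /= lez_nat mdegE leq_sum // => i _.
case: (ltnP (m i) (b i)) => [lt|ge]; last by case: h; exists i.
by have := b_gt0 i; case: (b i) lt.
Qed.

End Syzygies.

(** * Lattices, twists and isomorphisms *)

Section Lattices.
Variables (C : closedFieldType) (K : model C).
Local Notation S := {mpoly C[3]}.
Local Notation pt := 'rV[C]_3.
Local Notation vec := 'cV[K]_2.
Implicit Types (F G w : S) (i j c : 'I_3) (f : K) (p q : pt) (u v : vec).
Implicit Types (g h : 'M[K]_2) (E : pt -> set vec).

(** The lattice [g O(n)^2] at the place [D], written as a condition on coordinates so that
    membership requires no witness. *)
Definition lat D g (n : int) : set vec :=
  [set v | forall r, Oloc D n ((invmx g *m v) r 0)].

Lemma lat_image D g : g \in unitmx ->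
  [set g *m w | w in [set w : vec | forall r, Oloc D 0 (w r 0)]] = lat D g 0.
Proof.
move=> ug; apply/seteqP; split=> [_ [w hw <-] r|v hv]; first by rewrite mulKmx.
by exists (invmx g *m v) => //; rewrite mulKVmx.
Qed.

Definition tw (n : int) E : pt -> set vec :=
  fun p => [set f *: v | f in Oloc (at_pt p) n & v in E p].

Lemma tw_lat n m E p g : p != 0 -> E p = lat (at_pt p) g m ->
  tw n E p = lat (at_pt p) g (n + m).
Proof.
move=> np eE; have hp := at_pt_place np; have [_ _ [j pj]] := hp.
apply/seteqP; split=> [_ [f hf [v hv <-]] r|v hv].
  rewrite -scalemxAr mxE; apply: (OlocM hp) => //.
  by move: hv; rewrite eE; apply.
exists (Xk K j ^ n); first by have /(Oloc_XzM hp 0 n 1 pj) := Oloc1 K hp; rewrite add0r mulr1.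
exists (Xk K j ^ (- n) *: v); last first.
  by rewrite scalerA -expfzDr ?Xk_neq0 // subrr expr0z scale1r.
rewrite eE => r; rewrite -scalemxAr mxE.
have -> : m = n + m - n by ring.
by apply/Oloc_XzM.
Qed.

(** Sheaves below are given by regularity of functionals; the frame is the inverse of the matrix of
    two independent functionals. *)
Lemma frame_of_functionals (phi : 'I_2 -> vec -> K) :
  (forall r u v, phi r (u + v) = phi r u + phi r v) ->
  (forall r f v, phi r (f *: v) = f * phi r v) ->
  (forall v, (forall r, phi r v = 0) -> v = 0) ->
  exists2 g, g \in unitmx & forall v r, (invmx g *m v) r 0 = phi r v.
Proof.
move=> phiD phiZ inj.
pose M : 'M[K]_2 := \matrix_(r, k) phi r (delta_mx k 0).
have eM v r : (M *m v) r 0 = phi r v.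
  have ev : v = \sum_k v k 0 *: delta_mx k 0.
    rewrite {1}[v]matrix_sum_delta; apply: eq_bigr => k _.
    by rewrite big_ord_recl big_ord0 addr0.
  have phi0 : phi r 0 = 0 by rewrite -(scale0r 0) phiZ mul0r.
  rewrite mxE {2}ev (big_morph (phi r) (phiD r) phi0).
  by apply: eq_bigr => k _; rewrite mxE phiZ mulrC.
have uM : M \in unitmx.
  rewrite -unitmx_tr -row_free_unit; apply: inj_row_free => v e.
  apply: trmx_inj; rewrite trmx0; apply: inj => r; rewrite -eM.
  by have := congr1 trmx e; rewrite trmx_mul trmxK trmx0 => ->; rewrite mxE.
by exists (invmx M); rewrite ?unitmx_inv // => v r; rewrite invmxK.
Qed.

Lemma lc_eq0 v j : (forall c, c != j -> lc v c = 0) -> v = 0.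
Proof.
move=> h; apply: lc_inj => c; have -> : lc (0 : vec) c = 0 by rewrite -(scale0r 0) lcZ mul0r.
have [->|] := eqVneq c j; last exact: h.
by have := lc_sum0 v; rewrite (bigD1 j) //= big1 ?addr0 // => c' /h.
Qed.

(** Where [x_j] is invertible, the two coordinates other than [j] are free and determine the third;
    the powers of [x_j] in [phi] bring them to degree 0. *)
Lemma Syz_frame b n j : exists2 g, g \in unitmx &
  forall p, p != 0 -> p ord0 j != 0 -> Syz b n p = lat (at_pt p) g 0.
Proof.
pose phi (r : 'I_2) v :=
  Xk K j ^ ((b (lift j r))%:Z - n) * (Xk K (lift j r) ^- b (lift j r) * lc v (lift j r)).
have [| | |g ug eg] := @frame_of_functionals phi.
- by move=> r u v; rewrite /phi lcD; ring.
- by move=> r f v; rewrite /phi lcZ; ring.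
- move=> v h; apply: (@lc_eq0 _ j) => c; case: (unliftP j c) => [r ->|->]; last by rewrite eqxx.
  have nz1 : Xk K j ^ ((b (lift j r))%:Z - n) != 0 by rewrite expfz_neq0 ?Xk_neq0.
  have nz2 : Xk K (lift j r) ^- b (lift j r) != 0 by rewrite invr_neq0 ?expf_neq0 ?Xk_neq0.
  by move=> _; apply: (mulfI nz2); apply: (mulfI nz1); rewrite !mulr0; apply: h.
exists g => // p np pj; have hp := at_pt_place np; have dj := at_ptX pj.
apply/seteqP; split=> v hv.
  move=> r; rewrite eg /phi.
  have -> : 0 = (n - (b (lift j r))%:Z) + ((b (lift j r))%:Z - n) by ring.
  exact/(Oloc_XzM hp)/hv.
have h c : c != j -> Oloc (at_pt p) (n - (b c)%:Z) (Xk K c ^- b c * lc v c).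
  case: (unliftP j c) => [r ->|->]; last by rewrite eqxx.
  move=> _; have := hv r; rewrite eg /phi.
  have {1}-> : 0 = (n - (b (lift j r))%:Z) + ((b (lift j r))%:Z - n) by ring.
  by move/(Oloc_XzM hp _ _ _ dj).
move=> c; have [->|/h //] := eqVneq c j.
have -> : lc v j = - \sum_(c | c != j) lc v c.
  by apply/eqP; rewrite -addr_eq0; have := lc_sum0 v; rewrite (bigD1 j) //= => ->.
rewrite [Xk K j ^- _]exprnN; apply/(Oloc_XzM hp)/OlocN => //; apply: (Oloc_sum hp) => d dj'.
have -> : lc v d = Xk K d ^+ b d * (Xk K d ^- b d * lc v d).
  by rewrite mulrA mulfV ?mul1r // expf_neq0 ?Xk_neq0.
rewrite -[n](subrK (b d)%:Z); apply: (Oloc_XnM hp); exact: h.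
Qed.

Lemma tw_Syz b n m p : p != 0 -> tw m (Syz b n) p = Syz b (n + m) p.
Proof.
move=> np; have hp := at_pt_place np; have [_ _ [j pj]] := hp.
apply/seteqP; split=> [_ [f hf [v hv <-]] c|v hv].
  rewrite lcZ mulrCA; have -> : n + m - (b c)%:Z = m + (n - (b c)%:Z) by ring.
  by apply: (OlocM hp) => //; apply: hv.
exists (Xk K j ^ m); first by have /(Oloc_XzM hp 0 m 1 pj) := Oloc1 K hp; rewrite add0r mulr1.
exists (Xk K j ^ (- m) *: v); last first.
  by rewrite scalerA -expfzDr ?Xk_neq0 // subrr expr0z scale1r.
move=> c; rewrite lcZ mulrCA.
have -> : n - (b c)%:Z = (n + m - (b c)%:Z) - m by ring.
by apply/(Oloc_XzM hp) => //; apply: hv.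
Qed.

Definition isoh h E E' :=
  h \in unitmx /\ forall p, p != 0 -> [set h *m v | v in E p] = E' p.

Lemma isoh_mem h E E' p v : isoh h E E' -> p != 0 -> E' p (h *m v) <-> E p v.
Proof.
move=> [uh e] np; rewrite -e //; split=> [[v' hv']|hv]; last by exists v.
by move/(congr1 (mulmx (invmx h))); rewrite !mulKmx // => <-.
Qed.

Lemma isohP h E E' : h \in unitmx ->
  (forall p v, p != 0 -> E' p (h *m v) <-> E p v) -> isoh h E E'.
Proof.
move=> uh e; split=> // p np; apply/seteqP; split=> [_ [v hv <-]|v hv].
  by apply/e.
by exists (invmx h *m v); rewrite ?mulKVmx //; apply/e; rewrite ?mulKVmx.
Qed.

Lemma isoh_sym h E E' : isoh h E E' -> isoh (invmx h) E' E.
Proof.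
move=> ih; have [uh _] := ih; apply: isohP; rewrite ?unitmx_inv // => p v np.
by rewrite -(isoh_mem _ ih np) mulKVmx.
Qed.

Lemma isoh_trans h h' E E' E'' : isoh h E E' -> isoh h' E' E'' -> isoh (h' *m h) E E''.
Proof.
move=> ih ih'; have [uh _] := ih; have [uh' _] := ih'.
apply: isohP; first by rewrite unitmx_mul uh uh'.
by move=> p v np; rewrite -mulmxA (isoh_mem _ ih' np) (isoh_mem _ ih np).
Qed.

Lemma isoh_eq E E' : (forall p, p != 0 -> E p = E' p) -> isoh 1%:M E E'.
Proof. by move=> e; apply: isohP; rewrite ?unitmx1 // => p v np; rewrite mul1mx e. Qed.

Lemma isoh_tw n h E E' : isoh h E E' -> isoh h (tw n E) (tw n E').
Proof.
move=> ih; have [uh e] := ih; apply: isohP => // p v np; split=> [[f hf [v' hv' ev]]|[f hf [v' hv' <-]]].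
  exists f => //; exists (invmx h *m v'); last by rewrite scalemxAr ev mulKmx.
  by rewrite -(isoh_mem _ ih np) mulKVmx.
by exists f => //; exists (h *m v'); rewrite ?scalemxAr //; apply/(isoh_mem _ ih np).
Qed.

Lemma isoh_cocycle h E E' s : isoh h E E' -> cocycle E s -> cocycle E' (fun i j => h *m s i j).
Proof.
move=> ih [reg coc]; split=> [i j q nq hq|i j k]; last by rewrite -mulmxDr coc.
by apply/(isoh_mem _ ih nq)/reg.
Qed.

Lemma isoh_coboundary h E E' s : isoh h E E' -> coboundary E s ->
  coboundary E' (fun i j => h *m s i j).
Proof.
move=> ih [m [hm em]]; exists (fun i => h *m m i); split=> [i q nq hq|i j].
  by apply/(isoh_mem _ ih nq)/hm.
by rewrite em mulmxBr.
Qed.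

Lemma isoh_H1v h E E' : isoh h E E' -> H1v E -> H1v E'.
Proof.
move=> ih van s cs; have ih' := isoh_sym ih; have [uh _] := ih.
have := isoh_coboundary ih (van _ (isoh_cocycle ih' cs)).
by congr coboundary; apply/funext => i; apply/funext => j; rewrite mulKVmx.
Qed.

(** Says that [x_i ^ k] annihilates the graded module formed by the [H^1(E(m))]. *)
Definition killsH1 E i (k : nat) := forall (m : int) s,
  cocycle (tw m E) s -> coboundary (tw (m + k%:Z) E) (fun a c => Xk K i ^+ k *: s a c).

Lemma isoh_killsH1 h E E' i k : isoh h E E' -> killsH1 E i k -> killsH1 E' i k.
Proof.
move=> ih kil m s cs; have ih' := isoh_tw m (isoh_sym ih); have [uh _] := ih.
have := isoh_coboundary (isoh_tw (m + k%:Z) ih) (kil _ _ (isoh_cocycle ih' cs)).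
congr coboundary; apply/funext => a; apply/funext => c.
by rewrite -scalemxAr mulKVmx.
Qed.

Lemma eq_cocycle E E' s : (forall p, p != 0 -> E p = E' p) -> cocycle E s -> cocycle E' s.
Proof. by move=> e [reg coc]; split=> // i j q nq hq; rewrite -e //; apply: reg. Qed.

Lemma eq_coboundary E E' s : (forall p, p != 0 -> E p = E' p) -> coboundary E s -> coboundary E' s.
Proof. by move=> e [m [hm em]]; exists m; split=> // i q nq hq; rewrite -e //; apply: hm. Qed.

(** Applied to the class of 1, which sits in the twist by [- n], [x_i ^ k] gives the class of
    [x_i ^ k], and this monomial is in the ideal exactly when [b_i <= k], the exponents being
    positive. *)
Lemma killsH1_Syz b n i k : (forall c, 0 < b c)%N -> killsH1 (Syz b n) i k <-> (b i <= k)%N.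
Proof.
move=> b_gt0; split=> [kil|bk m s].
  have h1 : homZ (0 : int) (1 : S) by apply/homZ_nat/dhomog1.
  have [s cs rs] := connecting_exists K b h1.
  have {}/kil : cocycle (tw (- n) (Syz b n)) s.
    by apply: eq_cocycle cs => p np; rewrite tw_Syz // subrr.
  move=> /(@eq_coboundary _ (Syz b k%:Z)) [p np|m [hm em]].
    by rewrite tw_Syz // addrA subrr add0r.
  have hX : homZ k%:Z ('X_i ^+ k : S) by exact: homZXn.
  have rX : connecting b k%:Z (fun a c => Xk K i ^+ k *: s a c) ('X_i ^+ k).
    have [mu [reg es ew]] := rs; exists (fun a c => Xk K i ^+ k * mu a c); split.
    - move=> a c q nq qa; rewrite addrC; have := reg a c q nq qa.
      by rewrite add0r => /(Oloc_XnM (at_pt_place nq) i k); rewrite addrC.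
    - by move=> a a' c; rewrite lcZ es; ring.
    - move=> a; rewrite dhXn -[RHS]mulr1 -dh1 -(ew a) mulr_sumr.
      by apply: eq_bigr => c _; rewrite mulrCA.
  have [/(_ (ex_intro _ m (conj hm em))) hi _] := connecting_coboundary hX rX.
  have [|c bc] := in_ideal_coef (m := (U_(i) *+ k)%MM) hi.
    by rewrite mpolyXn mcoeffX eqxx oner_neq0.
  move: bc; rewrite mulmnE mnm1E; case: eqVneq => [<-|_]; first by rewrite mul1n.
  by rewrite mul0n leqNgt b_gt0.
move=> /(@eq_cocycle _ (Syz b (n + m))) cs.
have {}cs : cocycle (Syz b (n + m)) s by apply: cs => p np; rewrite tw_Syz.
have [w hw [mu [reg es ew]]] := cocycle_connecting cs.
apply: (@eq_coboundary (Syz b (n + m + k%:Z))).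
  by move=> p np; rewrite tw_Syz // addrA.
have hX : homZ (n + m + k%:Z) ('X_i ^+ k * w).
  by rewrite addrC; apply: homZM => //; exact: homZXn.
have rX : connecting b (n + m + k%:Z) (fun a c => Xk K i ^+ k *: s a c) ('X_i ^+ k * w).
  exists (fun a c => Xk K i ^+ k * mu a c); split.
  - move=> a c q nq qa; have := Oloc_XnM (at_pt_place nq) i k (reg a c q nq qa).
    by congr Oloc; ring.
  - by move=> a a' c; rewrite lcZ es; ring.
  - move=> a; rewrite dhM dhXn -(ew a) mulr_sumr.
    by apply: eq_bigr => c _; rewrite mulrCA.
apply/(connecting_coboundary hX rX)/in_idealP => // m'.
by rewrite mcoeff_XnM; case: leqP => [h _|_]; [exists i; exact: leq_trans h|rewrite eqxx].
Qed.

(** The least annihilating power of [x_i] is [b_i], and [- n] is the lowest twist with nonzero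
    [H^1]: were [n2 < n1], twisting by [- n1] would give vanishing on one side and the class of 1 on
    the other. *)
Lemma Syz_isoh_inj h b b' n n' : (forall c, 0 < b c)%N -> (forall c, 0 < b' c)%N ->
  isoh h (Syz b n) (Syz b' n') -> b =1 b' /\ n = n'.
Proof.
move=> b0 b0' ih; have ih' := isoh_sym ih.
have eb : b =1 b'.
  move=> i; apply/eqP; rewrite eqn_leq; apply/andP; split.
    by apply/(killsH1_Syz n _ _ b0)/(isoh_killsH1 ih')/(killsH1_Syz n' _ _ b0').
  by apply/(killsH1_Syz n' _ _ b0')/(isoh_killsH1 ih)/(killsH1_Syz n _ _ b0).
split=> //.
have key b1 b2 n1 n2 h' : (forall c, 0 < b1 c)%N -> (forall c, 0 < b2 c)%N ->
    isoh h' (Syz b1 n1) (Syz b2 n2) -> 0 <= n2 - n1.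
  move=> p1 p2 ih1; apply/negPn/negP => lt0.
  have : H1v (tw (- n1) (Syz b2 n2)).
    have e : forall p, p != 0 -> Syz b2 (n2 - n1) p = tw (- n1) (Syz b2 n2) p.
      by move=> p np; rewrite tw_Syz.
    apply: (isoh_H1v (isoh_eq e)); apply/(H1v_Syz _ p2) => /andP [] h0.
    by rewrite h0 in lt0.
  move/(isoh_H1v (isoh_tw (- n1) (isoh_sym ih1))).
  have e : forall p, p != 0 -> tw (- n1) (Syz b1 n1) p = Syz b1 0 p.
    by move=> p np; rewrite tw_Syz // subrr.
  move/(isoh_H1v (isoh_eq e))/(H1v_Syz _ p1); apply.
  by rewrite Order.POrderTheory.lexx.
have k1 := key _ _ _ _ _ b0 b0' ih; have k2 := key _ _ _ _ _ b0' b0 ih'.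
by lia.
Qed.

End Lattices.

(** * Indecomposability of syzygy bundles *)

Section NonSplit.
Variables (C : closedFieldType) (K : model C).
Local Notation S := {mpoly C[3]}.
Local Notation pt := 'rV[C]_3.
Local Notation vec := 'cV[K]_2.
Implicit Types (F G : S) (i j c d : 'I_3) (f : K) (p q : pt) (u v : vec).
Implicit Types (e : 'M[K]_2) (A B : 'I_3 -> 'I_3 -> S).

Variables (b : 'I_3 -> nat) (n : int).
Hypothesis b_gt0 : forall i, (0 < b i)%N.

Let nX c : Xk K c ^+ b c != 0.
Proof. by rewrite expf_neq0 ?Xk_neq0. Qed.

Let nV c : Xk K c ^- b c != 0.
Proof. by rewrite invr_neq0. Qed.

(* the graded matrix [A] induces [e] on syzygies *)
Definition lifts e A := (forall c j, homZ ((b j)%:Z - (b c)%:Z) (A c j)) /\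
  forall v c, Xk K c ^- b c * lc (e *m v) c =
    \sum_j dh K (A c j) * (Xk K j ^- b j * lc v j).

Lemma lc_sumZ (I : Type) (r : seq I) (h : I -> K) (u : I -> vec) c :
  lc (\sum_(x <- r) h x *: u x) c = \sum_(x <- r) h x * lc (u x) c.
Proof.
elim: r => [|x r IH]; first by rewrite !big_nil -(scale0r 0) lcZ mul0r.
by rewrite !big_cons lcD lcZ IH.
Qed.

(* Ext^1(O(n), O(n - b_c)) = 0 makes every endomorphism lift *)
Lemma lift_exists e :
  (forall p v, p != 0 -> Syz b n p v -> Syz b n p (e *m v)) -> exists A, lifts e A.
Proof.
move=> pres.
(* [d i j] is the difference of the unit vectors [j] and [i]; these vectors form a cocycle and span
   the plane. *)
have [d hd] : exists d : 'I_3 -> 'I_3 -> vec,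
    forall i j c, lc (d i j) c = (c == j)%:R - (c == i)%:R.
  exists (fun i j => lc_vec (fun c => (c == j)%:R - (c == i)%:R)) => i j c.
  rewrite lc_vecK // sumrB.
  suff h (k : 'I_3) : \sum_(l < 3) (l == k)%:R = 1 :> K by rewrite !h subrr.
  by rewrite (bigD1 k) //= eqxx big1 ?addr0 // => l /negPf ->.
have dD i j k : d i j + d j k = d i k.
  by apply: lc_inj => c; rewrite lcD !hd addrC addrA subrK.
pose phi c v := Xk K c ^- b c * lc (e *m v) c.
have phiZ c f v : phi c (f *: v) = f * phi c v.
  by rewrite /phi -scalemxAr lcZ mulrCA.
have phiD c u v : phi c (u + v) = phi c u + phi c v.
  by rewrite /phi mulmxDr lcD mulrDr.
have dsec (z : int) i j f q : q != 0 -> q ord0 i != 0 ->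
    Oloc (at_pt q) z f -> Oloc (at_pt q) (z - (b j)%:Z) (Xk K j ^- b j * f) ->
    forall c, Oloc (at_pt q) (z - (b c)%:Z) (phi c (f *: d i j)).
  move=> nq qi h1 h2 c; have hq := at_pt_place nq; have di := at_ptX qi.
  have : Syz b n q (Xk K i ^ (n - z) *: (f *: d i j)).
    move=> l; rewrite !lcZ hd mulrCA.
    have -> : n - (b l)%:Z = z - (b l)%:Z + (n - z) by ring.
    apply/(Oloc_XzM hq) => //.
    have [e1|n1] := eqVneq l j; have [e2|n2] := eqVneq l i.
    - by rewrite subrr !mulr0; apply: Oloc0.
    - by rewrite subr0 mulr1 e1.
    - rewrite sub0r mulrN1 mulrN; apply: OlocN.
      by rewrite e2 exprnN; apply/(Oloc_XzM hq).
    - by rewrite subrr !mulr0; apply: Oloc0.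
  move=> /(pres _ _ nq)/(_ c); rewrite -/(phi c _) [phi c (_ ^ _ *: _)]phiZ.
  have -> : n - (b c)%:Z = z - (b c)%:Z + (n - z) by ring.
  by move/(Oloc_XzM hq _ _ _ di).
(* [phi c (d i j)] is a cocycle of [O(- b_c)]. A primitive [tau] of it extends the [c]-th coordinate
   of [e] to the sum of the three line bundles, with value [tau j] on the [j]-th unit vector. *)
have /choice [tau htau] : forall c, exists tau : 'I_3 -> K,
    (forall i q, q != 0 -> q ord0 i != 0 -> Oloc (at_pt q) (- (b c)%:Z) (tau i)) /\
    (forall i j, phi c (d i j) = tau j - tau i).
  move=> c; apply: H1_O_vanishes => [i j q nq qi qj|i j k]; last by rewrite -phiD dD.
  have hq := at_pt_place nq.
  rewrite -[d i j]scale1r -[X in Oloc _ X]add0r; apply: dsec => //; first exact: Oloc1.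
  rewrite exprnN; apply/(Oloc_XzM hq); [exact: at_ptX|exact: Oloc1].
have /choice [A hA] : forall cj : 'I_3 * 'I_3, exists A : S,
    homZ ((b cj.2)%:Z - (b cj.1)%:Z) A /\ Xk K cj.2 ^+ b cj.2 * tau cj.1 cj.2 = dh K A.
  move=> [c j] /=; have [|A hA eA] := @global_sections C K ((b j)%:Z - (b c)%:Z) (Xk K j ^+ b j * tau c j).
    move=> q nq; have hq := at_pt_place nq; have [_ _ [i qi]] := hq.
    move: qi; rewrite /at_pt mevalXU => qi; have [reg et] := htau c.
    have -> : Xk K j ^+ b j * tau c j = phi c (Xk K j ^+ b j *: d i j) + Xk K j ^+ b j * tau c i.
      by rewrite phiZ et -mulrDr subrK.
    apply: (OlocD hq).
      apply: dsec => //.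
        have := Oloc_XnM hq j (b j) (Oloc1 K hq).
        by rewrite add0r mulr1.
      by rewrite subrr mulVf //; apply: Oloc1.
    by rewrite addrC; apply: (Oloc_XnM hq); exact: reg.
  by exists A.
exists (fun c j => A (c, j)); split=> [c j|v c]; first by have [] := hA (c, j).
rewrite -/(phi c v).
have ev : v = \sum_j lc v j *: d 0 j.
  apply: lc_inj => l; rewrite lc_sumZ.
  transitivity (\sum_j (lc v j * (l == j)%:R - lc v j * (l == 0)%:R)).
    rewrite sumrB -mulr_suml lc_sum0 mul0r subr0 (bigD1 l) //= eqxx mulr1 big1 ?addr0 //.
    by move=> j; rewrite eq_sym => /negPf ->; rewrite mulr0.
  by apply: eq_bigr => j _; rewrite hd mulrBr.
have phi0 : phi c 0 = 0 by rewrite -(scale0r 0) phiZ mul0r.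
rewrite {1}ev (big_morph (phi c) (phiD c) phi0).
have [_ et] := htau c.
transitivity (\sum_j (lc v j * tau c j - lc v j * tau c 0)).
  by apply: eq_bigr => j _; rewrite phiZ et mulrBr.
rewrite sumrB -mulr_suml lc_sum0 mul0r subr0; apply: eq_bigr => j _.
have [_ /= <-] := hA (c, j).
by rewrite mulrAC mulrA mulfV // mul1r mulrC.
Qed.

Lemma homZ0_const F : homZ 0 F -> F = (F@_0)%:MP.
Proof.
move=> hF; apply/mpolyP => m; rewrite mcoeffC.
case: (eqVneq 0%MM m) => [<-|nm]; first by rewrite mulr1.
rewrite mulr0; apply/eqP/negPn/negP => /hF [] /eqP.
by rewrite mdeg_eq0 eq_sym (negPf nm).
Qed.

Lemma lifts_mul e e' A B : lifts e A -> lifts e' B ->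
  lifts (e *m e') (fun c j => \sum_d A c d * B d j).
Proof.
move=> [hA eA] [hB eB]; split=> [c j|v c].
  apply: homZ_sum => d _.
  have -> : (b j)%:Z - (b c)%:Z = (b d)%:Z - (b c)%:Z + ((b j)%:Z - (b d)%:Z) by ring.
  exact: homZM.
rewrite -mulmxA eA.
transitivity (\sum_d \sum_j dh K (A c d) * (dh K (B d j) * (Xk K j ^- b j * lc v j))).
  by apply: eq_bigr => d _; rewrite eB mulr_sumr.
rewrite exchange_big /=; apply: eq_bigr => j _.
rewrite (big_morph (dh K) (@dhD _ K) (@dh0 _ K)) mulr_suml.
by apply: eq_bigr => d _; rewrite dhM mulrA.
Qed.

(** The row [y = (x_c ^ b_c) A] vanishes on syzygies, hence is proportional to [(x_c ^ b_c)], and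
    [y j = l x_j ^ b_j] by degrees. The coefficients of the [x_i ^ b_i] show that the constant terms
    of [A] form a scalar matrix. The diagonal of [A] is constant, so its trace [3 l] is [l] from the
    quotient line plus the trace of [e]. *)
Lemma lifts_scalar e A : lifts e A -> exists l : C,
  (forall c j, (A c j)@_0 = if c == j then l else 0) /\ \tr e = dh K (l + l)%:MP.
Proof.
move=> [hA eA].
pose y j : S := \sum_c 'X_c ^+ b c * A c j.
have hy j : homZ (b j)%:Z (y j).
  apply: homZ_sum => c _; have -> : (b j)%:Z = (b c)%:Z + ((b j)%:Z - (b c)%:Z) by ring.
  by apply: homZM => //; exact: homZXn.
have y0 v : \sum_j dh K (y j) * (Xk K j ^- b j * lc v j) = 0.
  transitivity (\sum_c lc (e *m v) c); last exact: lc_sum0.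
  transitivity (\sum_c \sum_j Xk K c ^+ b c * (dh K (A c j) * (Xk K j ^- b j * lc v j))).
    rewrite [RHS]exchange_big /=; apply: eq_bigr => j _.
    rewrite (big_morph (dh K) (@dhD _ K) (@dh0 _ K)) mulr_suml.
    by apply: eq_bigr => c _; rewrite dhM dhXn -mulrA.
  by apply: eq_bigr => c _; rewrite -mulr_sumr -eA mulrA mulfV ?mul1r.
(* Obtained from the syzygy supported on the coordinates [j] and [k]. *)
have yjk j k : 'X_k ^+ b k * y j = 'X_j ^+ b j * y k.
  have [->//|jk] := eqVneq j k.
  apply: (@dh_homZ_inj _ K ((b j)%:Z + (b k)%:Z)).
  - by rewrite addrC; apply: homZM => //; exact: homZXn.
  - by apply: homZM => //; exact: homZXn.
  have h0 : \sum_(c < 3) ((c == j)%:R - (c == k)%:R) = 0 :> K.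
    rewrite sumrB; suff h (l : 'I_3) : \sum_(c < 3) (c == l)%:R = 1 :> K by rewrite !h subrr.
    by rewrite (bigD1 l) //= eqxx big1 ?addr0 // => c /negPf ->.
  have := y0 (lc_vec (fun c => (c == j)%:R - (c == k)%:R)).
  rewrite (bigD1 j) //= (bigD1 k) 1?eq_sym //= big1 => [|c /andP [cj ck]]; last first.
    by rewrite lc_vecK // (negPf cj) (negPf ck) subrr !mulr0.
  rewrite !lc_vecK // !eqxx [k == j]eq_sym (negPf jk) subr0 sub0r addr0 mulr1 !mulrN1 mulrN.
  move/eqP; rewrite subr_eq0 => /eqP h; rewrite !dhM !dhXn.
  have -> : dh K (y j) = Xk K j ^+ b j * (dh K (y k) / Xk K k ^+ b k).
    by rewrite -h mulrCA mulfV ?mulr1.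
  by rewrite mulrCA; congr (_ * _); rewrite mulrC divfK.
have ym j m : (y j)@_m != 0 -> m = (U_(j) *+ b j)%MM.
  move=> nm; have dj := hy j m nm.
  have bm : (b j <= m j)%N.
    pose k := lift j 0; have jk : j != k := neq_lift _ _.
    have := congr1 (mcoeff (m + U_(k) *+ b k)) (yjk j k).
    rewrite !mcoeff_XnM !mnmDE !mulmnE !mnm1E eqxx mul1n leq_addl addmK.
    rewrite eq_sym (negPf jk) mul0n addn0; case: leqP => // _ h.
    by rewrite h eqxx in nm.
  have [dj'] : Posz (mdeg (m - U_(j) *+ b j)) = 0.
    have le : (U_(j) *+ b j <= m)%MM.
      apply/mnm_lepP => i; rewrite mulmnE mnm1E.
      by case: eqVneq => [<-|_]; rewrite ?mul1n ?mul0n.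
    move: dj; rewrite -{1}(submK le) mdegD mdegMn mdeg1 mul1n PoszD => /eqP.
    by rewrite -subr_eq0 addrK => /eqP.
  move/eqP: dj'; rewrite mdeg_eq0 => /eqP e0.
  rewrite -[m in LHS](submK (m := (U_(j) *+ b j)%MM)) ?e0 ?add0m //.
  apply/mnm_lepP => i; rewrite mulmnE mnm1E.
  by case: eqVneq => [<-|_]; rewrite ?mul1n ?mul0n.
have ycoef i j : (y j)@_(U_(i) *+ b i) = (A i j)@_0.
  rewrite raddf_sum (bigD1 i) //= big1 ?addr0 => [|c ci].
    rewrite mcoeff_XnM mulmnE mnm1E eqxx mul1n leqnn; congr (_ @_ _).
    by apply/mnmP => l; rewrite mnmBE subnn mnm0E.
  rewrite mcoeff_XnM mulmnE mnm1E eq_sym (negPf ci) mul0n.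
  by rewrite leqNgt b_gt0.
have UU i j : (U_(i) *+ b i)%MM = (U_(j) *+ b j)%MM -> i = j.
  move=> /mnmP /(_ i); rewrite !mulmnE !mnm1E eqxx mul1n.
  case: eqVneq => // _; rewrite mul0n => h.
  by have := b_gt0 i; rewrite h.
pose l := (A 0 0)@_0.
have Ajj j : (A j j)@_0 = l.
  rewrite /l -!ycoef.
  have := congr1 (mcoeff (U_(j) *+ b j + U_(0%R) *+ b 0%R)%MM) (yjk j 0).
  rewrite !mcoeff_XnM !mnmDE !mulmnE !mnm1E !eqxx !mul1n leq_addl leq_addr addmK.
  by rewrite addmC addmK.
exists l; split=> [c j|].
  case: eqVneq => [->|cj]; first exact: Ajj.
  apply/eqP/negPn/negP; rewrite -ycoef => /ym /UU e'.
  by rewrite e' eqxx in cj.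
have y2 : y 2%:R = l%:MP * 'X_2%:R ^+ b 2%:R.
  apply/mpolyP => m; rewrite mul_mpolyC mcoeffZ mpolyXn mcoeffX.
  case: (eqVneq (U_(2%:R) *+ b 2%:R)%MM m) => [<-|nm]; first by rewrite mulr1 ycoef Ajj.
  by rewrite mulr0; apply/eqP/negPn/negP => /ym e'; rewrite e' eqxx in nm.
have Ac j : A j j = l%:MP.
  by rewrite -(Ajj j); apply: homZ0_const; have := hA j j; rewrite subrr.
have lcd (i : 'I_2) c : lc (e *m delta_mx i 0) c =
    if c == 0 then e 0 i else if c == 1 then e 1 i else - (e 0 i + e 1 i).
  by rewrite -colE /lc !mxE.
have e00 : e 0 0 = dh K (A 0 0) - dh K (A 0 2%:R) * Xk K 2%:R ^- b 2%:R.
  have := eA (delta_mx 0 0) 0; rewrite lcd sum_ord3 /lc /= !mxE /= Xk0 expr1n invr1 !mul1r.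
  by move=> ->; ring.
have e11 : e 1 1 = Xk K 1 ^+ b 1 * (dh K (A 1 1) * Xk K 1 ^- b 1 - dh K (A 1 2%:R) * Xk K 2%:R ^- b 2%:R).
  have := eA (delta_mx 1 0) 1; rewrite lcd sum_ord3 /lc /= !mxE /=.
  move=> /(canRL (mulKf (nV 1))) ->; rewrite invrK; congr (_ * _); ring.
have trE : \tr e = e 0 0 + e 1 1.
  by rewrite /mxtrace !big_ord_recl big_ord0 addr0; congr (_ + e _ _); apply/val_inj.
have : dh K (y 2%:R) = dh K l%:MP * Xk K 2%:R ^+ b 2%:R by rewrite y2 dhM dhXn.
rewrite /y sum_ord3 !Ac !dhD !dhM !dhXn -/(Xk K _) => ey.
rewrite trE e00 e11 !Ac mpolyCD dhD.
have {}ey : Xk K 0 ^+ b 0 * dh K (A 0 2%:R) + Xk K 1 ^+ b 1 * dh K (A 1 2%:R) = 0.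
  by apply: (addIr (Xk K 2%:R ^+ b 2%:R * dh K l%:MP)); rewrite ey add0r mulrC.
rewrite Xk0 expr1n mul1r in ey.
have -> : dh K (A 0 2%:R) = - (Xk K 1 ^+ b 1 * dh K (A 1 2%:R)) by apply/eqP; rewrite -addr_eq0 ey.
rewrite mulrBr [Xk K 1 ^+ b 1 * (dh K l%:MP * _)]mulrCA mulfV // mulr1.
by ring.
Qed.

(** The constant terms multiply, so a trace 1 idempotent would give [2 l = 1] and [2 l ^ 2 = 1],
    hence [l = 1] and [2 = 1]. *)
Lemma Syz_no_idempotent e :
  (forall p v, p != 0 -> Syz b n p v -> Syz b n p (e *m v)) ->
  e *m e = e -> \tr e != 1.
Proof.
move=> pres ee; apply/eqP => tr1.
have [A lA] := lift_exists pres.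
have [l [Al tl]] := lifts_scalar lA.
have lAA := lifts_mul lA lA; rewrite ee in lAA.
have [l' [Al' tl']] := lifts_scalar lAA.
have el' : l' = l * l.
  have := Al' 0 0; rewrite eqxx => <-; rewrite raddf_sum (bigD1 0) //= big1 ?addr0.
    by rewrite rmorphM /= Al.
  by move=> c c0; rewrite rmorphM /= !Al (negPf c0) mulr0.
have cinj (x y : C) : dh K x%:MP = dh K y%:MP -> x = y.
  move=> h; have hc (z : C) : homZ 0 (z%:MP : S).
    by apply/homZ_nat; rewrite -alg_mpolyC rpredZ ?dhomog1.
  have /(congr1 (mcoeff 0%MM)) := dh_homZ_inj (hc x) (hc y) h.
  by rewrite !mcoeffC eqxx !mulr1.
have one : dh K (1 : C)%:MP = 1 by rewrite mpolyC1 dh1.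
have e1 : l + l = 1 by apply: cinj; rewrite one -tl.
have e2 : l' + l' = 1 by apply: cinj; rewrite one -tl'.
have e3 : l = 1 by rewrite -e2 el' -mulrDr e1 mulr1.
by move/eqP: e1; rewrite e3 -subr_eq0 addrK oner_eq0.
Qed.

End NonSplit.

(** * Torus-stable bundles and their normal form on coordinate lines *)

Section Torus.
Variables (C : closedFieldType) (K : model C).
Local Notation S := {mpoly C[3]}.
Local Notation pt := 'rV[C]_3.
Local Notation vec := 'cV[K]_2.
Implicit Types (F G : S) (i j c : 'I_3) (f : K) (p q : pt) (u v : vec).
Implicit Types (g h : 'M[K]_2) (E : pt -> set vec) (t : C * C).

Definition tau t i : C := [tuple 1; t.1; t.2]`_i.
Definition tinv t : C * C := (t.1^-1, t.2^-1).

Lemma tau_neq0 t i : torus t -> tau t i != 0.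
Proof. by move=> [t1 t2]; rewrite /tau; case: (ord3P i) => -> //=; rewrite oner_neq0. Qed.

Lemma tau_inv t i : tau (tinv t) i = (tau t i)^-1.
Proof. by rewrite /tau; case: (ord3P i) => -> //=; rewrite invr1. Qed.

Lemma torus_inv t : torus t -> torus (tinv t).
Proof. by move=> [t1 t2]; split; rewrite invr_neq0. Qed.

Lemma tinvK t : tinv (tinv t) = t.
Proof. by case: t => x y; rewrite /tinv /= !invrK. Qed.

Lemma actE t p i : act t p ord0 i = p ord0 i * tau t i.
Proof. by rewrite mxE. Qed.

Lemma act_eq0 t p i : torus t -> (act t p ord0 i == 0) = (p ord0 i == 0).
Proof. by move=> tt; rewrite actE mulf_eq0 (negPf (tau_neq0 i tt)) orbF. Qed.

Lemma act_neq0 t p : torus t -> p != 0 -> act t p != 0.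
Proof.
move=> tt; apply: contra_neq => e; apply/rowP => i; rewrite mxE; apply/eqP.
by rewrite -(act_eq0 p i tt) e mxE.
Qed.

Lemma actK t p : torus t -> act (tinv t) (act t p) = p.
Proof.
by move=> tt; apply/rowP => i; rewrite !actE tau_inv mulfK ?tau_neq0.
Qed.

(** The substitution on forms that induces [pull]; [tau t] lists the weights [1, t_1, t_2]. *)
Definition sc t F : S := F \mPo [tuple tau t i *: 'X_i | i < 3].

Lemma sc_nth t i : [tuple tau t i *: ('X_i : S) | i < 3]`_i = tau t i *: 'X_i.
Proof. by rewrite (nth_map i) ?size_enum_ord // nth_ord_enum. Qed.

Lemma meval_sc t F p : (sc t F).@[p ord0] = F.@[act t p ord0].
Proof. by apply: meval_comp => i; rewrite sc_nth mevalZ mevalXU actE mulrC. Qed.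

Lemma sc_X t (m : 'X_{1..3}) : sc t 'X_[m] = (\prod_i tau t i ^+ m i) *: 'X_[m].
Proof.
rewrite /sc comp_mpolyX [in RHS]mpolyXE_id -mul_mpolyC rmorph_prod -big_split.
apply: eq_bigr => i _; rewrite (tnth_nth 0) sc_nth rmorphXn /= -mul_mpolyC exprMn.
by [].
Qed.

Lemma mcoeff_sc t F m : (sc t F)@_m = (\prod_i tau t i ^+ m i) * F@_m.
Proof.
elim/mpolyind: F => [|c k P _ _ IH]; first by rewrite /sc comp_mpoly0 !mcoeff0 mulr0.
rewrite /sc comp_mpolyD comp_mpolyZ -!/(sc _ _) sc_X !mcoeffD !mcoeffZ IH !mcoeffX.
by case: (eqVneq k m) => [->|_]; [ring | rewrite !mulr0; ring].
Qed.

Lemma sc_homog t F k : F \is k.-homog -> sc t F \is k.-homog.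
Proof.
move=> /dhomogP h; apply/dhomogP => m; rewrite mcoeff_msupp mcoeff_sc mulf_eq0 negb_or.
by move=> /andP [_]; rewrite -mcoeff_msupp; apply: h.
Qed.

Lemma scK t F : torus t -> sc (tinv t) (sc t F) = F.
Proof.
move=> tt; apply/mpolyP => m.
have h : (\prod_i tau (tinv t) i ^+ m i) * (\prod_i tau t i ^+ m i) = 1.
  rewrite -big_split /=; apply: big1 => i _.
  by rewrite -exprMn tau_inv mulVf ?tau_neq0 // expr1n.
by rewrite 2!mcoeff_sc mulrA h mul1r.
Qed.

Lemma rst_sc t i F : rst i (sc t F) = sc t (rst i F).
Proof.
apply/mpolyP => m; rewrite mcoeff_rst 2!mcoeff_sc mcoeff_rst.
by case: eqP; rewrite ?mulr0.
Qed.

Lemma at_line_sc t i F : torus t -> at_line i (sc t F) = at_line i F.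
Proof.
move=> tt; rewrite /at_line rst_sc; congr (~~ _); apply/eqP/eqP => [e|->].
  by rewrite -(scK (rst i F) tt) e /sc comp_mpoly0.
by rewrite /sc comp_mpoly0.
Qed.

Local Notation pull := (@mpull C K).

Lemma pull_dh t F : torus t -> pull t (dh K F) = dh K (sc t F).
Proof.
move=> [t1 t2]; rewrite /dh mpullE //; congr (emb K _).
rewrite /scale_vars /dehomP /sc !comp_mpolyA; congr (F \mPo _).
apply: eq_from_tnth => i; rewrite !(tnth_nth 0) (nth_map 0) ?size_tuple //.
rewrite [RHS](nth_map 0) ?size_tuple // sc_nth comp_mpolyZ comp_mpolyXU.
case: (ord3P i) => -> /=; rewrite ?scale1r ?comp_mpolyXU /= ?(comp_mpoly1) //.
Qed.

Lemma pullK t f : torus t -> pull (tinv t) (pull t f) = f.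
Proof.
move=> tt; have ti := torus_inv tt; have [k [F [G [_ _ _ ->]]]] := frac_forms f.
by rewrite !fmorph_div /= !pull_dh // !scK.
Qed.

Lemma pullVK t f : torus t -> pull t (pull (tinv t) f) = f.
Proof. by move=> tt; rewrite -{1}(tinvK t) pullK //; exact: torus_inv. Qed.

Lemma Oloc_pull_sub t p n f : torus t ->
  Oloc (at_pt (act t p)) n f -> Oloc (at_pt p) n (pull t f).
Proof.
move=> tt [k [l [F [G [hF hG e DG ->]]]]].
rewrite fmorph_div /= !pull_dh //; apply: (@Oloc_intro _ _ _ k l); rewrite ?sc_homog //.
by rewrite /at_pt meval_sc.
Qed.

Lemma Oloc_pull t p n f : torus t ->
  Oloc (at_pt p) n (pull t f) <-> Oloc (at_pt (act t p)) n f.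
Proof.
move=> tt; split; last exact: Oloc_pull_sub.
move=> h; rewrite -(pullK f tt); apply: Oloc_pull_sub; first exact: torus_inv.
by rewrite actK.
Qed.

Lemma Oloc_line_pull t i n f : torus t ->
  Oloc (at_line i) n f -> Oloc (at_line i) n (pull t f).
Proof.
move=> tt [k [l [F [G [hF hG e DG ->]]]]].
rewrite fmorph_div /= !pull_dh //; apply: (@Oloc_intro _ _ _ k l); rewrite ?sc_homog //.
by rewrite at_line_sc.
Qed.

Definition cst (x : C) : K := dh K x%:MP.

Lemma pull_cst t x : torus t -> pull t (cst x) = cst x.
Proof. by move=> tt; rewrite /cst pull_dh // /sc comp_mpolyC. Qed.

Lemma cstM x y : cst (x * y) = cst x * cst y.
Proof. by rewrite /cst mpolyCM dhM. Qed.

Lemma cst_eq0 x : (cst x == 0) = (x == 0).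
Proof.
rewrite /cst (@dh_eq0 _ _ _ 0) ?mpolyC_eq0 //.
by rewrite -alg_mpolyC rpredZ ?dhomog1.
Qed.

Lemma pull_Xk t i : torus t -> pull t (Xk K i) = cst (tau t i) * Xk K i.
Proof.
move=> tt; rewrite /Xk pull_dh // /sc comp_mpolyXU sc_nth /cst -dhM.
by rewrite mul_mpolyC.
Qed.

Definition pullv t v : vec := map_mx (pull t) v.

(** Stability under the torus acting on [K^2] through the coefficients alone, so that the identity
    matrix is an equivariant structure. *)
Definition invar E := forall t p v, torus t -> p != 0 ->
  E p (pullv t v) <-> E (act t p) v.

Definition lfree E := forall p, p != 0 -> exists (k : nat) F g,
  [/\ F \is k.-homog, F.@[p ord0] != 0, g \in unitmx &
      forall q, q != 0 -> F.@[q ord0] != 0 -> E q = lat (at_pt q) g 0].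

Lemma Oloc_spread D n f : Oloc D n f -> exists (k : nat) G, [/\ G \is k.-homog, D G &
  forall q, G.@[q ord0] != 0 -> Oloc (at_pt q) n f].
Proof.
move=> [k [l [F [G [hF hG e DG ->]]]]]; exists l, G; split=> // q Gq.
exact: (@Oloc_intro _ _ _ k l).
Qed.

Lemma Oloc_spread_seq D (hD : place D) n (s : seq K) : (forall f, f \in s -> Oloc D n f) ->
  exists (k : nat) G, [/\ G \is k.-homog, D G &
  forall q, G.@[q ord0] != 0 -> forall f, f \in s -> Oloc (at_pt q) n f].
Proof.
elim: s => [|f s IH] h; first by exists 0%N, 1; rewrite dhomog1; split=> //; exact: place1.
have [|k [G [hG DG sG]]] := IH; first by move=> f' fs; apply: h; rewrite inE fs orbT.
have [l [G' [hG' DG' sG']]] := Oloc_spread (h f (mem_head _ _)).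
exists (k + l)%N, (G * G'); split; rewrite ?dhomogM ?(placeM hD) ?DG //.
move=> q; rewrite mevalM mulf_eq0 negb_or => /andP [n1 n2] f'.
by rewrite inE => /orP [/eqP ->|]; [apply: sG'|apply: sG].
Qed.

Definition at_generic : S -> bool := fun G => G != 0.

Lemma at_generic_place : place at_generic.
Proof.
split=> [|F G|]; rewrite /at_generic ?eqxx //; first by rewrite mulf_eq0 negb_or.
by exists 0; rewrite mpolyX_neq0.
Qed.

Lemma Oloc_generic f : Oloc at_generic 0 f.
Proof.
have [k [F [G [hF hG nG ->]]]] := frac_forms f.
by apply: (@Oloc_intro _ _ _ k k); rewrite ?addr0.
Qed.

Lemma lat_regular p g h n : p != 0 -> g \in unitmx -> h \in unitmx ->
  (forall r k, Oloc (at_pt p) 0 ((invmx g *m h) r k)) ->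
  lat (at_pt p) h n `<=` lat (at_pt p) g n.
Proof.
move=> np ug uh reg v hv r; have hp := at_pt_place np.
have -> : invmx g *m v = invmx g *m h *m (invmx h *m v) by rewrite -!mulmxA mulKVmx.
rewrite mxE; apply: (Oloc_sum hp) => k _; rewrite -[n]add0r.
by apply: (OlocM hp) => //; apply: hv.
Qed.

Definition entries (g : 'M[K]_2) : seq K := [seq g rk.1 rk.2 | rk : 'I_2 * 'I_2].

Lemma mem_entries g r k : g r k \in entries g.
Proof. by apply/mapP; exists (r, k) => //; rewrite mem_enum. Qed.

(** At a general point the frame and its inverse are regular, so the stalk is the standard lattice;
    the torus carries this to the whole open orbit. *)
Lemma lfree_torus E : lfree E -> invar E ->
  forall p, (forall i, p ord0 i != 0) -> E p = lat (at_pt p) 1%:M 0.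
Proof.
move=> fE iE p np; have p_neq0 : p != 0 by apply: (@pt_neq0 _ _ 0).
have [k [F [g [hF Fp ug eE]]]] := fE p p_neq0.
have [f _|l [G [hG nG reg]]] := @Oloc_spread_seq _ at_generic_place 0 (entries g ++ entries (invmx g)).
  exact: Oloc_generic.
have nF : F != 0 by apply: contraNneq Fp => ->; rewrite meval0.
have /mpoly_nonroot [w [nw FGw]] : F * G != 0 by rewrite mulf_neq0.
(* Rescaled so that the first coordinates of [p] and [q] agree, because the torus fixes that
   coordinate. *)
pose q : pt := \row_i (p ord0 0 / w 0 * w i).
have np0 : p ord0 0 / w 0 != 0 by rewrite mulf_neq0 ?invr_neq0.
have FGq : (F * G).@[q ord0] != 0.
  have -> : (F * G).@[q ord0] = (F * G).@[fun i => p ord0 0 / w 0 * w i].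
    by apply: meval_eq => i; rewrite mxE.
  by rewrite (meval_homog _ _ (dhomogM hF hG)) mulf_neq0 ?expf_neq0.
have nq i : q ord0 i != 0 by rewrite mxE mulf_neq0.
have q_neq0 : q != 0 by apply: (@pt_neq0 _ _ 0).
move: FGq; rewrite mevalM mulf_eq0 negb_or => /andP [Fq Gq].
have Eq : E q = lat (at_pt q) 1%:M 0.
  rewrite eE //; apply/seteqP; split; apply: lat_regular => //; rewrite ?unitmx1 //.
    by move=> r c; rewrite invmx1 mul1mx; apply: reg; rewrite // mem_cat mem_entries.
  by move=> r c; rewrite mulmx1; apply: reg; rewrite // mem_cat mem_entries orbT.
pose t : C * C := (q ord0 1 / p ord0 1, q ord0 2%:R / p ord0 2%:R).
have tt : torus t by split; rewrite /= mulf_neq0 ?invr_neq0.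
have eq_act : act t p = q.
  apply/rowP => i; rewrite actE /tau; case: (ord3P i) => -> /=.
  - by rewrite mulr1 [RHS]mxE divfK.
  - by rewrite mulrC divfK.
  - by rewrite mulrC divfK.
have lat1 p' v : lat (at_pt p') 1%:M 0 v <-> forall r, Oloc (at_pt p') 0 (v r 0).
  by split=> h r; have := h r; rewrite invmx1 mul1mx.
have ev v : v = pullv t (pullv (tinv t) v).
  by apply/matrixP => r c; rewrite !mxE pullVK.
apply/seteqP; split=> v; rewrite [v]ev; move: (pullv _ v) => u.
  move/(iE t p u tt p_neq0); rewrite eq_act Eq => /lat1 h; apply/lat1 => r.
  by rewrite mxE; apply/Oloc_pull => //; rewrite eq_act.
move/lat1 => h; apply/iE => //; rewrite eq_act Eq; apply/lat1 => r.
by rewrite -eq_act; apply/Oloc_pull => //; have := h r; rewrite mxE.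
Qed.

(** Points are nonzero vectors; this makes the stalk depend on the projective point only. *)
Lemma lfree_scale E l q : lfree E -> l != 0 -> q != 0 -> E (l *: q) = E q.
Proof.
move=> fE nl nq; have [k [F [g [hF Fq ug eE]]]] := fE q nq.
have ev G m : G \is m.-homog -> G.@[(l *: q) ord0] = l ^+ m * G.@[q ord0].
  by move=> hG; rewrite -(meval_homog _ _ hG); apply: meval_eq => i; rewrite mxE.
have nlq : l *: q != 0 by rewrite scaler_eq0 negb_or nl.
have Fq' : F.@[(l *: q) ord0] != 0 by rewrite (ev _ _ hF) mulf_neq0 ?expf_neq0.
rewrite !eE //; have eO f : Oloc (at_pt (l *: q)) 0 f <-> Oloc (at_pt q) 0 f.
  split=> [] [a [b [A [B [hA hB e DB ->]]]]]; apply: (@Oloc_intro _ _ _ a b) => //.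
    by move: DB; rewrite /at_pt (ev _ _ hB) mulf_eq0 negb_or => /andP [].
  by rewrite /at_pt (ev _ _ hB) mulf_neq0 ?expf_neq0.
by apply/seteqP; split=> v h r; apply/eO.
Qed.

(* T-orbits: the open orbit, the three open lines, and the three fixed points,
   where Hartogs applies *)
Lemma eq_of_orbits E E' : lfree E -> lfree E' -> invar E -> invar E' ->
  (forall i, exists q, [/\ q ord0 i = 0, forall j, j != i -> q ord0 j != 0 & E q = E' q]) ->
  forall p, p != 0 -> E p = E' p.
Proof.
move=> fE fE' iE iE' lines.
have one_zero i p : (forall j, j != i -> p ord0 j != 0) -> E p = E' p.
  move=> np; have n_neq0 : p != 0.
    by apply: (@pt_neq0 _ _ (lift i 0)); apply: np; rewrite eq_sym neq_lift.
  have [p0|pi] := eqVneq (p ord0 i) 0; last first.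
    have np' j : p ord0 j != 0 by have [->|] := eqVneq j i; [| exact: np].
    by rewrite !lfree_torus.
  have [q [q0 nq Eq]] := lines i.
  have q_neq0 : q != 0.
    by apply: (@pt_neq0 _ _ (lift i 0)); apply: nq; rewrite eq_sym neq_lift.
  have [t [l [tt nl etp]]] : exists t l, [/\ torus t, l != 0 & act t p = l *: q].
    pose r j := if j == i then 1 else q ord0 j / p ord0 j.
    have nr j : r j != 0.
      rewrite /r; case: (eqVneq j i) => [_|ji]; first exact: oner_neq0.
      by apply: mulf_neq0; rewrite ?invr_neq0 ?nq ?np.
    have pr j : p ord0 j * r j = q ord0 j.
      rewrite /r; case: (eqVneq j i) => [->|ji]; first by rewrite p0 mul0r q0.
      by rewrite mulrC divfK ?np.
    exists (r 1 / r 0, r 2%:R / r 0), (r 0)^-1; split; rewrite ?invr_neq0 //.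
      by split; rewrite /= mulf_neq0 ?invr_neq0.
    apply/rowP => j; rewrite actE !mxE -pr /tau; case: (ord3P j) => -> /=.
    - by rewrite mulr1 mulrC mulfK.
    - by rewrite mulrA mulrC.
    - by rewrite mulrA mulrC.
  have ev v : v = pullv t (pullv (tinv t) v).
    by apply/matrixP => r c; rewrite !mxE pullVK.
  apply/seteqP; split=> v; rewrite [v]ev; move: (pullv _ v) => u.
    by move/(iE t p u tt n_neq0); rewrite etp lfree_scale // Eq => h; apply/iE' => //; rewrite etp lfree_scale.
  by move/(iE' t p u tt n_neq0); rewrite etp lfree_scale // -Eq => h; apply/iE => //; rewrite etp lfree_scale.
(* A germ at [p] extends to a section of [E1] over [G' <> 0]. There the two bundles agree wherever
   one of the coordinates [i], [j] is nonzero, and Hartogs applies to the coordinates of the section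
   in the frame [g2]. *)
have fixed E1 E2 : lfree E1 -> lfree E2 ->
    (forall i p, (forall j, j != i -> p ord0 j != 0) -> E1 p = E2 p) ->
    forall p, p != 0 -> E1 p `<=` E2 p.
  move=> f1 f2 e12 p np v; have hp := at_pt_place np.
  have [k1 [F1 [g1 [hF1 F1p ug1 eE1]]]] := f1 p np.
  have [k2 [F2 [g2 [hF2 F2p ug2 eE2]]]] := f2 p np.
  rewrite eE1 // eE2 // => hv r.
  have [f /mapP [r' _ ->]|l [G [hG Gp reg]]] := @Oloc_spread_seq _ hp 0 [seq (invmx g1 *m v) r 0 | r : 'I_2].
    exact: hv.
  have [_ _ [k pk]] := hp; rewrite /at_pt mevalXU in pk.
  pose G' := F1 * (F2 * (G * 'X_k)).
  have hG' : G' \is (k1 + (k2 + (l + 1))).-homog by rewrite !dhomogM ?homogX.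
  have G'p : G'.@[p ord0] != 0 by rewrite !mevalM mevalXU !mulf_neq0.
  have nG' : G' != 0 by apply: contraNneq G'p => ->; rewrite meval0.
  pose i := lift k 0; pose j := lift k 1.
  have ij : i != j by rewrite /i /j (inj_eq lift_inj).
  have all3 c : [\/ c = k, c = i | c = j].
    case: (unliftP k c) => [d ->|->]; last exact: Or31.
    by case: (unliftP 0 d) => [d' ->|->]; [rewrite ord1; apply: Or33; congr (lift k _); exact/val_inj | exact: Or32].
  have sect a b : (forall c, c != b -> c = k \/ c = a) ->
      forall q, q != 0 -> G'.@[q ord0] != 0 -> q ord0 a != 0 ->
      Oloc (at_pt q) 0 ((invmx g2 *m v) r 0).
    move=> ab q nq; rewrite !mevalM mevalXU !mulf_eq0 !negb_or => /and4P [q1 q2 qG qk] qa.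
    have hq : E1 q v by rewrite eE1 // => r'; apply: reg => //; apply/mapP; exists r'; rewrite ?mem_enum.
    have e : E1 q = E2 q by apply: (e12 b) => c /ab [] ->.
    by move: hq; rewrite e eE2 // => hq; exact: hq.
  have [| |N [A hA ->]] := @hartogs C K 0 ((invmx g2 *m v) r 0) G' _ i j hG' nG' ij.
  - by apply: (@sect i j) => c cj; case: (all3 c) => e; [left|right|rewrite e eqxx in cj].
  - by apply: (@sect j i) => c ci; case: (all3 c) => e; [left|rewrite e eqxx in ci|right].
  exact: (@Oloc_homZ_div _ _ _ hp _ (k1 + (k2 + (l + 1)))%N).
move=> p np; apply/seteqP; split.
  by apply: (fixed E E') => // i q nq; exact: one_zero nq.
by apply: (fixed E' E) => // i q nq; apply/esym; exact: one_zero nq.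
Qed.

End Torus.

(** * The valuation ring of a coordinate line under the torus *)

Section LineStructure.
Variables (C : closedFieldType) (K : model C).
Local Notation S := {mpoly C[3]}.
Local Notation pt := 'rV[C]_3.
Local Notation vec := 'cV[K]_2.
Local Notation pull := (@mpull C K).
Implicit Types (F G : S) (f w : K) (p q : pt) (u v : vec).
Implicit Types (g h : 'M[K]_2) (E : pt -> set vec) (t : C * C).

Lemma torus_of_ratios (r : 'I_3 -> C) : (forall c, r c != 0) ->
  exists2 t, torus t & forall c, tau t c = r c / r 0.
Proof.
move=> nr; exists (r 1 / r 0, r 2%:R / r 0); first by split; rewrite /= mulf_neq0 ?invr_neq0.
by move=> c; rewrite /tau; case: (ord3P c) => -> //=; rewrite divff.
Qed.

Lemma line_orbit (i : 'I_3) p q : p ord0 i = 0 -> q ord0 i = 0 ->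
  (forall j, j != i -> p ord0 j != 0) -> (forall j, j != i -> q ord0 j != 0) ->
  exists t l, [/\ torus t, l != 0 & act t p = l *: q].
Proof.
move=> p0 q0 np nq.
pose r j := if j == i then 1 else q ord0 j / p ord0 j.
have nr j : r j != 0.
  rewrite /r; case: (eqVneq j i) => [_|ji]; first exact: oner_neq0.
  by apply: mulf_neq0; rewrite ?invr_neq0 ?nq ?np.
have pr j : p ord0 j * r j = q ord0 j.
  rewrite /r; case: (eqVneq j i) => [->|ji]; first by rewrite p0 mul0r q0.
  by rewrite mulrC divfK ?np.
have [t tt et] := torus_of_ratios nr.
exists t, (r 0)^-1; split; rewrite ?invr_neq0 //.
by apply/rowP => j; rewrite actE !mxE -pr et mulrA mulrC.
Qed.

Variable i : 'I_3.
Let j := lift i 0.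
Local Notation V := (@Oloc C K (at_line i) 0).
Let hV : place (at_line i) := at_line_place C i.

(* a uniformizer at the generic point of [x_i = 0] *)
Definition unif : K := Xk K i / Xk K j.
(** The character by which the torus acts on the uniformizer. *)
Definition chi t : C := tau t i / tau t j.

Lemma ij_neq : j != i. Proof. by rewrite eq_sym neq_lift. Qed.

Lemma unif_neq0 : unif != 0.
Proof. by rewrite mulf_neq0 ?invr_neq0 ?Xk_neq0. Qed.

Lemma at_line_Xj : at_line i ('X_j : S).
Proof. by rewrite /at_line rst_X (negPf ij_neq) mpolyX_neq0. Qed.

Lemma V_unif : V unif.
Proof. by apply: (@Oloc_intro _ _ _ 1 1); rewrite ?homogX ?addr0 ?at_line_Xj. Qed.

Lemma pull_unif t : torus t -> pull t unif = cst K (chi t) * unif.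
Proof.
move=> tt; rewrite /unif fmorph_div /= !pull_Xk // /chi invfM mulrACA; congr (_ * _).
rewrite cstM; congr (_ * _).
have nj : cst K (tau t j) != 0 by rewrite cst_eq0 tau_neq0.
apply: (mulfI nj); rewrite mulfV // -cstM mulfV ?tau_neq0 //.
by rewrite /cst mpolyC1 dh1.
Qed.

Lemma eval_rst F q : q ord0 i = 0 -> (rst i F).@[q ord0] = F.@[q ord0].
Proof.
move=> q0; rewrite meval_rst; apply: meval_eq => k.
by case: eqVneq => [->|].
Qed.

(** The residue of [A / B] is the quotient of the restrictions to the line, which turns divisibility
    by the uniformizer into a vanishing that can be tested at points. *)
Lemma V_div_unif A B k : A \is k.-homog -> B \is k.-homog -> at_line i B ->
  V (dh K A / dh K B / unif) <-> rst i A = 0.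
Proof.
move=> hA hB DB; have e : dh K A / dh K B / unif = dh K (A * 'X_j) / dh K (B * 'X_i).
  by rewrite !dhM /unif !invfM invrK /Xk; ring.
rewrite e; split=> [h|/rst_eq0 [A' eA]].
  have hAX : A * 'X_j \is (k + 1).-homog by rewrite dhomogM ?homogX.
  have hBX : B * 'X_i \is (k + 1).-homog by rewrite dhomogM ?homogX.
  have nBX : B * 'X_i != 0 by rewrite mulf_neq0 ?mpolyX_neq0 ?(place_neq0 hV DB).
  have [||F1 [G1 [DG1 + _]]] := Oloc_cross hV h hAX hBX nBX; rewrite ?addr0 //.
  move=> /(congr1 (rst i)); rewrite !rstM [rst i 'X_i]rst_X eqxx !mulr0 => /eqP.
  rewrite !mulf_eq0 -orbA => /or3P [/eqP //|e'|e'].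
    by have := at_line_Xj; rewrite /at_line e'.
  by move: DG1; rewrite /at_line e'.
have -> : dh K (A * 'X_j) / dh K (B * 'X_i) = dh K (A' * 'X_j) / dh K B.
  by rewrite eA [B * _]mulrC !dhM -[_ * _ * dh K 'X_j]mulrA -mulf_div divff ?mul1r ?Xk_neq0.
have [A0|nA] := eqVneq A' 0; first by rewrite A0 mul0r dh0 mul0r; exact: (Oloc0 K hV).
case: k hA hB => [|k] hA hB.
  have hXA : homZ (0 : int) ('X_i * A') by rewrite -eA; apply/homZ_nat.
  by have /homZP [e0|[]//] := homZ_XM hXA; rewrite e0 eqxx in nA.
apply: (@Oloc_intro _ _ _ k.+1 k.+1); rewrite ?addr0 //.
by rewrite -[k.+1]addn1 dhomogM ?homogX //; apply: (@homog_XM _ i); rewrite -eA.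
Qed.

(** The residue of [w] is a semi-invariant function on the line. The torus is transitive on the open
    orbit of the line, so an invariant residue is constant; for [b > 0] the stabilizer of a point
    has elements with [chi t ^ b <> 1], so the residue vanishes. *)
Lemma semi_invariant_residue w (b : nat) : V w ->
  (forall t, torus t -> V ((cst K (chi t ^+ b) * pull t w - w) / unif)) ->
  exists c, V ((w - cst K c) / unif) /\ (b != 0%N -> c = 0).
Proof.
move=> [k [l [F [G [hF hG]]]]]; rewrite addr0 => -[ekl] DG ew inv; rewrite -{l}ekl in hG.
have nG := place_dh K hV hG DG.
have hC c (P : S) m : P \is m.-homog -> c%:MP * P \is m.-homog.
  by move=> hP; rewrite mul_mpolyC rpredZ.
have rel t q : torus t -> q ord0 i = 0 ->
    chi t ^+ b * F.@[act t q ord0] * G.@[q ord0] = F.@[q ord0] * G.@[act t q ord0].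
  move=> tt q0; have nsG : dh K (sc t G) != 0.
    by apply: (place_dh K hV (sc_homog t hG)); rewrite at_line_sc.
  have : rst i ((chi t ^+ b)%:MP * (sc t F * G) - F * sc t G) = 0.
    apply/(@V_div_unif _ (sc t G * G) (k + k)).
    - by rewrite rpredB ?hC // dhomogM ?sc_homog.
    - by rewrite dhomogM ?sc_homog.
    - by rewrite (placeM hV) at_line_sc // DG.
    have := inv t tt; rewrite ew fmorph_div /= !pull_dh // /cst.
    congr (V (_ / unif)); rewrite dhD dhN !dhM.
    move: nsG nG; move: (dh K _) (dh K _) (dh K _) (dh K _) (dh K _) => x1 x2 x3 x4 x5 n1 n2.
    by field; rewrite n1 n2.
  move=> /(congr1 (meval (q ord0))); rewrite eval_rst // meval0 mevalB !mevalM mevalC !meval_sc.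
  by move/eqP; rewrite subr_eq0 mulrA => /eqP.
have fin c : rst i (F - c%:MP * G) = 0 -> V ((w - cst K c) / unif).
  move=> e; have -> : w - cst K c = dh K (F - c%:MP * G) / dh K G.
    by rewrite dhD dhN dhM mulrBl mulfK // ew.
  by apply/(@V_div_unif _ _ k) => //; rewrite rpredB ?hC.
case: b inv rel => [|b] inv rel.
  have [q0 [q00 nq0 Gq0]] := rst_neq0_pt DG.
  exists (F.@[q0 ord0] / G.@[q0 ord0]); split=> //; apply: fin.
  set c := _ / _; apply/eqP/negPn/negP => /rst_neq0_pt [q [q_0 nq]]; apply/negP/negPn.
  have [t [l [tt nl etq]]] := line_orbit q00 q_0 nq0 nq.
  have hFG : F - c%:MP * G \is k.-homog by rewrite rpredB ?hC.
  have : (F - c%:MP * G).@[act t q0 ord0] = 0.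
    apply: (mulIf Gq0); rewrite mul0r mevalB mevalM mevalC mulrBl.
    have := rel t q0 tt q00; rewrite expr0 mul1r => ->.
    move: Gq0; rewrite /c; move: (F.@[_]) (G.@[_]) (G.@[_]) => x1 x2 x3 n1.
    by field.
  rewrite etq.
  have -> : (F - c%:MP * G).@[(l *: q) ord0] = l ^+ k * (F - c%:MP * G).@[q ord0].
    by rewrite -(meval_homog _ _ hFG); apply: meval_eq => m; rewrite mxE.
  by move/eqP; rewrite mulf_eq0 expf_eq0 (negPf nl) andbF.
exists 0; split=> //; apply: fin; rewrite mpolyC0 mul0r subr0.
apply/eqP/negPn/negP => nF.
have : rst i (F * G) != 0 by rewrite rstM mulf_neq0.
move=> /rst_neq0_pt [q [q0 nq]]; rewrite mevalM mulf_eq0 negb_or => /andP [Fq Gq].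
(* [s] is nonzero with [s ^ b.+1 <> 1]; the torus element scaling [x_i] alone by [s] fixes the point
   [q]. *)
have /closed_nonrootP [s] : 'X * ('X^(b.+1) - 1) != 0 :> {poly C}.
  by rewrite mulf_neq0 ?polyX_eq0 // -size_poly_eq0 size_Xn_sub_1.
rewrite /root hornerM !hornerE mulf_eq0 negb_or => /andP [ns sb].
pose r (c : 'I_3) := if c == i then s else 1.
have nr c : r c != 0 by rewrite /r; case: ifP; rewrite ?oner_neq0.
have [t tt et] := torus_of_ratios nr.
have echi : chi t = s.
  have ri : r i = s by rewrite /r eqxx.
  have rj : r j = 1 by rewrite /r (negPf ij_neq).
  by rewrite /chi !et ri rj div1r invrK divfK.
have eact : act t q = (r 0)^-1 *: q.
  apply/rowP => c; rewrite actE !mxE et.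
  have [->|ci] := eqVneq c i; first by rewrite q0 mul0r mulr0.
  by rewrite [r c]/r (negPf ci) div1r mulrC.
have ev P m : P \is m.-homog -> P.@[act t q ord0] = (r 0)^-1 ^+ m * P.@[q ord0].
  move=> hP; rewrite -(meval_homog _ _ hP); apply: meval_eq => m'.
  by rewrite eact mxE.
have := rel t q tt q0; rewrite echi (ev _ _ hF) (ev _ _ hG).
set a := _^-1 ^+ k => e.
have na : a * (F.@[q ord0] * G.@[q ord0]) != 0 by rewrite !mulf_neq0 ?expf_neq0 ?invr_neq0.
have : (s ^+ b.+1 - 1) * (a * (F.@[q ord0] * G.@[q ord0])) = 0.
  rewrite mulrBl mul1r; apply/eqP; rewrite subr_eq0; apply/eqP.
  by rewrite -!mulrA in e *; rewrite e mulrCA.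
by move/eqP; rewrite mulf_eq0 (negPf na) orbF (negPf sb).
Qed.

(** Inductively [w = c + unif ^ b * w'], where [w'] satisfies the residue condition with the factor
    [chi t ^ b]. Its residue contributes a constant only for [b = 0]; afterwards it vanishes and the
    congruence improves by one power. *)
Lemma semi_invariant_constant (b : nat) w : V w ->
  (forall t, torus t -> V ((pull t w - w) / unif ^+ b)) ->
  exists c, V ((w - cst K c) / unif ^+ b).
Proof.
have nu n : unif ^+ n != 0 by rewrite expf_neq0 ?unif_neq0.
elim: b => [|b IH] Vw inv.
  by exists 0; rewrite /cst mpolyC0 dh0 subr0 expr0 divr1.
have [t tt|c Vc] := IH Vw.
  have -> : (pull t w - w) / unif ^+ b = unif * ((pull t w - w) / unif ^+ b.+1).
    rewrite exprSr; move: (nu b) unif_neq0; move: (unif ^+ b) => y ny nx.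
    by field; rewrite nx ny.
  by rewrite -[0]addr0; apply: (OlocM hV); [exact: V_unif | exact: inv].
set w' := _ / _ in Vc.
have ew : w = cst K c + unif ^+ b * w' by rewrite mulrC divfK // addrC subrK.
have [t tt|c' [Vc' c0]] := @semi_invariant_residue w' b Vc.
  have := inv t tt; rewrite {1 2}ew rmorphD rmorphM rmorphXn /= pull_cst // pull_unif //.
  have -> : cst K (chi t ^+ b) = cst K (chi t) ^+ b.
    by elim: (b) => [|m IHm]; [rewrite !expr0 /cst mpolyC1 dh1 | rewrite !exprS cstM IHm].
  move: (cst K c) (pull t w') (cst K (chi t)) => x y z; congr V.
  apply: (mulIf (nu b.+1)); rewrite divfK // exprSr.
  have -> : (z ^+ b * y - w') / unif * (unif ^+ b * unif) = (z ^+ b * y - w') * unif ^+ b * (unif / unif) by ring.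
  by rewrite divff ?unif_neq0 // exprMn; ring.
exists (c + c').
have eD : cst K (c + c') = cst K c + cst K c' by rewrite /cst mpolyCD dhD.
have -> : (w - cst K (c + c')) / unif ^+ b.+1 = (w' - cst K c' / unif ^+ b) / unif.
  rewrite eD {1}ew exprSr; move: (nu b) unif_neq0; move: (unif ^+ b) => z nz nx.
  move: (cst K c) (cst K c') => x y.
  by field; rewrite nx nz.
have [b0|nb] := eqVneq b 0%N.
  have -> : cst K c' / unif ^+ b = cst K c' by rewrite b0 expr0 divr1.
  exact: Vc'.
have e0 : cst K c' = 0 by rewrite c0 // /cst mpolyC0 dh0.
by move: Vc'; rewrite e0 mul0r.
Qed.

Lemma valuation f : f != 0 -> exists (z : int) w, [/\ f = unif ^ z * w, w != 0, V w & V w^-1].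
Proof.
have key F k : F \is k.-homog -> F != 0 -> exists (a l : nat) F',
   [/\ (k = a + l)%N, F' \is l.-homog, at_line i F' & F = 'X_i ^+ a * F'].
  elim: k F => [|k IH] F hF nF; have [F0|Fi] := eqVneq (rst i F) 0.
  - have [F' eF] := rst_eq0 F0; have hXA : homZ (0 : int) ('X_i * F') by rewrite -eF; apply/homZ_nat.
    have /homZP [e0|[]//] := homZ_XM hXA; by rewrite eF e0 mulr0 eqxx in nF.
  - by exists 0%N, 0%N, F; rewrite expr0 mul1r.
  - have [F' eF] := rst_eq0 F0; have [| |a [l [F'' [-> hF'' DF'' eF']]]] := IH F'.
    + by apply: (@homog_XM _ i); rewrite -eF.
    + by apply: contra_neq nF => e; rewrite eF e mulr0.
    by exists a.+1, l, F''; rewrite eF eF' exprS mulrA.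
  - by exists 0%N, k.+1, F; rewrite expr0 mul1r.
move=> nf; have [k [F [G [hF hG nG ef]]]] := frac_forms f.
have nF : F != 0 by apply: contra_neq nf => e; rewrite ef e dh0 mul0r.
have [a [l [F' [ek hF' DF' eF]]]] := key F k hF nF.
have [a' [l' [G' [ek' hG' DG' eG]]]] := key G k hG nG.
have ez : l%:Z + (a%:Z - a'%:Z) = l'%:Z by clear -ek ek'; lia.
have ez' : l'%:Z - (a%:Z - a'%:Z) = l%:Z by rewrite -ez addrK.
pose z := a%:Z - a'%:Z.
have dj := at_line_Xj.
have VU (A B : S) m m' (y : int) : A \is m.-homog -> B \is m'.-homog ->
    at_line i A -> at_line i B -> m%:Z + y = m'%:Z ->
    V (Xk K j ^ y * (dh K A / dh K B)).
  move=> hA hB DA DB e; have -> : 0 = (m%:Z - m'%:Z) + y by rewrite -e; ring.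
  by apply/(Oloc_XzM hV) => //; apply: (@Oloc_intro _ _ _ m m') => //; ring.
exists z, (Xk K j ^ z * (dh K F' / dh K G')).
have nF' := place_dh K hV hF' DF'; have nG' := place_dh K hV hG' DG'.
split.
- rewrite /unif ef eF eG !dhM !dhXn -!/(Xk K i) mulrA -expfzMl divfK ?Xk_neq0 //.
  rewrite /z expfzDr ?Xk_neq0 // -exprnP -exprnN -mulf_div.
  by [].
- by rewrite !mulf_neq0 ?invr_neq0 ?expfz_neq0 ?Xk_neq0.
- exact: (VU _ _ l l').
- rewrite invfM invfM invrK invr_expz [_^-1 * dh K G']mulrC.
  exact: (VU _ _ l' l).
Qed.

End LineStructure.

(** * Normal form of a torus-stable bundle on a coordinate line *)

Section LineNormalForm.
Variables (C : closedFieldType) (K : model C).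
Local Notation S := {mpoly C[3]}.
Local Notation pt := 'rV[C]_3.
Local Notation vec := 'cV[K]_2.
Local Notation pull := (@mpull C K).
Implicit Types (F G : S) (f w : K) (p q : pt) (u v : vec).
Implicit Types (g h : 'M[K]_2) (E : pt -> set vec) (t : C * C).

Definition linform (l : 'I_2 -> C) v : K := \sum_r cst K (l r) * v r 0.

Variable i : 'I_3.
Let j := lift i 0.
Local Notation V := (@Oloc C K (at_line i) 0).
Let hV : place (at_line i) := at_line_place C i.
Local Notation unif := (unif K i).

Lemma at_pt_at_line q G : q ord0 i = 0 -> at_pt q G -> at_line i G.
Proof.
by move=> q0; rewrite /at_pt /at_line; apply: contraNneq => e; rewrite -(eval_rst _ q0) e meval0.
Qed.

Lemma Oloc_at_line q n f : q ord0 i = 0 -> Oloc (at_pt q) n f -> Oloc (at_line i) n f.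
Proof.
move=> q0 [k [l [F [G [hF hG e DG ->]]]]]; apply: (@Oloc_intro _ _ _ k l) => //.
exact: at_pt_at_line DG.
Qed.

(** The matrix of [t] in the frame [g] is regular at any [q] such that [q] and [t q] lie in the
    domain of the frame; since the line is irreducible, it contains such a point. *)
Lemma frame_invariant E F k g : invar E -> F \is k.-homog -> at_line i F -> g \in unitmx ->
  (forall q, q != 0 -> F.@[q ord0] != 0 -> E q = lat (at_pt q) g 0) ->
  forall t, torus t -> forall r c, V ((invmx g *m map_mx (pull t) g) r c).
Proof.
move=> iE hF DF ug eE t tt r c.
have : rst i (F * sc t F) != 0.
  by rewrite rstM mulf_neq0 //; have := at_line_sc i F tt; rewrite /at_line => ->.
move=> /rst_neq0_pt [q [q0 nq]]; rewrite mevalM meval_sc mulf_eq0 negb_or => /andP [Fq Ftq].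
have q_neq0 : q != 0 by apply: (@pt_neq0 _ _ j); rewrite nq // ij_neq.
have ht := act_neq0 tt q_neq0.
have : E (act t q) (g *m delta_mx c 0).
  rewrite eE // => r'; rewrite mulKmx // mxE.
  by case: (_ && _); [exact: (Oloc1 K (at_pt_place ht)) | exact: (Oloc0 K (at_pt_place ht))].
move/(iE t q _ tt q_neq0); rewrite eE // => /(_ r).
rewrite /pullv map_mxM map_delta_mx mulmxA -colE mxE => h.
exact: Oloc_at_line h.
Qed.

(* Gaussian elimination over the discrete valuation ring [V]; invariance under
   the torus makes the multiplier [w] constant modulo [unif ^+ b]. *)
Lemma line_normal_form E : lfree E -> invar E -> exists q (l : 'I_2 -> C) (z : int) (b : nat),
  [/\ q ord0 i = 0, forall k, k != i -> q ord0 k != 0, exists r, l r != 0 &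
   forall v, E q v <-> (forall r, Oloc (at_pt q) 0 (unif ^ (- z) * v r 0)) /\
                       Oloc (at_pt q) 0 (unif ^ (- z - b%:Z) * linform l v)].
Proof.
move=> fE iE.
pose p0 : pt := \row_k if k == i then 0 else 1.
have np0 : p0 != 0 by apply: (@pt_neq0 _ _ j); rewrite mxE (negPf (ij_neq i)) oner_neq0.
have [k [F [g [hF Fp ug eE]]]] := fE p0 np0.
have DF : at_line i F by apply: (at_pt_at_line _ Fp); rewrite mxE eqxx.
have inv := frame_invariant iE hF DF ug eE.
have nu z : unif ^ z != 0 by rewrite expfz_neq0 ?unif_neq0.
(* At 0 the value of [val] is arbitrary; the minimum below is taken over nonzero entries only. *)
have /choice [val hval] : forall f, exists z : int, f != 0 ->
    exists w, [/\ f = unif ^ z * w, w != 0, V w & V w^-1].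
  move=> f; have [->|nf] := eqVneq f 0; first by exists 0.
  by have [z [w hw]] := valuation i nf; exists z => _; exists w.
have Vpow (y : int) : 0 <= y -> V (unif ^ y).
  by case: y => // m _; rewrite -exprnP; apply: (OlocX hV); exact: V_unif.
have pow_ge0 (y : int) w : w != 0 -> V w^-1 -> V (unif ^ y * w) -> 0 <= y.
  move=> nw Vw h; apply/negPn/negP => y0.
  have : V (dh K 1 / dh K 1 / unif).
    have -> : dh K 1 / dh K 1 / unif = unif ^ (- y - 1) * (unif ^ y * w * w^-1).
      by rewrite mulfK // -expfzDr ?unif_neq0 // dh1 divr1 mul1r addrAC addNr add0r.
    rewrite -[0]addr0; apply: (OlocM hV); first by apply: Vpow; lia.
    by rewrite -[0]addr0; apply: (OlocM hV).
  move/(@V_div_unif _ _ _ _ _ 0); rewrite !dhomog1 (place1 hV) => /(_ isT isT isT).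
  by rewrite /rst comp_mpoly1 => /eqP; rewrite oner_eq0.
have Vcst x : V (cst K x) by exact: OlocC.
have Vcstz x (y : int) : x != 0 -> V (cst K x ^ y).
  move=> nx; case: y => m; first by rewrite -exprnP; apply: (OlocX hV).
  have -> : cst K x ^ Negz m = cst K x^-1 ^+ m.+1; last exact: (OlocX hV).
  rewrite NegzE -exprnN -exprVn; congr (_ ^+ _).
  have ncx : cst K x != 0 by rewrite cst_eq0.
  by apply: (mulfI ncx); rewrite mulfV // -cstM mulfV // /cst mpolyC1 dh1.
have sum2 (r : 'I_2) (h : 'I_2 -> K) : \sum_k h k = h r + h (lift r 0).
  by rewrite (bigD1_ord r) //= big_ord1.
have [rk0 nrk0] : exists rk : 'I_2 * 'I_2, g rk.1 rk.2 != 0.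
  apply: contrapT => h; have g0 : g = 0.
    by apply/matrixP => r c; rewrite mxE; apply/eqP/negPn/negP => n; apply: h; exists (r, c).
  have /matrixP /(_ 0 0) := mulmxV ug; rewrite g0 mul0mx !mxE => /eqP.
  by rewrite eq_sym oner_eq0.
have [] := @Num.Theory.real_arg_minP _ _ rk0 (fun rk => g rk.1 rk.2 != 0) (fun rk => val (g rk.1 rk.2)) nrk0.
  by move=> x _; exact: Num.Theory.num_real.
move=> [r0 k0] /= n00 minz.
pose r1 := lift r0 0; pose k1 := lift k0 0.
set al := g r0 k0 in n00 minz; set z := val al in minz.
pose ga := g r0 k1; pose be := g r1 k0; pose de := g r1 k1.
have [w0 [eal nw0 Vw0 Vw0']] := hval al n00.
rewrite -/z in eal.
set s := unif ^ z in eal; have ns : s != 0 by exact: nu.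
have Ventry r k' : V (g r k' / s).
  have [->|ne] := eqVneq (g r k') 0; first by rewrite mul0r; exact: (Oloc0 K hV).
  have [w [ew nw Vw _]] := hval _ ne.
  rewrite ew /s mulrAC invr_expz -expfzDr ?unif_neq0 // -[0]addr0; apply: (OlocM hV) => //.
  by apply: Vpow; rewrite Num.Theory.subr_ge0; apply: (minz (r, k')).
pose w := be / al.
have Vw : V w.
  have -> : w = be / s * w0^-1 by rewrite /w eal invfM mulrA.
  by rewrite -[0]addr0; apply: (OlocM hV); first exact: Ventry.
(* Up to sign, the determinant of [g] divided by the pivot; its valuation [z + b] is the second
   elementary divisor, [z] being the first. *)
pose De := de - w * ga.
have nDe : De != 0.
  apply/eqP => De0; pose x : 'rV[K]_2 := \row_r if r == r0 then - w else 1.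
  have xg : x *m g = 0.
    apply/rowP => c; rewrite !mxE (sum2 r0) !mxE eqxx [lift _ _ == _]eq_sym (negPf (neq_lift _ _)) mul1r.
    case: (unliftP k0 c) => [d|] ->; last by rewrite mulNr -/al /w divfK // addNr.
    by rewrite ord1 mulNr addrC -/k1 -/ga -/de.
  have x0 : x = 0 by rewrite -(mulmxK ug x) xg mul0mx.
  have /rowP /(_ r1) := x0; rewrite !mxE [r1 == _]eq_sym (negPf (neq_lift _ _)) => /eqP.
  by rewrite oner_eq0.
have [wD [eDe nwD VwD VwD']] := hval De nDe.
set z' := val De in eDe.
have VDe : V (De / s).
  have -> : De / s = de / s - w * (ga / s) by rewrite /De; ring.
  apply: (OlocB hV); first exact: Ventry.
  by rewrite -[0]addr0; apply: (OlocM hV) => //; exact: Ventry.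
have zz' : 0 <= z' - z.
  apply: (pow_ge0 _ wD) => //.
  by move: VDe; rewrite {1}eDe mulrAC /s invr_expz -expfzDr ?unif_neq0.
pose b := absz (z' - z).
have ez' : z' = z + b%:Z by rewrite /b gez0_abs //; ring.
set B := unif ^+ b; have nB : B != 0 by rewrite expf_neq0 ?unif_neq0.
have {}eDe : De = s * B * wD by rewrite {1}eDe ez' expfzDr ?unif_neq0 // -exprnP.
(* The change of frame [N] gives [pull t w - w = De * N k1 k0 / pull t al], which is [unif ^ b]
   times an element of [V]. *)
have [t tt|c Vc] := @semi_invariant_constant _ K i b w Vw.
  pose N := invmx g *m map_mx (pull t) g.
  have eN r : pull t (g r k0) = g r k0 * N k0 k0 + g r k1 * N k1 k0.
    have /matrixP /(_ r k0) : map_mx (pull t) g = g *m N by rewrite mulKVmx.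
    by rewrite mxE => ->; rewrite mxE (sum2 k0).
  have npal : pull t al != 0 by rewrite fmorph_eq0.
  have ea : pull t al = cst K (chi i t) ^ z * s * pull t w0.
    by rewrite {1}eal rmorphM fmorphXz /= pull_unif // expfzMl.
  have nchi : chi i t != 0 by rewrite mulf_neq0 ?invr_neq0 ?tau_neq0.
  have ncz : cst K (chi i t) ^ z != 0 by rewrite expfz_neq0 // cst_eq0.
  have npw : pull t w0 != 0 by rewrite fmorph_eq0.
  have -> : (pull t w - w) / unif ^+ b =
      wD * (N k1 k0 * (cst K (chi i t) ^ (- z) * pull t w0^-1)).
    have -> : pull t w - w = De * N k1 k0 / pull t al.
      apply: (mulIf npal); rewrite divfK // /w fmorph_div /= mulrBl divfK //.
      rewrite [pull t be]eN {1}[pull t al]eN /De.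
      rewrite -/al -/ga -/be -/de; move: (N _ _) (N _ _) => x y.
      by rewrite /w; field.
    rewrite eDe ea fmorphV -invr_expz -/B; move: (N _ _) (pull t w0) npw ncz => x y ny.
    move: (cst K _ ^ z) => X nX; field.
    by rewrite ns nB ny nX.
  have Vpw : V (pull t w0^-1) by apply: Oloc_line_pull.
  rewrite -[0]addr0; apply: (OlocM hV) => //; rewrite -[0]addr0; apply: (OlocM hV).
    exact: inv.
  by rewrite -[0]addr0; apply: (OlocM hV) => //; apply: Vcstz.
pose e := (w - cst K c) / B.
(* Finitely many elements of [V] are simultaneously regular at a general point of the line. *)
have [f|m [G [hG DG reg]]] := @Oloc_spread_seq C K _ hV 0 [:: w0; w0^-1; ga / s; wD; wD^-1; e].
  by rewrite !inE => /or4P [/eqP->|/eqP->|/eqP->|/or3P[/eqP->|/eqP->|/eqP->]] //; exact: Ventry.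
have : rst i (F * G) != 0 by rewrite rstM mulf_neq0.
move=> /rst_neq0_pt [q [q0 nq]]; rewrite mevalM mulf_eq0 negb_or => /andP [Fq Gq].
have nq0 : q != 0 by apply: (@pt_neq0 _ _ j); rewrite nq // ij_neq.
have hq := at_pt_place nq0.
have qj : q ord0 j != 0 by rewrite nq // ij_neq.
have Ow0 : Oloc (at_pt q) 0 (w0) by apply: (reg q Gq); rewrite !inE eqxx ?orbT.
have Ow0' : Oloc (at_pt q) 0 (w0^-1) by apply: (reg q Gq); rewrite !inE eqxx ?orbT.
have Oga : Oloc (at_pt q) 0 (ga / s) by apply: (reg q Gq); rewrite !inE eqxx ?orbT.
have OwD : Oloc (at_pt q) 0 (wD) by apply: (reg q Gq); rewrite !inE eqxx ?orbT.
have OwD' : Oloc (at_pt q) 0 (wD^-1) by apply: (reg q Gq); rewrite !inE eqxx ?orbT.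
have Oe : Oloc (at_pt q) 0 (e) by apply: (reg q Gq); rewrite !inE eqxx ?orbT.
have Ou : Oloc (at_pt q) 0 unif.
  by apply: (@Oloc_intro _ _ _ 1 1); rewrite ?homogX ?addr0 ?at_ptX.
have OB : Oloc (at_pt q) 0 B by apply: (OlocX hq).
have OM (x y : K) : Oloc (at_pt q) 0 x -> Oloc (at_pt q) 0 y -> Oloc (at_pt q) 0 (x * y).
  by move=> hx hy; rewrite -[0]addr0; apply: (OlocM hq).
(* Replacing the multiplier [w] by the constant [c] costs only the regular correction [e], as [A3]
   shows. *)
pose l r := if r == r0 then - c else 1.
have lr1 : l r1 = 1 by rewrite /l [r1 == _]eq_sym (negPf (neq_lift _ _)).
exists q, l, z, b; split=> //; first by exists r1; rewrite lr1 oner_neq0.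
move=> v.
have elin : linform l v = v r1 0 - cst K c * v r0 0.
  rewrite /linform (sum2 r0) -/r1 lr1 /l eqxx /cst mpolyC1 dh1 mpolyCN dhN.
  by ring.
have es : unif ^ (- z) = s^-1 by rewrite /s invr_expz.
have esB : unif ^ (- z - b%:Z) = s^-1 * B^-1.
  by rewrite expfzDr ?unif_neq0 // es -exprnN.
rewrite esB elin es eE //.
pose x := invmx g *m v; pose x0 := x k0 0; pose x1 := x k1 0.
have ev r : v r 0 = g r k0 * x0 + g r k1 * x1.
  by rewrite -[v in LHS](mulKVmx ug) -/x mxE (sum2 k0).
have A1 : s^-1 * v r0 0 = w0 * x0 + ga / s * x1.
  by rewrite ev -/al -/ga eal; field.
have A2 : s^-1 * B^-1 * (v r1 0 - w * v r0 0) = wD * x1.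
  have -> : v r1 0 - w * v r0 0 = De * x1.
    by rewrite !ev -/al -/ga -/be -/de /De /w; field.
  by rewrite eDe; field; rewrite ns nB.
have A3 : s^-1 * B^-1 * (v r1 0 - cst K c * v r0 0) =
          wD * x1 + e * (s^-1 * v r0 0).
  by rewrite -A2 /e; field; rewrite ns nB.
have all2 (Q : 'I_2 -> Prop) (r : 'I_2) : Q r -> Q (lift r 0) -> forall k', Q k'.
  by move=> h1 h2 k'; case: (unliftP r k') => [d|] ->; rewrite ?ord1.
split=> [hx|[hr hl]].
  have hx0 : Oloc (at_pt q) 0 x0 := hx k0; have hx1 : Oloc (at_pt q) 0 x1 := hx k1.
  have h0 : Oloc (at_pt q) 0 (s^-1 * v r0 0).
    by rewrite A1; apply: (OlocD hq); apply: OM.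
  have hl : Oloc (at_pt q) 0 (s^-1 * B^-1 * (v r1 0 - cst K c * v r0 0)).
    by rewrite A3; apply: (OlocD hq); apply: OM.
  split=> //; apply: (all2 _ r0) => //.
  have -> : s^-1 * v (lift r0 0) 0 = B * (s^-1 * B^-1 * (v r1 0 - cst K c * v r0 0)) + cst K c * (s^-1 * v r0 0).
    by rewrite -/r1; field; rewrite ns nB.
  by apply: (OlocD hq); apply: OM => //; exact: OlocC.
have h1 : Oloc (at_pt q) 0 x1.
  have -> : x1 = wD^-1 * (s^-1 * B^-1 * (v r1 0 - cst K c * v r0 0) - e * (s^-1 * v r0 0)).
    by rewrite A3 addrK mulKf.
  exact: (OM _ _ OwD' (OlocB hq hl (OM _ _ Oe (hr r0)))).
apply: (all2 _ k0) => //.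
have -> : (invmx g *m v) k0 0 = w0^-1 * (s^-1 * v r0 0 - ga / s * x1).
  by rewrite A1 addrK mulKf.
apply: (OM _ _ Ow0'); exact: (OlocB hq (hr r0) (OM _ _ Oga h1)).
Qed.

End LineNormalForm.

(** * Trivializing the equivariant structure *)

Section Cocycle.
Variables (C : closedFieldType) (K : model C).
Local Notation A2 := {mpoly C[2]}.
Local Notation A4 := {mpoly C[4]}.
Local Notation pull := (@mpull C K).
Local Notation emb := (emb K).
Implicit Types (s t : C * C) (v w : 'I_2 -> C).

Definition pt4 t v (i : 'I_4) : C := [tuple t.1; t.2; v 0; v 1]`_i.

Lemma meval_specialize t (F : A4) v : (specialize t F).@[v] = F.@[pt4 t v].
Proof.
apply: meval_comp => -[[|[|[|[|//]]]] hi]; rewrite /pt4 /= ?mevalC ?mevalXU //.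
Qed.

Definition shift t v (i : 'I_2) : C := [tuple t.1 * v 0; t.2 * v 1]`_i.

Lemma meval_scale t (P : A2) v : (scale_vars t P).@[v] = P.@[shift t v].
Proof.
by apply: meval_comp => -[[|[|//]] hi]; rewrite /shift /= mevalZ mevalXU.
Qed.

Lemma mpoly2_eq (P Q : A2) : (forall v, (forall i, v i != 0) -> P.@[v] = Q.@[v]) -> P = Q.
Proof.
move=> h; apply/eqP; rewrite -subr_eq0; apply/negPn/negP => /mpoly_nonroot [v [nv]].
by rewrite mevalB h // subrr eqxx.
Qed.

Lemma emb_neq0 (P : A2) : P != 0 -> emb P != 0.
Proof. by move=> nP; rewrite -(rmorph0 emb) (inj_eq (@emb_inj _ K)). Qed.

(** Clears denominators, turning an identity between fractions into one between polynomials, which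
    can be evaluated at points. *)
Lemma emb_quotient_sum (n : nat) (P Q U V : A2) (a y : 'I_n -> A2) :
  Q != 0 -> U != 0 -> V != 0 ->
  (emb P / emb Q = \sum_j emb (a j) / emb U * (emb (y j) / emb V)) <->
  P * (U * V) = (\sum_j a j * y j) * Q.
Proof.
move=> /emb_neq0 nQ /emb_neq0 nU /emb_neq0 nV.
have -> : \sum_j emb (a j) / emb U * (emb (y j) / emb V) = emb (\sum_j a j * y j) / emb (U * V).
  rewrite rmorph_sum mulr_suml; apply: eq_bigr => j _.
  by rewrite mulf_div !rmorphM.
have nUV : emb (U * V) != 0 by rewrite rmorphM mulf_neq0.
split=> [/eqP|e]; first by rewrite eqr_div // -!rmorphM (inj_eq (@emb_inj _ K)) => /eqP.
by apply/eqP; rewrite eqr_div // -!rmorphM e.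
Qed.

Lemma meval_sumM (n : nat) v (P : A2) (a y : 'I_n -> A2) :
  ((\sum_j a j * y j) * P).@[v] = (\sum_j (a j).@[v] * (y j).@[v]) * P.@[v].
Proof.
rewrite mevalM (big_morph (meval v) (mevalD v) (meval0 v)); congr (_ * _).
by apply: eq_bigr => j _; rewrite mevalM.
Qed.

Lemma scale_vars_neq0 t (P : A2) : torus t -> P != 0 -> scale_vars t P != 0.
Proof.
move=> [ta tb] /mpoly_nonroot [v [nv Pv]]; apply: contraNneq Pv => e.
have -> : P.@[v] = (scale_vars t P).@[shift (t.1^-1, t.2^-1) v].
  rewrite meval_scale; apply: meval_eq => -[[|[|//]] hi] /=; rewrite /shift /= mulVKf //;
    by congr v; apply/val_inj.
by rewrite e meval0.
Qed.

(* [Phi t z : E_(t z) -> E_z]; fixing [z] and writing [w = t z], the map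
   [A w := Phi (w / z) z] trivializes the cocycle. *)
Lemma cocycle_trivial (Phi : C * C -> 'M[K]_2) (N : 'M[A4]_2) (D : A4) :
  (forall t, torus t -> specialize t D != 0 /\
     forall i j, Phi t i j = emb (specialize t (N i j)) / emb (specialize t D)) ->
  (forall t, torus t -> Phi t \in unitmx) ->
  (forall s t, torus s -> torus t -> Phi (s * t) = Phi t *m map_mx (pull t) (Phi s)) ->
  exists2 A : 'M[K]_2, A \in unitmx &
    forall s, torus s -> A *m Phi s = map_mx (pull s) A.
Proof.
move=> alg uPhi coc.
have emb_eq0 P : (emb P == 0) = (P == 0).
  by rewrite -(rmorph0 emb) (inj_eq (@emb_inj _ K)).
have t1 : torus (1 : C * C) by split; rewrite oner_neq0.
have detE (f : {rmorphism A4 -> A2}) (d : K) :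
    \det (d *: map_mx (emb \o f) N) = d ^+ 2 * emb (f (\det N)).
  by rewrite detZ; congr (_ * _); rewrite (det_map_mx (emb \o f)).
have [D1 eP1] := alg 1 t1.
have nN1 : specialize 1 (\det N) != 0.
  have := uPhi 1 t1; rewrite unitmxE unitfE.
  have -> : Phi 1 = (emb (specialize 1 D))^-1 *: map_mx (emb \o comp_mpoly [tuple (1 : C * C).1%:MP; (1 : C * C).2%:MP; 'X_(0 : 'I_2); 'X_(1 : 'I_2)]) N.
    by apply/matrixP => i j; rewrite eP1 !mxE mulrC.
  by rewrite detE mulf_eq0 negb_or emb_eq0 => /andP [].
(* At [w = z] the substitution [nu] gives [t = 1], so this choice keeps [nu D] and [nu (\det N)]
   nonzero. *)
have /mpoly_nonroot [z [nz]] := mulf_neq0 D1 nN1.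
rewrite mevalM mulf_eq0 negb_or !meval_specialize => /andP [Dz Nz].
pose nuT : 4.-tuple A2 := [tuple (z 0)^-1 *: 'X_(0 : 'I_2); (z 1)^-1 *: 'X_(1 : 'I_2); (z 0)%:MP; (z 1)%:MP].
pose nu (F : A4) : A2 := F \mPo nuT.
pose quo w : C * C := (w 0 / z 0, w 1 / z 1).
have nuE F w : (nu F).@[w] = F.@[pt4 (quo w) z].
  apply: meval_comp => -[[|[|[|[|//]]]] hi]; rewrite /pt4 /nuT /= ?mevalC ?mevalZ ?mevalXU //=.
    by rewrite mulrC.
  by rewrite mulrC.
have quoz : quo z = 1 by rewrite /quo !divff.
have nD : nu D != 0 by apply: contraNneq Dz => e; rewrite -quoz -nuE e meval0.
have nN : nu (\det N) != 0 by apply: contraNneq Nz => e; rewrite -quoz -nuE e meval0.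
exists ((emb (nu D))^-1 *: map_mx (emb \o comp_mpoly nuT) N).
  rewrite unitmxE unitfE detE mulf_neq0 ?expf_neq0 ?invr_neq0 ?emb_eq0 //.
move=> s ts; have [Ds ePs] := alg s ts.
(* The cocycle condition for [s] and [t = w / z], evaluated at [z], is this identity at the point
   [w]. *)
have key i k : (\sum_j nu (N i j) * specialize s (N j k)) * scale_vars s (nu D) =
    scale_vars s (nu (N i k)) * (nu D * specialize s D).
  apply: mpoly2_eq => w nw; pose t := quo w.
  have tt : torus t by split; rewrite /= mulf_neq0 ?invr_neq0.
  have tst : torus (s * t).
    by case: ts tt => sa sb [ta tb]; split; rewrite /= mulf_neq0.
  have [Dt ePt] := alg t tt; have [Dst ePst] := alg _ tst.
  have [ta tb] := tt.
  have e : specialize (s * t) (N i k) * (specialize t D * scale_vars t (specialize s D)) =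
     (\sum_j specialize t (N i j) * scale_vars t (specialize s (N j k))) * specialize (s * t) D.
    apply/(emb_quotient_sum _ _ _ Dst Dt (scale_vars_neq0 tt Ds)).
    have /matrixP /(_ i k) := coc s t ts tt; rewrite ePst !mxE => ->.
    apply: eq_bigr => j _; rewrite mxE ePt ePs; congr (_ * _).
    by rewrite fmorph_div; congr (_ / _); rewrite mpullE.
  have eshift : forall F : A4, (scale_vars t (specialize s F)).@[z] = F.@[pt4 s w].
    move=> F; rewrite meval_scale meval_specialize; apply: meval_eq => -[[|[|[|[|//]]]] hi] //=;
      by rewrite /pt4 /shift /= divfK.
  have esc : forall F : A4, (scale_vars s (nu F)).@[w] = F.@[pt4 (s * t) z].
    move=> F; rewrite meval_scale nuE; apply: meval_eq => -[[|[|[|[|//]]]] hi] //=;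
      by rewrite /pt4 /quo /shift /= mulrA.
  have := congr1 (meval z) e; rewrite meval_sumM [in LHS]mevalM [(_ * scale_vars _ _).@[_]]mevalM.
  rewrite !meval_specialize eshift => e'.
  rewrite [RHS]mevalM [(nu D * _).@[_]]mevalM !esc [(nu D).@[_]]nuE -/t [(specialize s D).@[_]]meval_specialize. rewrite e' meval_sumM meval_specialize.

  by congr (_ * _); apply: eq_bigr => j _; rewrite nuE !meval_specialize eshift.
apply/matrixP => i k; rewrite !mxE.
have [sa sb] := ts.
transitivity (\sum_j emb (nu (N i j)) / emb (nu D) * (emb (specialize s (N j k)) / emb (specialize s D))).
  by apply: eq_bigr => j _; rewrite ePs !mxE [_^-1 * _]mulrC.
transitivity (emb (scale_vars s (nu (N i k))) / emb (scale_vars s (nu D))).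
  by apply/esym/(emb_quotient_sum _ _ _ (scale_vars_neq0 ts nD) nD Ds).
rewrite rmorphM fmorphV [RHS]mulrC.
congr (_ / _); by rewrite /= mpullE.
Qed.

End Cocycle.

(** * Classification of torus-stable bundles *)

Section Classification.
Variables (C : closedFieldType) (K : model C).
Local Notation S := {mpoly C[3]}.
Local Notation pt := 'rV[C]_3.
Local Notation vec := 'cV[K]_2.
Local Notation pull := (@mpull C K).
Implicit Types (F G : S) (f : K) (p q : pt) (u v : vec).
Implicit Types (g h : 'M[K]_2) (E : pt -> set vec) (t : C * C).
Implicit Types (a : 'I_3 -> int) (l m : 'I_2 -> C).

Definition mon a : K := \prod_c Xk K c ^ (- a c).

Lemma prod_ord3 (R : comPzRingType) (i : 'I_3) (h : 'I_3 -> R) :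
  \prod_c h c = h i * (h (lift i 0) * h (lift i 1)).
Proof.
rewrite (bigD1_ord i) //= big_ord_recl big_ord1; congr (_ * (h _ * h (lift i _))).
exact/val_inj.
Qed.

Lemma sum_ord3_lift (V : zmodType) (i : 'I_3) (h : 'I_3 -> V) :
  \sum_c h c = h i + (h (lift i 0) + h (lift i 1)).
Proof.
rewrite (bigD1_ord i) //= big_ord_recl big_ord1; congr (_ + (h _ + h (lift i _))).
exact/val_inj.
Qed.

Lemma mon_neq0 a : mon a != 0.
Proof. by apply/prodf_neq0 => c _; rewrite expfz_neq0 ?Xk_neq0. Qed.

Lemma mon_pull t a : torus t -> exists2 x, x != 0 & pull t (mon a) = cst K x * mon a.
Proof.
move=> tt; exists (\prod_c tau t c ^ (- a c)).
  by apply/prodf_neq0 => c _; rewrite expfz_neq0 ?tau_neq0.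
have cstV x : x != 0 -> cst K x^-1 = (cst K x)^-1.
  move=> nx; have ncx : cst K x != 0 by rewrite cst_eq0.
  by apply: (mulfI ncx); rewrite mulfV // -cstM mulfV // /cst mpolyC1 dh1.
have cstX x (n : nat) : cst K (x ^+ n) = cst K x ^+ n.
  by elim: n => [|n IH]; [rewrite !expr0 /cst mpolyC1 dh1 | rewrite !exprS cstM IH].
have cstz x (y : int) : x != 0 -> cst K (x ^ y) = cst K x ^ y.
  move=> nx; case: y => n; first by rewrite -!exprnP cstX.
  by rewrite NegzE -!exprnN cstV ?expf_neq0 // cstX.
have one : cst K 1 = 1 by rewrite /cst mpolyC1 dh1.
rewrite rmorph_prod (big_morph (cst K) (@cstM _ K) one) -big_split.
by apply: eq_bigr => c _; rewrite /= fmorphXz pull_Xk // expfzMl cstz ?tau_neq0.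
Qed.

(** The variables other than [x_i] are invertible at [q], so only the exponent [a i] matters; powers
    of the others adjust the degree. *)
Lemma Oloc_mon_line q (i : 'I_3) (k : int) a f : q != 0 -> (forall d, d != i -> q ord0 d != 0) ->
  Oloc (at_pt q) (k - \sum_c a c) (mon a * f) <-> Oloc (at_pt q) k (unif K i ^ (- a i) * f).
Proof.
move=> nq qd; have hq := at_pt_place nq.
have nj : q ord0 (lift i 0) != 0 by apply: qd; rewrite eq_sym neq_lift.
have nl : q ord0 (lift i 1) != 0 by apply: qd; rewrite eq_sym neq_lift.
have -> : mon a * f = Xk K (lift i 1) ^ (- a (lift i 1)) *
    (Xk K (lift i 0) ^ (- a (lift i 0) - a i) * (unif K i ^ (- a i) * f)).
  rewrite /mon (prod_ord3 i) /unif expfzMl exprz_inv opprK expfzDr ?Xk_neq0 //.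
  have : Xk K (lift i 0) ^ a i != 0 by rewrite expfz_neq0 ?Xk_neq0.
  rewrite -[Xk K (lift i 0) ^ (- a i)]invr_expz; move: (Xk K (lift i 0) ^ a i) => x nx.
  by move: (_ ^ _) (_ ^ _) (_ ^ _) => y1 y2 y3; field.
have -> : k - \sum_c a c = k + (- a (lift i 0) - a i) + - a (lift i 1).
  by rewrite (sum_ord3_lift i); ring.
split=> [/(Oloc_XzM hq)|h].
  by move=> /(_ (at_ptX nl))/(Oloc_XzM hq); apply; exact: at_ptX.
by apply/(Oloc_XzM hq); [exact: at_ptX | apply/(Oloc_XzM hq) => //; exact: at_ptX].
Qed.

(** A sum of two line bundles given by divisors: the [r]-th coordinate has order at least [a r c]
    along [x_c = 0]. *)
Definition sumL (a : 'I_2 -> 'I_3 -> int) (p : pt) : set vec :=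
  [set v | forall r, Oloc (at_pt p) (- \sum_c a r c) (mon (a r) * v r 0)].

Lemma lfree_comp E h : h \in unitmx -> lfree E -> lfree (fun p => [set v | E p (h *m v)]).
Proof.
move=> uh fE p np; have [k [F [g [hF Fp ug eE]]]] := fE p np.
have U : invmx h *m g \in unitmx by rewrite unitmx_mul unitmx_inv uh.
have e : invmx (invmx h *m g) = invmx g *m h.
  by rewrite -[RHS](mulKmx U) -mulmxA (mulKVmx ug) mulVmx // mulmx1.
exists k, F, (invmx h *m g); split=> //.
move=> q nq Fq; apply/seteqP; split=> v; rewrite /= eE // => hv r;
  by have := hv r; rewrite e mulmxA.
Qed.

Lemma Syz_lfree b n : lfree (@Syz C K b n).
Proof.
move=> p np; have [_ _ [j pj]] := at_pt_place np.
have [g ug eg] := Syz_frame K b n j.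
rewrite /at_pt mevalXU in pj.
exists 1%N, 'X_j, g; split; rewrite ?homogX ?mevalXU //.
by move=> q nq; rewrite mevalXU; exact: eg.
Qed.

Lemma sumL_lfree (a : 'I_2 -> 'I_3 -> int) : lfree (sumL a).
Proof.
move=> p np; have [_ _ [j pj]] := at_pt_place np; rewrite /at_pt mevalXU in pj.
pose phi (r : 'I_2) v := Xk K j ^ (\sum_c a r c) * (mon (a r) * v r 0).
have [| | |g ug eg] := @frame_of_functionals C K phi.
- by move=> r u v; rewrite /phi mxE !mulrDr.
- by move=> r f v; rewrite /phi mxE; ring.
- move=> v h; apply/colP => r; rewrite mxE; apply: (mulfI (mon_neq0 (a r))).
  have nz : Xk K j ^ (\sum_c a r c) != 0 by rewrite expfz_neq0 ?Xk_neq0.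
  by apply: (mulfI nz); rewrite !mulr0; apply: h.
exists 1%N, 'X_j, g; split; rewrite ?homogX ?mevalXU //.
move=> q nq; rewrite mevalXU => qj; have hq := at_pt_place nq.
have e r f : Oloc (at_pt q) 0 (Xk K j ^ (\sum_c a r c) * f) <-> Oloc (at_pt q) (- \sum_c a r c) f.
  rewrite -{1}(addNr (\sum_c a r c)); apply: (Oloc_XzM hq); exact: at_ptX.
by apply/seteqP; split=> v hv r; [rewrite eg /phi; apply/e/hv | apply/e; have := hv r; rewrite eg].
Qed.

Lemma invar_functionals (I : finType) (phi : I -> vec -> K) (n : I -> int) E :
  (forall p v, p != 0 -> E p v <-> forall c, Oloc (at_pt p) (n c) (phi c v)) ->
  (forall t c, torus t -> exists2 x, x != 0 & forall v, phi c (pullv t v) = cst K x * pull t (phi c v)) ->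
  invar E.
Proof.
move=> eE ephi t p v tt np; rewrite !eE //; last exact: act_neq0.
have hp := at_pt_place np.
split=> h c; have [x nx ex] := ephi t c tt.
  apply/(Oloc_pull p (n c) _ tt).
  have ncx : cst K x != 0 by rewrite cst_eq0.
  have -> : pull t (phi c v) = cst K x^-1 * phi c (pullv t v).
    rewrite ex mulrA -cstM mulVf // /cst mpolyC1 dh1 mul1r.
    by [].
  by rewrite -[n c]add0r; apply: (OlocM hp) => //; exact: OlocC.
rewrite ex -[n c]add0r; apply: (OlocM hp); first exact: OlocC.
exact/(Oloc_pull p (n c) _ tt).
Qed.

Lemma pullv_linform t l v : torus t -> linform l (pullv t v) = pull t (linform l v).
Proof.
move=> tt; rewrite /linform rmorph_sum; apply: eq_bigr => r _.
by rewrite rmorphM /= pull_cst // mxE.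
Qed.

Lemma Syz_invar b n : invar (@Syz C K b n).
Proof.
apply: (@invar_functionals _ (fun c v => Xk K c ^- b c * lc v c) (fun c => n - (b c)%:Z)).
  by move=> p v np.
move=> t c tt; exists (tau t c ^+ b c); first by rewrite expf_neq0 ?tau_neq0.
move=> v; have -> : lc (pullv t v) c = pull t (lc v c).
  rewrite /lc !mxE; case: ifP => _ //; case: ifP => _ //.
  by rewrite rmorphN rmorphD.
rewrite rmorphM fmorphV rmorphXn /= pull_Xk // mulrA; congr (_ * _).
have -> : cst K (tau t c ^+ b c) = cst K (tau t c) ^+ b c.
  by elim: (b c) => [|k IH]; [rewrite !expr0 /cst mpolyC1 dh1 | rewrite !exprS cstM IH].
have nt : cst K (tau t c) ^+ b c != 0 by rewrite expf_neq0 // cst_eq0 tau_neq0.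
by rewrite exprMn invfM mulrA mulfV // mul1r.
Qed.

Definition cr l m : C := l 0 * m 1 - l 1 * m 0.

Lemma linform2 l v : linform l v = cst K (l 0) * v 0 0 + cst K (l 1) * v 1 0.
Proof.
rewrite /linform big_ord_recl big_ord1; congr (_ + cst K (l _) * v _ _); exact/val_inj.
Qed.

Lemma cstD x y : cst K (x + y) = cst K x + cst K y.
Proof. by rewrite /cst mpolyCD dhD. Qed.
Lemma cstN x : cst K (- x) = - cst K x.
Proof. by rewrite /cst mpolyCN dhN. Qed.

Lemma linform_basis l m (r : 'I_2) : cr l m != 0 ->
  exists x y, forall v, v r 0 = cst K x * linform l v + cst K y * linform m v.
Proof.
move=> nd; have nc : cst K (cr l m) != 0 by rewrite cst_eq0.
have key x y : exists x' y', cst K x' = cst K x / cst K (cr l m) /\ cst K y' = cst K y / cst K (cr l m).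
  exists (x / cr l m), (y / cr l m); split; apply: (mulIf nc); by rewrite divfK // -cstM divfK.
case: (unliftP 0 r) => [k|] ->; last first.
  have [x [y [ex ey]]] := key (m 1) (- l 1); exists x, y => v.
  move: nc ex ey; rewrite !linform2 /cr cstD !cstN !cstM => + -> ->.
  move: (cst K _) (cst K _) (cst K _) (cst K _) (v _ _) (v _ _) => x1 x2 x3 x4 x5 x6 nc.
  by field.
have [x [y [ex ey]]] := key (- m 0) (l 0); exists x, y => v.
have -> : lift 0 k = 1 by apply/val_inj; rewrite ord1.
move: nc ex ey; rewrite !linform2 /cr cstD !cstN !cstM => + -> ->.
move: (cst K _) (cst K _) (cst K _) (cst K _) (v _ _) (v _ _) => x1 x2 x3 x4 x5 x6 nc.
by field.
Qed.

(** Two independent forms of the family recover both coordinates of [v], and the other forms ask for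
    no more than order [z]. Only the form of index [c0] sees the jump [b], hence has to be
    proportional to [l] unless [b = 0]. *)
Lemma line_match (I : finType) (m : I -> 'I_2 -> C) (y : I -> int) (c0 : I)
    (i : 'I_3) q l (z : int) (b : nat) :
  q != 0 -> (forall d, d != i -> q ord0 d != 0) ->
  (forall c, c != c0 -> y c = z) -> y c0 = z + b%:Z ->
  (b = 0%N \/ exists2 x, x != 0 & forall r, m c0 r = x * l r) ->
  (exists c1 c2, cr (m c1) (m c2) != 0) ->
  forall v, (forall r, Oloc (at_pt q) 0 (unif K i ^ (- z) * v r 0)) /\
             Oloc (at_pt q) 0 (unif K i ^ (- z - b%:Z) * linform l v) <->
    forall c, Oloc (at_pt q) 0 (unif K i ^ (- y c) * linform (m c) v).
Proof.
move=> nq qd yz yc0 ml [c1 [c2 ncr]] v; have hq := at_pt_place nq.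
have qj : q ord0 (lift i 0) != 0 by apply: qd; rewrite eq_sym neq_lift.
have OM (x x' : K) : Oloc (at_pt q) 0 x -> Oloc (at_pt q) 0 x' -> Oloc (at_pt q) 0 (x * x').
  by move=> hx hy; rewrite -[0]addr0; apply: (OlocM hq).
have Oc x : Oloc (at_pt q) 0 (cst K x) by exact: OlocC.
have Ou : Oloc (at_pt q) 0 (unif K i ^+ b).
  apply: (OlocX hq); apply: (@Oloc_intro _ _ _ 1 1); rewrite ?homogX ?addr0 //.
  exact: at_ptX.
have lin (x : K) k : (forall r, Oloc (at_pt q) 0 (x * v r 0)) -> Oloc (at_pt q) 0 (x * linform k v).
  move=> h; rewrite /linform mulr_sumr; apply: (Oloc_sum hq) => r _.
  by rewrite mulrCA; apply: OM.
have nu := unif_neq0 K i.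
have bu (f : K) : unif K i ^ (- z) * f = unif K i ^+ b * (unif K i ^ (- z - b%:Z) * f).
  by rewrite mulrA exprnP -expfzDr //; congr (_ ^ _ * _); ring.
split=> [[hv hl] c|h].
  have [->|nc] := eqVneq c c0; last by rewrite yz //; apply: lin.
  rewrite yc0; case: ml => [b0|[x nx e]].
    by rewrite b0 addr0; apply: lin.
  have -> : linform (m c0) v = cst K x * linform l v.
    by rewrite !linform2 !e !cstM; ring.
  by rewrite mulrCA opprD; apply: OM.
have hz c : Oloc (at_pt q) 0 (unif K i ^ (- z) * linform (m c) v).
  have [->|nc] := eqVneq c c0; last by rewrite -(yz c) //; apply: h.
  by rewrite bu; apply: OM => //; have := h c0; rewrite yc0 opprD.
have hv r : Oloc (at_pt q) 0 (unif K i ^ (- z) * v r 0).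
  have [x [x' ->]] := linform_basis r ncr.
  by rewrite mulrDr; apply: (OlocD hq); rewrite mulrCA; apply: OM.
split=> //; case: ml => [b0|[x nx e]].
  by rewrite b0 subr0; apply: lin.
have -> : linform l v = cst K x^-1 * linform (m c0) v.
  rewrite !linform2 !e !cstM mulrDr !mulrA -!cstM mulVf //.
  by rewrite !mul1r.
by rewrite mulrCA; apply: OM => //; have := h c0; rewrite yc0 opprD.
Qed.

(** Syzygy bundles and sums of line bundles are both cut out by monomials times constant linear
    forms, so comparing them with [E] takes one point on each line. *)
Lemma eq_functionals (I : finType) (m : I -> 'I_2 -> C) (a : I -> 'I_3 -> int) E E' :
  lfree E -> invar E -> lfree E' ->
  (forall p, E' p = [set v | forall c, Oloc (at_pt p) (- \sum_d a c d) (mon (a c) * linform (m c) v)]) ->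
  (forall i : 'I_3, exists q, [/\ q ord0 i = 0, forall d, d != i -> q ord0 d != 0 &
     forall v, E q v <-> forall c, Oloc (at_pt q) 0 (unif K i ^ (- a c i) * linform (m c) v)]) ->
  forall p, p != 0 -> E p = E' p.
Proof.
move=> fE iE fE' eE' lines; apply: eq_of_orbits => //.
  apply: (@invar_functionals I (fun c v => mon (a c) * linform (m c) v) (fun c => - \sum_d a c d)).
    by move=> p v _; rewrite eE'.
  move=> t c tt; have [x nx ex] := mon_pull (a c) tt.
  exists x^-1; first by rewrite invr_neq0.
  move=> v; rewrite pullv_linform // rmorphM /= ex !mulrA -cstM mulVf //.
  by rewrite /cst mpolyC1 dh1 mul1r.
move=> i; have [q [q0 qd eq]] := lines i; exists q; split=> //.
have nq : q != 0 by apply: (@pt_neq0 _ _ (lift i 0)); apply: qd; rewrite eq_sym neq_lift.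
rewrite eE'; apply/seteqP; split=> v; rewrite eq => h c.
  by rewrite -[X in Oloc _ X]add0r; apply/(Oloc_mon_line 0 (a c) _ nq qd).
by apply/(Oloc_mon_line 0 (a c) _ nq qd); rewrite add0r; apply: h.
Qed.

Lemma inj_unitmx (M : 'M[K]_2) : (forall v, M *m v = 0 -> v = 0) -> M \in unitmx.
Proof.
move=> inj; rewrite -unitmx_tr -row_free_unit; apply: inj_row_free => v e.
apply: trmx_inj; rewrite trmx0; apply: inj.
by have := congr1 trmx e; rewrite trmx_mul trmxK trmx0.
Qed.

Lemma cr0_prop l m : (exists r, l r != 0) -> (exists r, m r != 0) -> cr l m = 0 ->
  exists2 x, x != 0 & forall r, l r = x * m r.
Proof.
move=> [r lr] [s ms] /eqP; rewrite subr_eq0 => /eqP e.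
have ord2 (k : 'I_2) : k = 0 \/ k = 1.
  by case: (unliftP 0 k) => [k'|] ->; [right; apply/val_inj; rewrite ord1|left].
have sw k k' : l k * m k' = l k' * m k.
  by case: (ord2 k) => ->; case: (ord2 k') => ->; rewrite // e.
exists (l s / m s); last by move=> k; rewrite mulrAC -sw mulfK.
rewrite mulf_neq0 ?invr_neq0 //; apply: contra_neq lr => ls.
by apply: (mulIf ms); rewrite sw ls !mul0r.
Qed.

Lemma linform_inj l m v : cr l m != 0 -> linform l v = 0 -> linform m v = 0 -> v = 0.
Proof.
move=> n lv mv; apply/colP => r; have [x [y ->]] := linform_basis r n.
by rewrite lv mv !mulr0 addr0 mxE.
Qed.

Theorem invariant_classification E : lfree E -> invar E ->
  (exists (a : 'I_2 -> 'I_3 -> int) h, isoh h E (sumL a)) \/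
  (exists b n h, (forall i, (0 < b i)%N) /\ isoh h E (@Syz C K b n)).
Proof.
move=> fE iE.
have /choice [D hD] : forall i : 'I_3, exists D : pt * ('I_2 -> C) * int * nat,
    let: (q, l, z, b) := D in
    [/\ q ord0 i = 0, forall k, k != i -> q ord0 k != 0, exists r, l r != 0 &
     forall v, E q v <-> (forall r, Oloc (at_pt q) 0 (unif K i ^ (- z) * v r 0)) /\
                       Oloc (at_pt q) 0 (unif K i ^ (- z - b%:Z) * linform l v)].
  by move=> i; have [q [l [z [b h]]]] := line_normal_form i fE iE; exists (q, l, z, b).
pose q i := (D i).1.1.1; pose l i := (D i).1.1.2; pose z i := (D i).1.2; pose b i := (D i).2.
have {hD} lines i : [/\ (q i) ord0 i = 0, forall k, k != i -> (q i) ord0 k != 0, exists r, l i r != 0 &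
     forall v, E (q i) v <-> (forall r, Oloc (at_pt (q i)) 0 (unif K i ^ (- z i) * v r 0)) /\
                       Oloc (at_pt (q i)) 0 (unif K i ^ (- z i - (b i)%:Z) * linform (l i) v)].
  by have := hD i; rewrite /q /l /z /b; case: (D i) => [[[? ?] ?] ?].
have nq i : q i != 0.
  have [_ qd _ _] := lines i; apply: (@pt_neq0 _ _ (lift i 0)); apply: qd.
  by rewrite eq_sym neq_lift.
have nl i : exists r, l i r != 0 by have [] := lines i.
have [[b_gt0 ncr]|deg] := pselect ((forall i, 0 < b i)%N /\ forall i j, i != j -> cr (l i) (l j) != 0).
  right; have [n01 n02 n12] := ord3_neq.
  (* Cramer's rule: rescaled by these coefficients, the three forms sum to zero, so they serve as
     the coordinates [lc] of a vector. *)
  pose mu (c : 'I_3) : C := if c == 0 then cr (l 1) (l 2%:R)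
    else if c == 1 then cr (l 2%:R) (l 0) else cr (l 0) (l 1).
  have nmu c : mu c != 0.
    by rewrite /mu; case: (ord3P c) => -> /=; apply: ncr.
  pose m c r := mu c * l c r.
  have m2 r : m 2%:R r = - (m 0 r + m 1 r).
    rewrite /m /mu /= /cr; case: (unliftP 0 r) => [k|] ->; last by ring.
    have -> : lift 0 k = 1 by apply/val_inj; rewrite ord1.
    by ring.
  have m01 : cr (m 0) (m 1) != 0.
    have -> : cr (m 0) (m 1) = mu 0 * mu 1 * cr (l 0) (l 1) by rewrite /cr /m; ring.
    by rewrite !mulf_neq0 ?ncr.
  (* The common orders [z] are absorbed by the monomial [mon z], which accounts for the degree
     [n]. *)
  pose a0 : 'I_3 -> int := z; pose n := - \sum_d z d.
  pose a (c d : 'I_3) : int := z d + (if d == c then (b d)%:Z else 0).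
  have asum c : - \sum_d a c d = n - (b c)%:Z.
    by rewrite /n /a big_split /= opprD; congr (_ - _); rewrite -big_mkcond big_pred1_eq.
  have amon c : mon (a c) = Xk K c ^- b c * mon z.
    rewrite /mon /a (bigD1 c) // [in RHS](bigD1 c) //= eqxx opprD expfzDr ?Xk_neq0 //.
    rewrite -exprnN [X in X * _]mulrC -!mulrA; congr (_ * (_ * _)).
    by apply: eq_bigr => d /negPf ->; rewrite addr0.
  pose h : 'M[K]_2 := \matrix_(c, r) (mon z * cst K (m (widen_ord (isT : (2 <= 3)%N) c) r)).
  have ehv v c : lc (h *m v) c = mon z * linform (m c) v.
    have row k : (h *m v) k 0 = mon z * linform (m (widen_ord (isT : (2 <= 3)%N) k)) v.
      by rewrite mxE mulr_sumr; apply: eq_bigr => r _; rewrite mxE mulrA.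
    rewrite /lc !row; have e0 : widen_ord (isT : (2 <= 3)%N) 0 = 0 by exact/val_inj.
    have e1 : widen_ord (isT : (2 <= 3)%N) 1 = 1 by exact/val_inj.
    rewrite e0 e1; case: (ord3P c) => -> //=.
    by rewrite -mulrDr -mulrN; congr (_ * _); rewrite !linform2 !m2 !cstN !cstD; ring.
  have uh : h \in unitmx.
    apply: inj_unitmx => v hv0; apply: (linform_inj m01).
      by apply: (mulfI (mon_neq0 z)); rewrite -ehv hv0 mulr0 -(scale0r 0) lcZ mul0r.
    by apply: (mulfI (mon_neq0 z)); rewrite -ehv hv0 mulr0 -(scale0r 0) lcZ mul0r.
  exists b, n, h; split=> //; apply: isohP => // p v np.
  have -> : E p = [set v | Syz b n p (h *m v)].
    apply: (@eq_functionals _ m a E (fun p => [set v | Syz b n p (h *m v)])) np => //.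
    - exact: lfree_comp (Syz_lfree _ _).
    - move=> p'; apply/seteqP; split=> v' hv c.
        by rewrite asum amon -mulrA -ehv; apply: hv.
      by rewrite ehv mulrA -amon -asum; apply: hv.
    move=> i; have [q0 qd _ eq] := lines i; exists (q i); split=> // v'.
    rewrite eq; apply: (@line_match _ m (fun c => a c i) i) => //.
    - by move=> c ci; rewrite /a eq_sym (negPf ci) addr0.
    - by rewrite /a eqxx.
    - by right; exists (mu i).
    - by exists 0, 1.
  by [].
left.
(* Some [b i] is 0 or two of the lines coincide; either way all indices but one impose nothing or
   the line of [l x]. *)
have [k [x hk]] : exists k x, forall c, c != k -> b c = 0%N \/ exists2 y, y != 0 & forall r, l x r = y * l c r.
  have [i [j [ij]]] : exists i j, i != j /\ (b i = 0%N \/ cr (l j) (l i) = 0).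
    apply: contrapT => no; apply: deg; split=> [i|i j ij].
      rewrite lt0n; apply/eqP => bi; apply: no; exists i, (lift i 0).
      by split; [exact: neq_lift|left].
    by apply/eqP => e; apply: no; exists j, i; split; [rewrite eq_sym|right].
  have third : exists k, forall c, c != k -> c = i \/ c = j.
    case: (ord3P i) ij => ->; case: (ord3P j) => -> // _;
      first [exists 0 => c; case: (ord3P c) => -> // _; by [left|right]
            |exists 1 => c; case: (ord3P c) => -> // _; by [left|right]
            |exists 2%:R => c; case: (ord3P c) => -> // _; by [left|right]].
  move=> bc; have [k hk] := third; exists k, j => c /hk [->|->].
    by case: bc => [->|/cr0_prop e]; [left|right; apply: e].
  by right; exists 1; rewrite ?oner_neq0 // => r; rewrite mul1r.
(* A basis of forms adapted to the three lines: [l x], completed by [l k], or arbitrarily when these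
   are proportional. [e c] tells which of the two serves the index [c]. *)
have [P1 [e [nP hP]]] : exists (P1 : 'I_2 -> C) (e : 'I_3 -> bool), cr (l x) P1 != 0 /\
    forall c, b c = 0%N \/ exists2 y, y != 0 & forall r, (if e c then P1 else l x) r = y * l c r.
  have [lk0|nlk] := eqVneq (cr (l x) (l k)) 0.
    have [P1 nP] : exists P1 : 'I_2 -> C, cr (l x) P1 != 0.
      have [r lr] := nl x; case: (unliftP 0 r) lr => [r'|] -> lr.
        exists (fun s => if s == 0 then 1 else 0); rewrite /cr /= mulr0 mulr1 sub0r oppr_eq0.
        by move: lr; have -> : lift 0 r' = 1 by apply/val_inj; rewrite ord1.
      by exists (fun s => if s == 0 then 0 else 1); rewrite /cr /= mulr0 mulr1 subr0.
    exists P1, (fun=> false); split=> // c.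
    have [->|/hk //] := eqVneq c k.
    by right; apply: cr0_prop.
  exists (l k), (fun c => c == k); split=> // c.
  have [->|/hk //] := eqVneq c k.
  by right; exists 1; rewrite ?oner_neq0 // => r; rewrite mul1r.
pose m (r : 'I_2) := if r == 0 then l x else P1.
pose ce (c : 'I_3) : 'I_2 := if e c then 1 else 0.
have mce c : m (ce c) = if e c then P1 else l x by rewrite /m /ce; case: (e c).
pose a (r : 'I_2) (d : 'I_3) : int := z d + (if r == ce d then (b d)%:Z else 0).
pose h : 'M[K]_2 := \matrix_(r, s) cst K (m r s).
have ehv v r : (h *m v) r 0 = linform (m r) v.
  by rewrite mxE; apply: eq_bigr => s _; rewrite mxE.
have m01 : cr (m 0) (m 1) != 0 by [].
have uh : h \in unitmx.
  by apply: inj_unitmx => v hv0; apply: (linform_inj m01); rewrite -ehv hv0 mxE.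
exists a, h; apply: isohP => // p v np.
have -> : E p = [set v | sumL a p (h *m v)].
  apply: (@eq_functionals _ m a E (fun p => [set v | sumL a p (h *m v)])) np => //.
  - exact: lfree_comp (sumL_lfree _).
  - by move=> p'; apply/seteqP; split=> v' hv c; have := hv c; rewrite ehv.
  move=> i; have [q0 qd _ eq] := lines i; exists (q i); split=> // v'.
  rewrite eq; apply: (@line_match _ m (fun c => a c i) (ce i)) => //.
  - by move=> c ci; rewrite /a (negPf ci) addr0.
  - by rewrite /a eqxx.
  - by rewrite mce; exact: hP.
  - by exists 0, 1.
by [].
Qed.

End Classification.

(** * Bundles up to twist *)

Section PullMorphism.
Variables (C : closedFieldType) (L : fieldType) (e : {rmorphism {mpoly C[2]} -> L}).
Hypothesis e_inj : injective e.
Hypothesis e_frac : forall f, exists P Q, Q != 0 /\ f = e P / e Q.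
Variables (t : C * C) (pf : L -> L).
Hypothesis tt : torus t.
Hypothesis pfE : forall f, exists P Q,
  [/\ Q != 0, f = e P / e Q & pf f = e (scale_vars t P) / e (scale_vars t Q)].
Local Notation sv := (scale_vars t).

Let e_neq0 P : P != 0 -> e P != 0.
Proof. by move=> nP; rewrite -(rmorph0 e) (inj_eq e_inj). Qed.

Let svM P Q : sv (P * Q) = sv P * sv Q. Proof. exact: rmorphM. Qed.
Let svD P Q : sv (P + Q) = sv P + sv Q. Proof. exact: rmorphD. Qed.
Let svN P : sv (- P) = - sv P. Proof. exact: rmorphN. Qed.

(** [pull_fun] is computed on a chosen representative; independence of the choice is what makes it a
    ring morphism. *)
Lemma pull_frac P Q : Q != 0 -> pf (e P / e Q) = e (sv P) / e (sv Q).
Proof.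
move=> nQ; have [P' [Q' [nQ' ef ->]]] := pfE (e P / e Q).
move/eqP: ef; rewrite eqr_div ?e_neq0 // -!(rmorphM e) (inj_eq e_inj) => /eqP ef.
apply/eqP; rewrite eqr_div ?e_neq0 ?scale_vars_neq0 // -!(rmorphM e) (inj_eq e_inj).
by rewrite -!svM ef.
Qed.

Lemma pull_zmod_morphism : zmod_morphism pf.
Proof.
move=> f g; have [P [Q [nQ ->]]] := e_frac f; have [P' [Q' [nQ' ->]]] := e_frac g.
have nQQ : Q * Q' != 0 by rewrite mulf_neq0.
have -> : e P / e Q - e P' / e Q' = e (P * Q' + (- P') * Q) / e (Q * Q').
  by rewrite -mulNr addf_div ?e_neq0 // !rmorphD !(rmorphM e) rmorphN.
rewrite !pull_frac // svD !svM svN -mulNr addf_div ?e_neq0 ?scale_vars_neq0 //.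
by rewrite !rmorphD !(rmorphM e) rmorphN.
Qed.

Lemma pull_monoid_morphism : monoid_morphism pf.
Proof.
split=> [|f g].
  have -> : 1 = e 1 / e 1 by rewrite rmorph1 divr1.
  by rewrite pull_frac ?oner_neq0 // /scale_vars comp_mpoly1.
have [P [Q [nQ ->]]] := e_frac f; have [P' [Q' [nQ' ->]]] := e_frac g.
have nQQ : Q * Q' != 0 by rewrite mulf_neq0.
have -> : e P / e Q * (e P' / e Q') = e (P * P') / e (Q * Q').
  by rewrite mulf_div !(rmorphM e).
by rewrite !pull_frac // !svM mulf_div !(rmorphM e).
Qed.

End PullMorphism.

(** * The function field of the plane as a model *)

Section FunctionField.
Variable C : closedFieldType.
Local Notation A2 := {mpoly C[2]}.

Lemma tofrac_inj : injective (@FracField.tofrac A2).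
Proof. by move=> P Q e; apply/eqP; rewrite -tofrac_eq e. Qed.

Lemma tofrac_surj (f : {fraction A2}) :
  exists P Q, Q != 0 /\ f = FracField.tofrac P / FracField.tofrac Q.
Proof. by exists \n_(repr f), \d_(repr f); split; [exact: denom_ratioP|exact: fracE]. Qed.

Lemma pull_funE (t : C * C) (f : {fraction A2}) : exists P Q,
  [/\ Q != 0, f = FracField.tofrac P / FracField.tofrac Q &
      pull_fun t f = FracField.tofrac (scale_vars t P) / FracField.tofrac (scale_vars t Q)].
Proof. by exists \n_(repr f), \d_(repr f); split; [exact: denom_ratioP|exact: fracE|]. Qed.

Definition pull_rmorphism (t : C * C) (ht : torus t) : {rmorphism {fraction A2} -> {fraction A2}} :=
  HB.pack (pull_fun t : {fraction A2} -> {fraction A2})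
    (GRing.isZmodMorphism.Build {fraction A2} {fraction A2} (pull_fun t)
       (pull_zmod_morphism tofrac_inj tofrac_surj ht (pull_funE t)))
    (GRing.isMonoidMorphism.Build {fraction A2} {fraction A2} (pull_fun t)
       (pull_monoid_morphism tofrac_inj tofrac_surj ht (pull_funE t))).

(** A model asks for a morphism at every pair; off the torus, where substitution may kill
    denominators, the identity is a default value. *)
Definition pull_total (t : C * C) : {rmorphism {fraction A2} -> {fraction A2}} :=
  if pselect (torus t) is left ht then pull_rmorphism ht else idfun.

Lemma pull_totalE t : torus t -> pull_total t =1 pull_fun t.
Proof. by rewrite /pull_total; case: pselect. Qed.

Lemma pull_total_tofrac t P : t.1 != 0 -> t.2 != 0 ->
  pull_total t (FracField.tofrac P) = FracField.tofrac (scale_vars t P).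
Proof.
move=> ta tb; have tt : torus t by [].
rewrite pull_totalE //.
have := pull_frac tofrac_inj tt (pull_funE t) P (oner_neq0 A2).
by rewrite /scale_vars comp_mpoly1 rmorph1 !divr1.
Qed.

Definition planeModel : model C :=
  @Model C {fraction A2} (@FracField.tofrac A2) tofrac_inj tofrac_surj pull_total pull_total_tofrac.

End FunctionField.

(** * Twists modulo d, trivialized structures and decompositions *)

Section Properties.
Variables (C : closedFieldType) (K : model C).
Local Notation pt := 'rV[C]_3.
Local Notation vec := 'cV[K]_2.
Local Notation pull := (@mpull C K).
Implicit Types (p q : pt) (u v : vec) (h : 'M[K]_2) (E : pt -> set vec).

Lemma tw_tw m n E p : lfree E -> p != 0 -> tw m (tw n E) p = tw (m + n) E p.
Proof.
move=> fE np; have [k [F [g [hF Fp ug /(_ p np Fp) eE]]]] := fE p np.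
rewrite (tw_lat _ np eE) (@tw_lat _ _ m (n + 0) (tw n E) p g) // ?addrA //.
exact: tw_lat.
Qed.

Lemma tw0 E p : lfree E -> p != 0 -> tw 0 E p = E p.
Proof.
move=> fE np; have [k [F [g [hF Fp ug /(_ p np Fp) eE]]]] := fE p np.
by rewrite (tw_lat _ np eE) addr0 eE.
Qed.

Lemma H1v_tw_Syz b n m : (forall i, 0 < b i)%N ->
  H1v (tw m (@Syz C K b n)) <-> ~ (0 <= n + m <= (\sum_i (b i).-1)%N%:Z).
Proof.
move=> b_gt0; have e p : p != 0 -> tw m (@Syz C K b n) p = Syz b (n + m) p.
  exact: tw_Syz.
rewrite -(H1v_Syz _ b_gt0); split; apply: isoh_H1v; first exact: isoh_eq.
by apply: isoh_sym; apply: isoh_eq.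
Qed.

Definition eqv (d : nat) E E' := exists t h, isoh h E' (tw (d%:Z * t) E).

Lemma eqv_sym d E E' : lfree E -> eqv d E E' -> eqv d E' E.
Proof.
move=> fE [t [h ih]]; exists (- t), (1%:M *m invmx h *m 1%:M).
have e p : p != 0 -> E p = tw (d%:Z * - t) (tw (d%:Z * t) E) p.
  by move=> np; rewrite tw_tw // mulrN addNr tw0.
apply: isoh_trans (isoh_eq e) _; apply: isoh_trans (isoh_tw _ (isoh_sym ih)) _.
exact: isoh_eq.
Qed.

Lemma eqv_trans d E E' E'' : lfree E -> eqv d E E' -> eqv d E' E'' -> eqv d E E''.
Proof.
move=> fE [t [h ih]] [t' [h' ih']]; exists (t' + t), (1%:M *m (h *m h')).
apply: isoh_trans (isoh_trans ih' (isoh_tw _ ih)) _.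
by apply: isoh_eq => p np; rewrite tw_tw // mulrDr.
Qed.

(** A twist by a multiple of [d] replaces [n] by its remainder [r]. As [0 <= r], vanishing of [H^1]
    there puts [r] beyond the upper end of the interval. *)
Lemma aCM_Syz_remainder b n (d : nat) : (0 < d)%N -> (forall i, 0 < b i)%N ->
  (forall t : int, H1v (tw (d%:Z * t) (@Syz C K b n))) ->
  exists r : nat, [/\ (r < d)%N, (\sum_i (b i).-1 < r)%N & eqv d (@Syz C K b n) (Syz b r%:Z)].
Proof.
move=> d_gt0 b_gt0 van; have d0 : d%:Z != 0 by lia.
have r0 := modz_ge0 n d0; have rd := ltz_pmod n (d_gt0 : 0 < d%:Z).
have en := divz_eq n d%:Z.
exists `|(n %% d%:Z)%Z|%N.
have er : (`|(n %% d%:Z)%Z|%N : int) = n + d%:Z * - (n %/ d%:Z)%Z by rewrite gez0_abs //; lia.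
split; first by lia.
  have /(H1v_tw_Syz _ _ b_gt0) := van (- (n %/ d%:Z)%Z).
  rewrite -er; lia.
exists (- (n %/ d%:Z)%Z), 1%:M; apply: isoh_eq => p np.
by rewrite tw_Syz // -er.
Qed.

(** [r + d t] exceeds the upper end for [t >= 0] and is negative for [t < 0], because [r < d]. *)
Lemma Syz_aCM b (r d : nat) : (r < d)%N -> (\sum_i (b i).-1 < r)%N -> (forall i, 0 < b i)%N ->
  forall t : int, H1v (tw (d%:Z * t) (@Syz C K b r%:Z)).
Proof.
move=> rd br b_gt0 t; apply/(H1v_tw_Syz _ _ b_gt0) => /andP [].
have [t0|t0] := Order.TotalTheory.leP 0 t; nia.
Qed.

Lemma Syz_eqv_inj (b b' : 'I_3 -> nat) (r r' d : nat) : (r < d)%N -> (r' < d)%N ->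
  (forall i, 0 < b i)%N -> (forall i, 0 < b' i)%N ->
  eqv d (@Syz C K b r%:Z) (Syz b' r'%:Z) -> b =1 b' /\ r = r'.
Proof.
move=> rd rd' b0 b0' [t [h ih]].
have e p : p != 0 -> tw (d%:Z * t) (@Syz C K b r%:Z) p = Syz b (r%:Z + d%:Z * t) p.
  exact: tw_Syz.
have [eb er] := Syz_isoh_inj b0' b0 (isoh_trans ih (isoh_eq e)).
split=> [i|]; first by rewrite eb.
have : t = 0 by nia.
by move=> t0; move: er; rewrite t0; lia.
Qed.

Lemma invar_trivialized E (Phi : C * C -> 'M[K]_2) (A : 'M[K]_2) : A \in unitmx ->
  (forall t, torus t -> A *m Phi t = map_mx (pull t) A) ->
  (forall t p v, torus t -> p != 0 -> E p (Phi t *m pullv t v) <-> E (act t p) v) ->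
  invar (fun p => [set v | E p (invmx A *m v)]).
Proof.
move=> uA eA eE t p v tt np; rewrite /= -(eE t p _ tt np).
have -> : Phi t *m pullv t (invmx A *m v) = invmx A *m pullv t v.
  apply: (can_inj (mulKmx uA)); rewrite mulmxA eA // mulKVmx // /pullv map_mxM mulmxA.
  by rewrite -map_mxM mulmxV // map_mx1 mul1mx.
by [].
Qed.

Lemma isoh_comp E h : h \in unitmx -> isoh h E (fun p => [set v | E p (invmx h *m v)]).
Proof. by move=> uh; apply: isohP => // p v np; rewrite /= mulKmx. Qed.

(** The projection to the first summand would be an idempotent endomorphism of trace 1. *)
Lemma Syz_indecomposable b n h (L : 'I_2 -> pt -> set 'cV[K]_1) : (forall i, 0 < b i)%N ->
  (forall i p, p != 0 -> L i p 0) ->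
  ~ isoh h (@Syz C K b n) (fun p => [set v | forall i, L i p (row i v)]).
Proof.
move=> b_gt0 L0 ih; have [uh _] := ih.
pose d : 'M[K]_2 := delta_mx 0 0; pose e := invmx h *m d *m h.
have dd : d *m d = d by rewrite mul_delta_mx.
have tr : \tr e = 1.
  rewrite /e mxtrace_mulC mulmxA mulmxV // mul1mx /mxtrace.
  by rewrite !big_ord_recl big_ord0 !mxE /= !addr0.
have ee : e *m e = e.
  by rewrite /e -!mulmxA; congr (_ *m _); rewrite mulKVmx // mulmxA dd.
have pres p v : p != 0 -> Syz b n p v -> Syz b n p (e *m v).
  move=> np hv; apply/(isoh_mem _ ih np) => i.
  have -> : h *m (e *m v) = d *m (h *m v) by rewrite /e -!mulmxA mulKVmx.
  have /(isoh_mem _ ih np)/(_ i) hi := hv.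
  have -> : row i (d *m (h *m v)) = (i == 0)%:R *: row i (h *m v).
    apply/rowP => k; rewrite !mxE big_ord_recl big_ord1 !mxE.
    by case: (unliftP 0 i) => [i'|] -> /=; rewrite ?(mul0r, mul1r, addr0, add0r) // mulr0.
  by case: eqP => _; rewrite ?scale1r ?scale0r //; apply: L0.
by have := Syz_no_idempotent b_gt0 pres ee; rewrite tr eqxx.
Qed.

Definition line (a : 'I_3 -> int) p : set 'cV[K]_1 :=
  [set v | Oloc (at_pt p) (- \sum_c a c) (mon K a * v 0 0)].

Lemma line_frame (a : 'I_3 -> int) j : exists2 g : 'M[K]_1, g \in unitmx &
  forall q, q != 0 -> q ord0 j != 0 ->
  line a q = [set g *m w | w in [set w : 'cV[K]_1 | forall i, Oloc (at_pt q) 0 (w i 0)]].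
Proof.
pose x := Xk K j ^ (\sum_c a c) * mon K a.
have nx : x != 0 by rewrite mulf_neq0 ?mon_neq0 // expfz_neq0 ?Xk_neq0.
exists (x^-1)%:M; first by rewrite unitmxE det_scalar1 unitfE invr_neq0.
move=> q nq qj; have hq := at_pt_place nq.
have e f : Oloc (at_pt q) 0 (x * f) <-> Oloc (at_pt q) (- \sum_c a c) (mon K a * f).
  rewrite -{1}(addNr (\sum_c a c)) -mulrA; apply: (Oloc_XzM hq); exact: at_ptX.
apply/seteqP; split=> [v /e hv|_ [w hw <-]].
  exists (x *: v); first by move=> i; rewrite mxE ord1.
  by rewrite mul_scalar_mx scalerA mulVf // scale1r.
by apply/e; rewrite mul_scalar_mx mxE mulVKf.
Qed.

Lemma sumL_line (a : 'I_2 -> 'I_3 -> int) p :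
  sumL (K := K) a p = [set v | forall i, line (a i) p (row i v)].
Proof. by apply/seteqP; split=> v hv r; have := hv r; rewrite /line /= mxE. Qed.

End Properties.

(** * Counting the parameters *)

Lemma param_list (d : nat) : (0 < d)%N -> exists L : seq (seq nat),
  [/\ uniq L, size L = 'C(d.+2, 4) &
      forall s, (s \in L) = (size s == 4) && (sumn s + 2 <= d)%N].
Proof.
case: d => [//|[|d]] _.
  by exists [::]; split=> // s; rewrite in_nil; apply/esym/negP => /andP [] _; rewrite addn2.
(* Here [d] is two less than the original one, so the tuples of sum at most [d] number
   ['C(d + 4, 4)]. *)
pose P := [set t : 4.-tuple 'I_d.+1 | (\sum_(i <- t) i <= d)%N]%SET.
have es (t : 4.-tuple 'I_d.+1) : sumn (map val t) = (\sum_(i <- t) i)%N.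
  by rewrite sumnE big_map.
exists [seq map val (tval t) | t <- enum P]; split.
- rewrite map_inj_uniq ?enum_uniq // => t t' /inj_map e.
  by apply/val_inj/e/val_inj.
- by rewrite size_map -cardE card_partial_ord_partitions.
move=> s; apply/mapP/andP => [[t]|[/eqP zs hs]].
  by rewrite mem_enum inE => ht ->; rewrite size_map size_tuple es; split => //; lia.
have bnd x : x \in s -> (x < d.+1)%N.
  move=> xs; suff : (x <= sumn s)%N by lia.
  by rewrite sumnE (big_rem x) //= leq_addr.
have zt : size (map inord s : seq 'I_d.+1) == 4 by rewrite size_map zs.
have ev : s = map val (Tuple zt).
  rewrite -map_comp map_id_in // => x /bnd h; by rewrite /= inordK.
exists (Tuple zt) => //; rewrite mem_enum inE -es -ev; lia.
Qed.

Lemma bin4_rat (d : nat) : (0 < d)%N ->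
  ('C(d.+2, 4)%:R : rat) = (d%:R - 1) * d%:R * (d%:R + 1) * (d%:R + 2) / 24.
Proof.
case: d => // d _.
have := bin_ffact d.+3 4; rewrite !ffactnS ffactn0 muln1 /= !factS fact0.
have -> : (4 * (3 * (2 * (1 * 1))) = 24)%N by [].
move=> /(congr1 (fun n : nat => n%:R : rat)); rewrite !natrM => e.
have n24 : (24%:R : rat) != 0 by [].
apply: (mulIf n24); rewrite e mulfVK //.
rewrite -[in RHS]natr1 -[in LHS]natr1 -[in X in _ = X]natr1.
ring.
Qed.

(** * The set of classes and its cardinality *)

Section Classes.
Variable C : closedFieldType.
Local Notation K := (planeModel C).
Local Notation pt := 'rV[C]_3.

Lemma vbundle_lfree (E : vbundle C 2) : @lfree C K (vstalk E).
Proof.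
move=> p np; have [k [F [g [hF Fp ug eE]]]] := vbundleP E np.
exists k, F, g; split=> // q nq Fq; rewrite eE //.
exact: (@lat_image C K (at_pt q) g ug).
Qed.

Lemma lfree_locally_free (E : stalks C 2) : @lfree C K E -> locally_free E.
Proof.
move=> fE p np; have [k [F [g [hF Fp ug eE]]]] := fE p np.
exists k, F, g; split=> // q nq Fq; rewrite eE //.
by rewrite -(@lat_image C K (at_pt q) g ug).
Qed.

Definition SyzB (b : 'I_3 -> nat) (n : int) : vbundle C 2 :=
  VBundle (lfree_locally_free (@Syz_lfree C K b n)).

Lemma H1_vanishesP (E : stalks C 2) : H1_vanishes E <-> @H1v C K E.
Proof.
by split=> [h s [s1 s2]|h s s1 s2]; [have [m hm] := h s s1 s2; exists m|exact: h (conj s1 s2)].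
Qed.

Lemma aCMP d (E : stalks C 2) :
  aCM d E <-> forall t : int, @H1v C K (@tw C K (d%:Z * t) E).
Proof. by split=> h t; apply/H1_vanishesP; apply: h. Qed.

Lemma line_locally_free (a : 'I_3 -> int) : @locally_free C 1 (@line C K a).
Proof.
move=> p np; have [_ _ [j pj]] := at_pt_place np; rewrite /at_pt mevalXU in pj.
have [g ug eg] := @line_frame C K a j.
exists 1%N, 'X_j, g; split; rewrite ?homogX ?mevalXU // => q nq.
by rewrite mevalXU => qj; rewrite eg.
Qed.

Lemma locally_free0 r (E : vbundle C r) (p : pt) : p != 0 -> vstalk E p 0.
Proof.
move=> np; have [k [F [g [_ Fp _ ->//]]]] := vbundleP E np.
exists 0; rewrite ?mulmx0 // => i; rewrite mxE.
exact: (@Oloc0 C K _ (at_pt_place np)).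
Qed.

Lemma split_sumL a h (E : stalks C 2) : @isoh C K h E (@sumL C K a) -> split_bundle E.
Proof.
move=> ih; exists (fun i => VBundle (line_locally_free (a i))), (1%:M *m h).
apply: (isoh_trans ih); apply: isoh_eq => p np; exact: sumL_line.
Qed.

Lemma SyzB_nonsplit b n : (forall i, 0 < b i)%N -> ~ split_bundle (SyzB b n).
Proof.
move=> b_gt0 [L [h ih]].
apply: (@Syz_indecomposable C K b n h (fun i => vstalk (L i)) b_gt0) ih => i p.
exact: locally_free0.
Qed.

(** In its embedding into [K^2] the bundle is already stable under the torus, so the constant family
    1 is a structure. *)
Lemma SyzB_equivariant b n : admits_equivariant_structure (SyzB b n).
Proof.
exists (fun=> 1%:M); split.
- exists 1%:M, 1 => t _; rewrite /specialize comp_mpoly1 oner_neq0; split=> // i j.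
  rewrite rmorph1 divr1 !mxE; case: (i == j); first by rewrite comp_mpoly1 rmorph1.
  by rewrite comp_mpoly0 rmorph0.
- move=> t tt; split; first exact: unitmx1.
  move=> p np; apply/seteqP; split=> [_ [_ [v hv <-] <-]|v hv].
    rewrite mul1mx; have := @Syz_invar C K b n t p v tt np.
    by rewrite /pullv (eq_map_mx _ (pull_totalE tt)) => -[_]; apply.
  exists v; last exact: mul1mx.
  have ti := torus_inv tt.
  exists (@pullv C K (tinv t) v).
    apply/(@Syz_invar C K b n (tinv t) _ _ ti (act_neq0 tt np)).
    by rewrite actK.
  rewrite -(eq_map_mx _ (pull_totalE tt)).
  by apply/matrixP => i j; rewrite !mxE; exact: (@pullVK C K t).
- move=> s t ts tt.
  rewrite mul1mx.
  rewrite -(eq_map_mx _ (pull_totalE tt)).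
  rewrite (map_mx1 (pull_total t)).
  by [].
Qed.

Lemma toric_classification (E : vbundle C 2) : admits_equivariant_structure E ->
  (exists a h, @isoh C K h (vstalk E) (@sumL C K a)) \/
  (exists b n h, (forall i, (0 < b i)%N) /\ @isoh C K h (vstalk E) (@Syz C K b n)).
Proof.
move=> [Phi [[N [D alg]] iso coc]].
have uPhi t : torus t -> Phi t \in unitmx by move=> /iso [].
have [] := @cocycle_trivial C K Phi N D alg uPhi.
  move=> s t ts tt.
  have -> : map_mx (mpull K t) (Phi s) = map_mx (pull_fun t) (Phi s).
    by apply: eq_map_mx; apply: pull_totalE.
  by apply: coc.
move=> A uA eA.
have fE := vbundle_lfree E.
have uVA : invmx A \in unitmx by rewrite unitmx_inv.
have iE t p v : torus t -> p != 0 ->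
    vstalk E p (Phi t *m @pullv C K t v) <-> vstalk E (act t p) v.
  move=> tt np; have [ut /(_ p np) eE] := iso t tt; rewrite -[in X in X <-> _]eE.
  split=> [[_ [w hw <-]] /(can_inj (mulKmx ut))|hv].
    by rewrite -(eq_map_mx _ (pull_totalE tt)) => /map_mx_inj <-.
  exists (@pullv C K t v) => //; exists v => //.
  by rewrite -(eq_map_mx _ (pull_totalE tt)).
have iA := @isoh_comp C K (vstalk E) A uA.
have fE' := @lfree_comp C K (vstalk E) (invmx A) uVA fE.
have iE' := @invar_trivialized C K (vstalk E) Phi A uA eA iE.
have [[a [h ih]]|[b [n [h [b_gt0 ih]]]]] := @invariant_classification C K _ fE' iE'.
  left; exists a, (h *m A); exact: (isoh_trans iA ih).
right; exists b, n, (h *m A); split; first exact: b_gt0.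
exact: (isoh_trans iA ih).
Qed.

Definition toric_class d (b : 'I_3 -> nat) (r : nat) : set (vbundle C 2) :=
  [set F | equiv_up_to_twist d (SyzB b r) F].

Lemma equiv_eqv d (E F : vbundle C 2) :
  equiv_up_to_twist d E F <-> @eqv C K d (vstalk E) (vstalk F).
Proof. by []. Qed.

Lemma class_eq d (E E' : vbundle C 2) : equiv_up_to_twist d E E' ->
  [set F : vbundle C 2 | equiv_up_to_twist d E F] =
  [set F : vbundle C 2 | equiv_up_to_twist d E' F].
Proof.
move=> /equiv_eqv e; have fE := vbundle_lfree E; have fE' := vbundle_lfree E'.
apply/seteqP; split=> F /equiv_eqv h; apply/equiv_eqv.
  exact: (@eqv_trans C K d _ _ _ fE' (eqv_sym fE e) h).
exact: (@eqv_trans C K d _ _ _ fE e h).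
Qed.

Lemma toric_aCM_classesE d : (0 < d)%N ->
  toric_aCM_classes C d 2 = [set c | exists (b : 'I_3 -> nat) (r : nat),
    [/\ forall i, (0 < b i)%N, (\sum_i (b i).-1 < r)%N, (r < d)%N & c = toric_class d b r]].
Proof.
move=> d_gt0; apply/seteqP; split=> [_ [E [nsE aE eqE] <-]|_ [b [r [b_gt0 br rd ->]]]].
  have [[a [h ih]]|[b [n [h [b_gt0 ih]]]]] := toric_classification eqE.
    by case: nsE; exact: split_sumL ih.
  have [|r [rd br er]] := @aCM_Syz_remainder C K b n d d_gt0 b_gt0.
    by move=> t; apply: (isoh_H1v (isoh_tw _ ih)); move/aCMP: aE; apply.
  exists b, r; split=> //; apply: (@class_eq d E (SyzB b r)); apply/equiv_eqv.
  have fE := vbundle_lfree E; have fS := vbundle_lfree (SyzB b n).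
  apply: (@eqv_trans C K d _ (vstalk (SyzB b n)) _ fE _ er).
  exists 0, (1%:M *m invmx h).
  apply: isoh_trans (isoh_sym ih) _; apply: isoh_eq => p np.
  by rewrite mulr0 tw0.
exists (SyzB b r) => //; split; first exact: SyzB_nonsplit.
  by apply/aCMP; exact: Syz_aCM.
exact: SyzB_equivariant.
Qed.

Lemma toric_class_inj d (b b' : 'I_3 -> nat) (r r' : nat) : (r < d)%N -> (r' < d)%N ->
  (forall i, 0 < b i)%N -> (forall i, 0 < b' i)%N ->
  toric_class d b r = toric_class d b' r' -> b =1 b' /\ r = r'.
Proof.
move=> rd rd' b0 b0' e.
have : toric_class d b' r' (SyzB b' r').
  exists 0, 1%:M; apply: (@isoh_eq C K) => p np.
  by rewrite mulr0; exact: (esym (@tw0 C K _ _ (vbundle_lfree (SyzB b' r')) np)).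
by rewrite -e => /equiv_eqv; apply: Syz_eqv_inj.
Qed.

Lemma card_toric_aCM_classes d : (0 < d)%N ->
  (toric_aCM_classes C d 2 #= `I_('C(d.+2, 4)))%card.
Proof.
move=> d_gt0; have [L [uL zL mL]] := param_list d_gt0.
pose b (s : seq nat) (i : 'I_3) := (nth 0%N s i).+1.
pose f k := toric_class d (b (nth [::] L k)) (sumn (nth [::] L k)).+1.
have -> : toric_aCM_classes C d 2 = f @` `I_(size L).
  rewrite toric_aCM_classesE //; apply/seteqP; split=> [_ [c [r [c0 cr rd ->]]]|_ [k kL <-]].
    (* The last entry makes the sum [r - 1], so that [r] is read off from [s] and [r < d] becomes
       [sumn s + 2 <= d]. *)
    pose s := [:: (c ord0).-1; (c 1).-1; (c 2).-1; (r - (\sum_i (c i).-1).+1)%N].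
    have zs : sumn s = r.-1.
      rewrite /= addn0; move: cr; rewrite !big_ord_recl big_ord0 addn0.
      have -> : lift ord0 ord0 = 1 :> 'I_3 by apply/val_inj.
      have -> : lift ord0 (lift ord0 ord0) = 2 :> 'I_3 by apply/val_inj.
      lia.
    have sL : s \in L by rewrite mL zs; apply/andP; split=> //; lia.
    exists (index s L); first by rewrite /= index_mem.
    have -> : c = b s.
      apply/funext => i; have := c0 i; rewrite /b.
      have [->|->|->] : [\/ i = 0, i = 1 | i = 2].
        by case: i => [[|[|[|//]]] hi]; [apply: Or31|apply: Or32|apply: Or33]; apply/val_inj.
      - by move=> /prednK.
      - by move=> /prednK.
      - by move=> /prednK.
    by rewrite /f (nth_index [::] sL) zs (ltn_predK cr).
  have := mem_nth [::] kL; rewrite mL => /andP [/eqP zs hs].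
  exists (b (nth [::] L k)), (sumn (nth [::] L k)).+1; split=> //; last by rewrite addn2 in hs.
  move: zs; case: (nth [::] L k) => [|x [|y [|z [|w [|//]]]]] // _.
  by rewrite !big_ord_recl big_ord0 /b /=; lia.
rewrite -zL; apply: inj_card_eq => k l; rewrite !inE /= => kL lL.
have := mem_nth [::] kL; have := mem_nth [::] lL; rewrite !mL => /andP [/eqP zl hl] /andP [/eqP zk hk].
rewrite addn2 in hk; rewrite addn2 in hl.
have b0 s i : (0 < b s i)%N by [].
move/(toric_class_inj hk hl (b0 _) (b0 _)) => [e er].
apply/eqP; rewrite -(nth_uniq [::] kL lL uL); apply/eqP.
clear -zl zk e er; move: zl zk e er; case: (nth [::] L k) => [|x [|y [|z [|w [|//]]]]] //.
case: (nth [::] L l) => [|x' [|y' [|z' [|w' [|//]]]]] // _ _ e er.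
have := e 0; have := e 1; have := e 2; rewrite /b /= => -[e2] [e1] [e0].
by move: er; rewrite /= e0 e1 e2 => er; congr [:: _; _; _; _]; lia.
Qed.

End Classes.

Theorem theorem1p1 (R : realType) (d : nat) (hd : (0 < d)%N) :
  exists S : nat,
    (toric_aCM_classes R[i] d 2 #= `I_S)%card /\
    (S%:R : rat) = (d%:R - 1) * d%:R * (d%:R + 1) * (d%:R + 2) / 24.
Proof.
exists 'C(d.+2, 4); split; last exact: bin4_rat.
exact: card_toric_aCM_classes.
Qed.
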